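(* The operator $\tilde\Lambda$, defined by $\tilde\Lambda\phi(x)=\mathrm{P.V.}\int_{\mathbb T^2}(\phi(x)-\phi(x+y))K(y)\,dy$ with the kernel $K$ given in the context, satisfies the following properties. (P1) Let $n\in\mathbb N$, $n\ge 1$. Then $\tilde\Lambda\phi(x)$ is well defined (the principal value limit exists) for every $\phi\in C^2((n+1)\mathbb T^2)$ and every $x\in n\mathbb T^2$. (P2) For every $k\in\mathbb N$, every multi-index $\alpha$ of two nonnegative integers with $|\alpha|=k$, and every $\phi\in C^{k+2}(2\mathbb T^2)$, it holds that $|D^\alpha\tilde\Lambda\phi(x)|\le C\|\phi\|_{W^{k+2,\infty}(2\mathbb T^2)}$ for all $x\in\mathbb T^2$, where $C$ is a positive universal constant independent of $\phi$. (P3) There exist a functional $\mathcal A: C^2(5\mathbb T^2)\to\mathbb R$ and a positive universal constant $C$ (independent of $\phi$) such that for every $\phi\in C^2(5\mathbb T^2)$, $$(\phi,\tilde\Lambda\phi)_{L^2(\mathbb T^2)}\ge\mathcal A(\phi),$$ where $$|\mathcal A(\phi)|\le C\|\phi\|_{L^2(5\mathbb T^2)}^2+C\left|\int_{\partial\mathbb T^2}\left(\mathrm{P.V.}\int_{\mathbb T^2}\frac{y\cdot\nu(x)\,\phi(x+y)^2}{|y|^3}\,dy\right)d\sigma(x)\right|,$$ $\nu$ being the outward unit normal to $\partial\mathbb T^2$ and $d\sigma$ the surface measure on $\partial \mathbb T^2$. In particular, if $\phi=\psi-\widehat\psi\in C^2(5\mathbb T^2)$, where $\psi$ is a periodic function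 on $\mathbb T^2$ (i.e. $2\pi$-periodic in each variable) and $\widehat\psi$ (defined on $5\mathbb T^2$) is smooth on $2\mathbb T^2$, it holds that $$\begin{aligned}|\mathcal A(\psi-\widehat\psi)|\le{}& C\|\psi-\widehat\psi\|_{L^2(5\mathbb T^2)}^2+C\|\widehat\psi^2(\cdot+2\pi i)-\widehat\psi^2(\cdot)\|_{H^1(2\mathbb T^2)}+C\|\widehat\psi^2(\cdot+2\pi j)-\widehat\psi^2(\cdot)\|_{H^1(2\mathbb T^2)}\\&+C\left(\|\psi\|_{L^\infty(\mathbb T^2)}+\|\nabla\psi\|_{L^\infty(\mathbb T^2)}\right)\\&\quad\times\left(\|\widehat\psi(\cdot+2\pi i)-\widehat\psi(\cdot)\|_{H^1(2\mathbb T^2)}+\|\widehat\psi(\cdot+2\pi j)-\widehat\psi(\cdot)\|_{H^1(2\mathbb T^2)}\right).\end{aligned}$$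
   Context: Notation: $\mathbb T^2=[-\pi,\pi]^2$, viewed as a box in $\mathbb R^2$ (identified with the torus only when dealing with periodic functions), and for a positive integer $n$, $n\mathbb T^2=[-n\pi,n\pi]^2$. $i=(1,0)$ and $j=(0,1)$ are the unit coordinate vectors. Functions are real-valued and are not assumed periodic unless stated. A periodic function on $\mathbb T^2$ is identified with its extension to $\mathbb R^2$ that is $2\pi$-periodic in each variable. $C^k(X)$ denotes the functions on $X$ whose derivatives up to order $k$ are continuous and bounded on $X$; $H^k(X)$ and $W^{k,\infty}(X)$ are the usual Sobolev spaces; $(f,g)_{L^2(\mathbb T^2)}=\int_{\mathbb T^2}fg\,dx$. The kernel is $$K(y)=\frac{2\Gamma(3/2)}{|\Gamma(-1/2)|\,\pi}\left(\frac1{|y|^3}+\sum_{k\in\mathbb Z^2\setminus\{0\}}\frac1{|y-2\pi k|^3}\right),$$ and for a (possibly non-periodic) function $\phi$, $$\tilde\Lambda\phi(x)=\mathrm{P.V.}\int_{\mathbb T^2}(\phi(x)-\phi(x+y))K(y)\,dy=\lim_{\epsilon\to0^+}\int_{\mathbb T^2\cap\{|y|>\epsilon\}}(\phi(x)-\phi(x+y))K(y)\,dy .$$ P.V. denotes the Cauchy principal value at $y=0$, as in the last formula. *)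

(* Defs.v *)
From mathcomp Require Import all_boot all_order all_algebra.
From mathcomp Require Import all_classical all_reals all_analysis.

Set Implicit Arguments.
Unset Strict Implicit.
Unset Printing Implicit Defensive.

Import Order.TTheory GRing.Theory Num.Theory.
Import numFieldNormedType.Exports.

Local Open Scope classical_set_scope.
Local Open Scope ring_scope.

Section plane.
Context {R : realType}.
Implicit Types (x y v : R * R) (f : R * R -> R) (X D : set (R * R)).

Definition e1 : R * R := (1, 0).
Definition e2 : R * R := (0, 1).

(* The canonical norm on [R * R] is the sup norm, hence a separate Euclidean
   norm. *)
Definition enorm x : R := Num.sqrt (x.1 ^+ 2 + x.2 ^+ 2).
Definition dot x y : R := x.1 * y.1 + x.2 * y.2.

Definition box (n : nat) : set (R * R) :=
  `[- (n%:R * pi), n%:R * pi] `*` `[- (n%:R * pi), n%:R * pi].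

Definition leb2 :
    {measure set (measurableTypeR R * measurableTypeR R) -> \bar R} :=
  ((@lebesgue_measure R) \x (@lebesgue_measure R))%E.

(* Partial derivatives relative to [X]: the difference quotient only uses
   points of [X]. This is the ordinary derivative at interior points and the
   one-sided one on the sides of a box, and it only depends on the values of
   [f] on [X]. *)
Definition diff_quot v f x (h : R) : R := h^-1 * (f (x + h *: v) - f x).

Definition rderivable X v f x : Prop :=
  cvg (diff_quot v f x @ within [set h | X (x + h *: v)] 0^').

Definition rderive X v f x : R :=
  lim (diff_quot v f x @ within [set h | X (x + h *: v)] 0^').

Definition partials X (a : nat * nat) f : R * R -> R :=
  iter a.1 (rderive X e1) (iter a.2 (rderive X e2) f).

Definition has_partials X (a : nat * nat) f : Prop :=
  (forall m, (m < a.2)%N -> forall x, X x ->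
     rderivable X e2 (iter m (rderive X e2) f) x) /\
  (forall m, (m < a.1)%N -> forall x, X x ->
     rderivable X e1 (iter m (rderive X e1) (iter a.2 (rderive X e2) f)) x).

Fixpoint Ck (k : nat) X f : Prop :=
  {within X, continuous f} /\ [bounded f x | x in X] /\
  (if k is k'.+1 then
     forall v, v = e1 \/ v = e2 ->
       (forall x, X x -> rderivable X v f x) /\ Ck k' X (rderive X v f)
   else True).

Definition smooth X f : Prop := forall k, Ck k X f.

Definition biperiodic f : Prop :=
  forall x, f (x + (pi *+ 2) *: e1) = f x /\ f (x + (pi *+ 2) *: e2) = f x.

Local Open Scope ereal_scope.

Definition Lpnorm (p : \bar R) X f : \bar R :=
  'N[leb2]_p [EFin \o (f \_ X)].

(* The two Sobolev norms are written with classical derivatives; they are meant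
   for functions of class C^k on the box [X], for which these are the weak
   derivatives in the interior of [X]. *)
Definition Wknorm (k : nat) X f : \bar R :=
  \big[maxe/0]_(a : 'I_k.+1 * 'I_k.+1 | (a.1 + a.2 <= k)%N)
    Lpnorm +oo X (partials X (nat_of_ord a.1, nat_of_ord a.2) f).

Definition H1norm X f : \bar R :=
  (Lpnorm 2%:E X f ^+ 2 + Lpnorm 2%:E X (rderive X e1 f) ^+ 2
   + Lpnorm 2%:E X (rderive X e2 f) ^+ 2) `^ (2^-1)%R.

Local Close Scope ereal_scope.

Definition grad_norm X f x : R := enorm (rderive X e1 f x, rderive X e2 f x).

Definition inner X f g : R := \int[leb2]_(x in X) (f x * g x).

Definition truncated_int D f (e : R) : R :=
  \int[leb2]_(y in D `&` [set y | e < enorm y]) f y.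

Definition pv_exists D f : Prop :=
  (forall e : R, 0 < e ->
     leb2.-integrable (D `&` [set y | e < enorm y]) (EFin \o f)) /\
  cvg (truncated_int D f e @[e --> 0^'+]).

Definition pv_int D f : R := lim (truncated_int D f e @[e --> 0^'+]).

(* Euler's Gamma function: the integral for [0 < s], and the recursion
   Gamma(s) = Gamma(s + n) / (s (s + 1) ... (s + n - 1)), with [n] the least
   integer such that [0 < s + n], for negative non-integral [s]. *)
Definition Gamma_pos (s : R) : R :=
  \int[@lebesgue_measure R]_(t in `]0, +oo[) (t `^ (s - 1) * expR (- t)).

Definition Gamma (s : R) : R :=
  let n := if 0 < s then 0%N else (Num.truncn (- s)).+1 in
  Gamma_pos (s + n%:R) / \prod_(i < n) (s + i%:R).

Definition lattice_pt (k : int * int) : R * R :=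
  ((pi *+ 2) * k.1%:~R, (pi *+ 2) * k.2%:~R).

Definition K y : R :=
  2 * Gamma (3 / 2) / (`|Gamma (- (1 / 2))| * pi) *
  (enorm y ^- 3 +
   fine (esum [set k : int * int | k <> (0, 0)]
           (fun k => (enorm (y - lattice_pt k) ^- 3)%:E))).

Definition Lambda_integrand f x y : R := (f x - f (x + y)) * K y.

Definition Lambda f x : R := pv_int (box 1) (Lambda_integrand f x).

(* Integral over the boundary of the box [box 1], with respect to arc length,
   of an integrand [F x nu] depending on the point and the outward unit
   normal. *)
Definition int_bdry (F : R * R -> R * R -> R) : R :=
  let I : set R := `[- pi, pi]%classic in
  \int[@lebesgue_measure R]_(t in I) F (pi, t) e1 +
  \int[@lebesgue_measure R]_(t in I) F (- pi, t) (- e1) +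
  \int[@lebesgue_measure R]_(t in I) F (t, pi) e2 +
  \int[@lebesgue_measure R]_(t in I) F (t, - pi) (- e2).

Definition shift_diff v f x : R := f (x + (pi *+ 2) *: v) - f x.

End plane.

(* Main.v *)
From HB Require Import structures.
Require Import Defs.
From mathcomp Require Import all_boot all_order all_algebra.
From mathcomp Require Import all_classical all_reals all_analysis.
From mathcomp Require Import unstable measurable_realfun ess_sup_inf.
From mathcomp Require Import ring lra.

Set Implicit Arguments.
Unset Strict Implicit.
Unset Printing Implicit Defensive.

Import Order.TTheory GRing.Theory Num.Theory.
Import numFieldNormedType.Exports.
Local Open Scope classical_set_scope.
Local Open Scope ring_scope.

(** Write [K = Kconst * (|y|^-3 + S y)], where the sum [S] over the nonzero lattice
points is bounded and even on the fundamental box. Pairing [y] with [- y]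
replaces [f x - f (x + y)] by half of the second difference
[sdiff f x y = 2 f x - f (x + y) - f (x - y)], which is of the order of [|y|^2]
for [f] of class C^2. Hence the principal value exists and is the absolutely
convergent integral of [sdiff f x y / 2 * K y] ([pv_symmetrise], [sdiff_le],
[Lambda_pv]), with a dominating function that depends on the second derivatives
of [f] only. The same domination allows differentiation under the integral, so
that partial derivatives commute with [Lambda] ([Lambda_rderive],
[Lambda_partials]) and are bounded as [Lambda] itself is.

The functional bounding the quadratic form from below is half of the integral of
[Lambda (phi ^+ 2)] over the box. It is a lower bound since
[phi x * sdiff phi x y - sdiff (phi ^+ 2) x y / 2] is half of a sum of two squares
and [K] is nonnegative ([Lambda_sqr_le]). To estimate it, put [g = phi ^+ 2]. The
bounded part [S] of the kernel contributes an integral over [x] of second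
differences of [g], hence at most a multiple of the integral of [g] over the
double box ([weighted_average_le]). For the singular part, [|y|^-3] is minus the
divergence of [y / |y|^3]; integrating by parts in [y] on each coordinate line
([hessian_line]) turns [sdiff g x y / 2 * |y|^-3] into values of [sdiff g x] on the
sides of the box, which are again harmless averages, minus the terms
[y_i |y|^-3 d_i g] antisymmetrised in [y] ([kernel_split]). Integrating a term of
the latter kind over [x] first, by Fubini and the fundamental theorem of calculus,
leaves its values on two opposite sides: this is the boundary integral of the
statement ([odd_part_total], [Lambda_average], [int_bdryE]).

When [phi = psi - psih] with [psi] periodic, the integrals over two opposite sides
combine into one integral of the jump of [g] across a period ([side_jump]). A
second integration by parts, against a primitive of [y_1 |y|^-3] that is at most
[1 / |y|] and vanishes on the vertical sides, moves a derivative onto the jump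
([jump_by_parts]). Since [1 / |y| <= |y_1|^(-1/4) |y_2|^(-3/4)], a quadratic inequality
with an optimised parameter bounds what remains by the square norm of the
differentiated jump on a strip of one period ([side_average_le]). Periodicity
cancels the products that contain [psi] only, and the jump is bounded by those of
[psih ^+ 2], [psih] and of the derivative of [psih] ([jump_sqr_phi_le]). The
vertical direction follows by exchanging the coordinates. *)

(** * Fubini theorems and changes of variables *)

Section product_sets.
Local Open Scope ereal_scope.
Context {d1 d2} {T1 : measurableType d1} {T2 : measurableType d2} {R : realType}.
Variables (m1 : {sigma_finite_measure set T1 -> \bar R}).
Variables (m2 : {sigma_finite_measure set T2 -> \bar R}).
Variables (A : set T1) (B : set T2) (mA : measurable A) (mB : measurable B).

Let restrict_pair (f : T1 * T2 -> \bar R) x y :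
  (f \_ (A `*` B)) (x, y) =
  ((fun x' => ((fun y' => f (x', y')) \_ B) y) \_ A) x.
Proof.
rewrite /patch in_setX /=.
by case: (x \in A) => //=; case: (y \in B).
Qed.

Let inner1 (f : T1 * T2 -> \bar R) x :
  \int[m2]_y (f \_ (A `*` B)) (x, y) =
  ((fun x' => \int[m2]_(y in B) f (x', y)) \_ A) x.
Proof.
under eq_integral do rewrite restrict_pair.
rewrite /patch; case: ifP => _; last by rewrite integral0.
by rewrite [RHS]integral_mkcond.
Qed.

Let inner2 (f : T1 * T2 -> \bar R) y :
  \int[m1]_x (f \_ (A `*` B)) (x, y) =
  ((fun y' => \int[m1]_(x in A) f (x, y')) \_ B) y.
Proof.
under eq_integral do rewrite restrict_pair.
rewrite /patch; case: ifP => yB; last first.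
  by under eq_integral do [case: ifP => // _]; rewrite integral0.
by rewrite [RHS]integral_mkcond.
Qed.

Lemma tonelli_setX (f : T1 * T2 -> \bar R) :
  measurable_fun (A `*` B) f -> (forall z, (A `*` B) z -> 0 <= f z) ->
  \int[m1 \x m2]_(z in A `*` B) f z =
    \int[m1]_(x in A) \int[m2]_(y in B) f (x, y) /\
  \int[m1 \x m2]_(z in A `*` B) f z =
    \int[m2]_(y in B) \int[m1]_(x in A) f (x, y).
Proof.
move=> mf f0.
have mAB : measurable (A `*` B) by exact: measurableX.
have mfr : measurable_fun setT (f \_ (A `*` B)).
  by apply/(measurable_restrictT _ _).1.
have fr0 z : 0 <= (f \_ (A `*` B)) z.
  by rewrite /patch; case: ifPn => // /set_mem /f0.
rewrite integral_mkcond; split.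
- rewrite (fubini_tonelli1 _ mfr fr0) [RHS]integral_mkcond.
  by apply: eq_integral => x _; rewrite -inner1.
- rewrite (fubini_tonelli2 _ mfr fr0) [RHS]integral_mkcond.
  by apply: eq_integral => y _; rewrite -inner2.
Qed.

Lemma measurable_tonelli_setX1 (f : T1 * T2 -> \bar R) :
  measurable_fun (A `*` B) f -> (forall z, (A `*` B) z -> 0 <= f z) ->
  measurable_fun A (fun x => \int[m2]_(y in B) f (x, y)).
Proof.
move=> mf f0.
have mAB : measurable (A `*` B) by exact: measurableX.
apply/(measurable_restrictT _ mA).2.
apply: (eq_measurable_fun (fubini_F m2 (f \_ (A `*` B)))).
  by move=> x _; exact: inner1.
apply: measurable_fun_fubini_tonelli_F; first exact/(measurable_restrictT _ _).1.
by move=> z; rewrite /patch; case: ifPn => // /set_mem /f0.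
Qed.

End product_sets.

Section transfer.
Local Open Scope ereal_scope.
Context {d1 d2} {X : measurableType d1} {Y : measurableType d2} {R : realType}.
Variables (mu : {measure set X -> \bar R}) (nu : {measure set Y -> \bar R}).
Variables (T : X -> Y) (mT : measurable_fun setT T).
Hypothesis nuE : forall A, measurable A -> mu (T @^-1` A) = nu A.

Let ge0_integral_transfer D (f : Y -> \bar R) :
  measurable D -> measurable_fun D f -> (forall y, D y -> 0 <= f y) ->
  \int[nu]_(y in D) f y = \int[mu]_(x in T @^-1` D) f (T x).
Proof.
move=> mD mf f0.
rewrite -(ge0_integral_pushforward mT mu mD mf); last first.
  by move=> y /set_mem; exact: f0.
apply: eq_measure_integral => A mA _.
by rewrite -nuE.
Qed.

Lemma integral_transfer D (f : Y -> \bar R) :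
  measurable D -> measurable_fun D f ->
  \int[nu]_(y in D) f y = \int[mu]_(x in T @^-1` D) f (T x).
Proof.
move=> mD mf; rewrite integralE [RHS]integralE.
rewrite !ge0_integral_transfer//.
  by congr (_ - _); apply: eq_integral => x _; rewrite ?(funeposE, funenegE).
  exact: measurable_funeneg.
exact: measurable_funepos.
Qed.

Lemma integrable_transfer D (f : Y -> \bar R) :
  measurable D -> nu.-integrable D f ->
  mu.-integrable (T @^-1` D) (f \o T).
Proof.
move=> mD /integrableP[mf fi]; apply/integrableP; split.
  apply: (measurable_comp mD) => //; first by move=> _ [x Dx <-].
  exact: measurable_funTS.
by rewrite -(@integral_transfer D (abse \o f))//; exact: measurableT_comp.
Qed.

End transfer.

Section product_transfer.
Local Open Scope ereal_scope.
Context {d d1 d2 : measure_display} {X : measurableType d} {T1 : measurableType d1}.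
Context {T2 : measurableType d2} {R : realType}.
Variables (mu : {measure set X -> \bar R}).
Variables (m1 : {sigma_finite_measure set T1 -> \bar R}).
Variables (m2 : {sigma_finite_measure set T2 -> \bar R}).

(** By uniqueness of the product measure, invariance only has to be tested on
rectangles. *)
Lemma product_measure_preimage (T : X -> T1 * T2) : measurable_fun setT T ->
  (forall A B, measurable A -> measurable B ->
    mu (T @^-1` (A `*` B)) = m1 A * m2 B) ->
  forall C, measurable C -> mu (T @^-1` C) = (m1 \x m2) C.
Proof.
move=> mT TE C mC.
pose nu := measure_function_pushforward__canonical__measure_function_Measure mu mT.
by rewrite (@product_measure_unique _ _ _ _ _ m1 m2 nu).
Qed.

End product_transfer.

Section product_swap.
Local Open Scope ereal_scope.
Context {d1 d2} {T1 : measurableType d1} {T2 : measurableType d2} {R : realType}.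
Variables (m1 : {sigma_finite_measure set T1 -> \bar R}).
Variables (m2 : {sigma_finite_measure set T2 -> \bar R}).

Lemma product_measure_swap (A : set (T1 * T2)) : measurable A ->
  (m2 \x m1) (@swap T2 T1 @^-1` A) = (m1 \x m2) A.
Proof.
apply: product_measure_preimage; first exact: measurable_swap.
move=> B C mB mC; rewrite (_ : swap @^-1` _ = C `*` B).
  by rewrite -[LHS]/((m2 \x m1) _) product_measure1E// muleC.
by apply/seteqP; split => -[x y] [].
Qed.

End product_swap.

Section fubini_real1.
Context {d1 d2} {T1 : measurableType d1} {T2 : measurableType d2} {R : realType}.
Variables (m1 : {sigma_finite_measure set T1 -> \bar R}).
Variables (m2 : {sigma_finite_measure set T2 -> \bar R}).

Let restrict_in1 A B (f : T1 * T2 -> R) x y : x \in A ->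
  ((EFin \o f) \_ (A `*` B)) (x, y) = ((fun y => (f (x, y))%:E) \_ B) y.
Proof. by rewrite /patch in_setX /= => ->. Qed.

(** The inner integral of an integrable function may be infinite on a null set,
where its real-valued version is 0 instead; null sets affect neither the
integrability nor the value of the iterated integral. *)
Lemma fubini_Rintegral1 (A : set T1) (B : set T2) (f : T1 * T2 -> R) :
  measurable A -> measurable B ->
  (m1 \x m2)%E.-integrable (A `*` B) (EFin \o f) ->
  m1.-integrable A (fun x => (\int[m2]_(y in B) f (x, y))%:E) /\
  \int[(m1 \x m2)%E]_(z in A `*` B) f z =
    \int[m1]_(x in A) \int[m2]_(y in B) f (x, y).
Proof.
move=> mA mB fi.
have mAB : measurable (A `*` B) by exact: measurableX.
have fi' := (integrable_mkcond _ mAB).1 fi.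
have iF := integrable_fubini_F fi'.
have E := integral12_prod_meas1 fi'.
have aeE : {ae m1, forall x, A x ->
    (\int[m2]_(y in B) (f (x, y)))%:E =
    fubini_F m2 ((EFin \o f) \_ (A `*` B)) x}.
  apply: filterS (ae_integrable1 fi') => x /= ix Ax.
  have {}ix : m2.-integrable B (fun y => (f (x, y))%:E).
    apply/(integrable_mkcond _ mB); apply: eq_integrable ix => // y _.
    by rewrite restrict_in1// inE.
  rewrite /Rintegral /fubini_F fineK; last exact: integrable_fin_num.
  rewrite integral_mkcond; apply: eq_integral => y _.
  by rewrite restrict_in1// inE.
have iFA : m1.-integrable A (fubini_F m2 ((EFin \o f) \_ (A `*` B))).
  exact: integrableS iF.
have mF : measurable_fun A (fun x => (\int[m2]_(y in B) (f (x, y)))%:E).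
  have mFe : measurable_fun A (fubini_F m2 ((EFin \o f) \_ (A `*` B))).
    exact: measurable_int iFA.
  apply/measurable_EFinP; rewrite /Rintegral.
  apply: (eq_measurable_fun (fine \o fubini_F m2 ((EFin \o f) \_ (A `*` B)))).
    move=> x xA /=; rewrite /fubini_F; congr fine.
    by rewrite [RHS]integral_mkcond; apply: eq_integral => y _; rewrite restrict_in1.
  exact: (measurable_comp measurableT).
have EA : (\int[m1]_(x in A) (\int[m2]_(y in B) (f (x, y)))%:E)%E =
    (\int[m1]_(x in A) fubini_F m2 ((EFin \o f) \_ (A `*` B)) x)%E.
  by apply: ae_eq_integral => //; exact: measurable_int iFA.
split.
  apply/integrableP; split=> //.
  have /integrableP[_] := iFA; apply: le_lt_trans.
  rewrite le_eqVlt; apply/orP; left; apply/eqP.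
  apply: ae_eq_integral => //.
  - exact: measurableT_comp.
  - by apply: measurableT_comp => //; exact: measurable_int iFA.
  - by apply: filterS aeE => x h Ax; congr abse; exact: h.
rewrite /Rintegral EA integral_mkcond; congr fine.
rewrite -[LHS]E [RHS]integral_mkcond; apply: eq_integral => x _.
rewrite [RHS]/patch; case: ifPn => // xA.
rewrite /fubini_F integral0_eq// => y _.
by rewrite /patch in_setX (negbTE xA).
Qed.

End fubini_real1.

Section fubini_real2.
Context {d1 d2} {T1 : measurableType d1} {T2 : measurableType d2} {R : realType}.
Variables (m1 : {sigma_finite_measure set T1 -> \bar R}).
Variables (m2 : {sigma_finite_measure set T2 -> \bar R}).

Lemma fubini_Rintegral2 (A : set T1) (B : set T2) (f : T1 * T2 -> R) :
  measurable A -> measurable B ->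
  (m1 \x m2)%E.-integrable (A `*` B) (EFin \o f) ->
  m2.-integrable B (fun y => (\int[m1]_(x in A) f (x, y))%:E) /\
  \int[(m1 \x m2)%E]_(z in A `*` B) f z =
    \int[m2]_(y in B) \int[m1]_(x in A) f (x, y).
Proof.
move=> mA mB fi.
have mS := @measurable_swap _ _ T2 T1.
have SE : @swap T2 T1 @^-1` (A `*` B) = B `*` A.
  by apply/seteqP; split => -[x y] [].
have mAB : measurable (A `*` B) by exact: measurableX.
have := integrable_transfer mS (product_measure_swap m1 m2) mAB fi.
rewrite SE => fi'.
have [Fi FE] := @fubini_Rintegral1 _ _ _ _ _ m2 m1 _ _ (f \o swap) mB mA fi'.
split=> //; rewrite -[RHS]FE /Rintegral.
rewrite (integral_transfer mS (product_measure_swap m1 m2))// ?SE//.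
exact: measurable_int fi.
Qed.

End fubini_real2.

Section plane_measure.
Context {R : realType}.
Notation mu := (@lebesgue_measure R).
Notation plane := (measurableTypeR R * measurableTypeR R)%type.

Lemma measurable_plane_add (a : plane) :
  measurable_fun [set: plane] (fun y : plane => (a + y : plane)).
Proof.
apply/measurable_fun_pairP; split.
  apply: (measurable_funD (measurable_cst a.1)); exact: measurable_fst.
apply: (measurable_funD (measurable_cst a.2)); exact: measurable_snd.
Qed.

Lemma measurable_plane_opp :
  measurable_fun [set: plane] (fun y : plane => (- y : plane)).
Proof.
apply/measurable_fun_pairP; split.
  by apply: (measurable_funN measurable_fst).
by apply: (measurable_funN measurable_snd).
Qed.

(** Translates of half-open intervals have the same length, and these intervals
determine the measure. *)
Lemma lebesgue_measure_translate (a : R) (A : set (measurableTypeR R)) :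
  measurable A -> mu ((fun x : measurableTypeR R => (a + x : measurableTypeR R)) @^-1` A) = mu A.
Proof.
have mT : measurable_fun setT (fun x : measurableTypeR R => (a + x : measurableTypeR R)).
  exact: (measurable_funD (measurable_cst a) (@measurable_id _ _ setT)).
pose nu := measure_function_pushforward__canonical__measure_function_Measure mu mT.
move=> mA; rewrite -[LHS]/(nu A); apply/esym/lebesgue_measure_unique => //.
move=> _ [[b c] _ <-] /=; rewrite /pushforward.
rewrite (_ : _ @^-1` _ = `]b - a, c - a]%classic).
  rewrite !lebesgue_measure_itv/= !lte_fin ltrD2r.
  by case: ifP => // _; rewrite -!EFinB; congr EFin; ring.
by apply/seteqP; split => x /=; rewrite !in_itv/= ltrBlDl lerBrDl.
Qed.

Lemma leb2_translate (a : plane) (A : set plane) : measurable A ->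
  (@leb2 R) ((fun y : plane => (a + y : plane)) @^-1` A) = (@leb2 R) A.
Proof.
apply: product_measure_preimage; first exact: measurable_plane_add.
move=> B C mB mC.
rewrite -[RHS]/(mu B * mu C)%E.
rewrite -(lebesgue_measure_translate a.1 mB) -(lebesgue_measure_translate a.2 mC).
apply: product_measure1E.
  by rewrite -[X in measurable X]setTI; apply: (measurable_funD (measurable_cst a.1) (@measurable_id _ _ setT)).
by rewrite -[X in measurable X]setTI; apply: (measurable_funD (measurable_cst a.2) (@measurable_id _ _ setT)).
Qed.

Lemma leb2_opp (A : set plane) : measurable A ->
  (@leb2 R) ((fun y : plane => (- y : plane)) @^-1` A) = (@leb2 R) A.
Proof.
apply: product_measure_preimage; first exact: measurable_plane_opp.
move=> B C mB mC; rewrite -[RHS]/(mu B * mu C)%E.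
rewrite -(lebesgue_measureN mB) -(lebesgue_measureN mC).
apply: product_measure1E.
  by rewrite -[X in measurable X]setTI; apply: oppr_measurable.
by rewrite -[X in measurable X]setTI; apply: oppr_measurable.
Qed.

Lemma leb2_swap (A : set plane) : measurable A ->
  (@leb2 R) (@swap _ _ @^-1` A) = (@leb2 R) A.
Proof. exact: product_measure_swap. Qed.

End plane_measure.

(** * The plane, boxes and the Euclidean norm *)

Section plane_topology.
Context {R : realType}.
Notation plane := (measurableTypeR R * measurableTypeR R)%type.
Implicit Types x y : R * R.

(** The Borel sets of the product topology and the product of the Borel sets agree
because rational squares form a countable base. *)
Lemma open_measurable_plane (A : set (R * R)) :
  open A -> measurable (A : set plane).
Proof.
move=> oA.
pose rect (q : rat * rat * rat) : set plane :=
  `]ratr q.1.1 - ratr q.2, ratr q.1.1 + ratr q.2[%classic `*`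
  `]ratr q.1.2 - ratr q.2, ratr q.1.2 + ratr q.2[%classic.
have -> : A = \bigcup_(q in [set q | rect q `<=` A]) rect q.
  apply/seteqP; split=> [x Ax|x [q qA]]; last exact: qA.
  have /nbhs_ballP[e /= e0 xA] : nbhs x A by exact: open_nbhs_nbhs.
  have e42 : e / 4 < e / 2 by lra.
  have [r /itvP re] := rat_in_itvoo e42.
  have r0 : 0 < ratr r :> R by rewrite (lt_trans _ (_ : e / 4 < _)) ?re//; lra.
  have [a /itvP ar] := @rat_in_itvoo R (x.1 - ratr r) (x.1 + ratr r) ltac:(lra).
  have [b /itvP br] := @rat_in_itvoo R (x.2 - ratr r) (x.2 + ratr r) ltac:(lra).
  have a1 : x.1 - ratr r < ratr a by rewrite ar.
  have a2 : ratr a < x.1 + ratr r by rewrite ar.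
  have b1 : x.2 - ratr r < ratr b by rewrite br.
  have b2 : ratr b < x.2 + ratr r by rewrite br.
  have re2 : ratr r < e / 2 by rewrite re.
  exists ((a, b), r); last by split=> /=; rewrite in_itv/=; apply/andP; split; lra.
  move=> y [] /=; rewrite !in_itv/= => /andP[? ?] /andP[? ?]; apply: xA.
  by split; rewrite /ball/= /ball_/= ltr_norml; apply/andP; split; lra.
rewrite bigcup_mkcond; apply: countable_bigcupT_measurable => [|q].
  exact: countableP.
by case: ifPn => // _; apply: measurableX; exact: measurable_itv.
Qed.

Lemma continuous_measurable_plane (f : R * R -> R) :
  continuous f -> measurable_fun [set: plane] f.
Proof.
move=> cf; apply: (measurability _ (RGenOpens.measurableE R)).
move=> _ [_ [a [b ->] <-]]; rewrite setTI; apply: open_measurable_plane.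
move/continuousP : cf; apply; exact: interval_open.
Qed.

Lemma measurable_box n : measurable (box n : set plane).
Proof. by apply: measurableX; exact: measurable_itv. Qed.

Lemma box_le m n x : (m <= n)%N -> box m x -> box n x.
Proof.
move=> mn [] /=; rewrite !in_itv/= => /andP[? ?] /andP[? ?].
have : m%:R * pi <= n%:R * pi :> R by rewrite ler_wpM2r ?pi_ge0// ler_nat.
by move=> ?; split; rewrite /= in_itv/=; apply/andP; split; lra.
Qed.

Lemma boxP n x : box n x <-> (`|x.1| <= n%:R * pi /\ `|x.2| <= n%:R * pi).
Proof. by rewrite /box/= !in_itv/= -!ler_norml; split => -[]. Qed.

Lemma boxD m n x y : box m x -> box n y -> box (m + n) (x + y).
Proof.
rewrite !boxP natrD mulrDl => -[x1 x2] [y1 y2].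
by split; rewrite (le_trans (ler_normD _ _))// lerD.
Qed.

Lemma boxN n x : box n (- x) <-> box n x.
Proof. by rewrite !boxP /= !normrN. Qed.

(** The projection onto the box. *)
Definition clamp (n : nat) (x : R * R) : R * R :=
  (Num.max (- (n%:R * pi)) (Num.min (n%:R * pi) x.1),
   Num.max (- (n%:R * pi)) (Num.min (n%:R * pi) x.2)).

Lemma clamp_box n x : box n (clamp n x).
Proof.
have n0 : 0 <= n%:R * pi :> R by rewrite mulr_ge0 ?pi_ge0.
by split; rewrite /= in_itv/= le_max lexx/= ge_max ge_min lexx/= andbT; lra.
Qed.

Lemma clamp_id n x : box n x -> clamp n x = x.
Proof.
case: x => a b [] /=; rewrite !in_itv/= => /andP[? ?] /andP[? ?].
by rewrite /clamp/= !min_r// !max_r.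
Qed.

Lemma continuous_pair (T : topologicalType) (f g : T -> R) :
  continuous f -> continuous g -> continuous (fun z => (f z, g z)).
Proof. by move=> cf cg x; exact: (cvg_pair (cf x) (cg x)). Qed.

Lemma continuous_clamp n : continuous (clamp n).
Proof.
apply: continuous_pair => x.
  apply: (@continuous_max _ _ (cst _) (fun z : R * R => Num.min _ z.1)).
    exact: cvg_cst.
  apply: (@continuous_min _ _ (cst _) (fst : R * R -> R)); first exact: cvg_cst.
  exact: cvg_fst.
apply: (@continuous_max _ _ (cst _) (fun z : R * R => Num.min _ z.2)).
  exact: cvg_cst.
apply: (@continuous_min _ _ (cst _) (snd : R * R -> R)); first exact: cvg_cst.
exact: cvg_snd.
Qed.

(** A function on the box may be arbitrary outside of it; its composition with the
projection is continuous, hence measurable, on the whole plane. *)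
Lemma continuous_comp_clamp n (f : R * R -> R) :
  {within box n, continuous f} -> continuous (f \o clamp n).
Proof.
move=> cf x; have cx := clamp_box n x.
have := (subspace_continuousP (box n) f).1 cf _ cx.
rewrite /continuous_at/=; apply: cvg_trans.
move=> P HP.
have HP' : nbhs (clamp n x) [set z | box n z -> P (f z)] by exact: HP.
have := @continuous_clamp n x _ HP'.
apply: (@filterS _ (nbhs x)) => z /=; apply; exact: clamp_box.
Qed.

End plane_topology.

Section euclidean_norm.
Context {R : realType}.
Notation plane := (measurableTypeR R * measurableTypeR R)%type.
Implicit Types x y : R * R.

Lemma enorm_ge0 y : 0 <= enorm y.
Proof. exact: sqrtr_ge0. Qed.

Lemma enorm0 : enorm (0 : R * R) = 0.
Proof. by rewrite /enorm/= expr0n/= addr0 sqrtr0. Qed.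

Lemma sqr_enorm y : enorm y ^+ 2 = y.1 ^+ 2 + y.2 ^+ 2.
Proof. by rewrite sqr_sqrtr// addr_ge0// sqr_ge0. Qed.

Lemma enormN y : enorm (- y) = enorm y.
Proof. by rewrite /enorm/= !sqrrN. Qed.

Lemma enorm_swap y : enorm (swap y) = enorm y.
Proof. by rewrite /enorm/= addrC. Qed.

Lemma le_norm1_enorm y : `|y.1| <= enorm y.
Proof. by rewrite -sqrtr_sqr ler_wsqrtr// lerDl sqr_ge0. Qed.

Lemma le_norm2_enorm y : `|y.2| <= enorm y.
Proof. by rewrite -sqrtr_sqr ler_wsqrtr// lerDr sqr_ge0. Qed.

Lemma enorm_gt0 y : (0 < enorm y) = (y != 0).
Proof.
rewrite lt_def enorm_ge0 andbT; congr (~~ _).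
apply/eqP/eqP => [y0|->]; last exact: enorm0.
have := le_norm1_enorm y; have := le_norm2_enorm y.
rewrite y0 !normr_le0 => /eqP y2 /eqP y1.
by rewrite [y]surjective_pairing y1 y2.
Qed.

Lemma enorm_box n y : box n y -> enorm y <= 2 * (n%:R * pi).
Proof.
move=> /boxP[y1 y2]; have n0 : 0 <= n%:R * pi :> R by rewrite mulr_ge0 ?pi_ge0.
move: y1 y2; rewrite !ler_norml => /andP[? ?] /andP[? ?].
rewrite leNgt; apply/negP => lt_E; have := sqr_enorm y.
have ? : y.1 ^+ 2 <= (n%:R * pi) ^+ 2 by nra.
have ? : y.2 ^+ 2 <= (n%:R * pi) ^+ 2 by nra.
nra.
Qed.

Lemma continuous_enorm : continuous (@enorm R).
Proof.
move=> x; apply: (@continuous_comp _ _ _ (fun y : R * R => y.1 ^+ 2 + y.2 ^+ 2) (@Num.sqrt R)).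
  by apply: cvgD; rewrite !expr2; apply: cvgM; (exact: cvg_fst || exact: cvg_snd).
exact: sqrt_continuous.
Qed.

Lemma measurable_enorm : measurable_fun [set: plane] (@enorm R).
Proof. exact: continuous_measurable_plane continuous_enorm. Qed.

Lemma measurable_inv_enorm : measurable_fun [set: plane] (fun y => (enorm y)^-1 : R).
Proof.
under eq_fun do rewrite -powR_inv1 ?enorm_ge0//.
exact: (measurableT_comp (@measurable_powR R _) measurable_enorm).
Qed.

End euclidean_norm.

(** * Integrable singularities *)

Section power_weight.
Context {R : realType}.
Notation mu := (@lebesgue_measure R).
Notation plane := (measurableTypeR R * measurableTypeR R)%type.

Definition punctured : set (measurableTypeR R) := `[- pi, pi]%classic `\ 0.

Lemma measurable_punctured : measurable punctured.
Proof. by apply: measurableD => //; exact: measurable_itv. Qed.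

(** Exhaustion of the interval from the right, with the primitive of the power on
each compact part. *)
Lemma integral_powR_near0 (p : R) : (0 < p < 1)%R ->
  (\int[mu]_(s in `]0%R, pi]) (s `^ (- p))%:E <= (pi `^ (1 - p) / (1 - p))%:E)%E.
Proof.
move=> /andP[p0 p1].
have pi0 : (0 < pi :> R)%R by exact: pi_gt0.
pose F (n : nat) : set (measurableTypeR R) := `[pi / n.+1%:R, pi]%classic.
have UF : \bigcup_n F n = `]0%R, pi]%classic.
  apply/seteqP; split=> [x [n _]|x]; rewrite /F/= !in_itv/= => /andP[x0 x1].
    by rewrite x1 andbT (lt_le_trans _ x0)// divr_gt0.
  exists (Num.truncn (pi / x)) => //=; rewrite in_itv/= x1 andbT.
  rewrite ler_pdivrMr// mulrC -ler_pdivrMr// ltW//.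
  exact: truncnS_gt.
have mf (D : set (measurableTypeR R)) : measurable_fun D (fun s : measurableTypeR R => (s `^ (- p))%:E).
  by apply/measurable_EFinP; apply: measurable_funTS; exact: measurable_powR.
rewrite -UF.
have ndF : nondecreasing_seq F.
  move=> m n mn; apply/subsetPset => x; rewrite /F/= !in_itv/= => /andP[x0 ->].
  rewrite andbT (le_trans _ x0)// ler_pM2l// lef_pV2 ?posrE// ler_nat ltnS//.
have F0 i x : F i x -> (0 <= (x `^ (- p))%:E)%E by rewrite lee_fin powR_ge0.
have cF := @ge0_nondecreasing_set_cvg_integral _ _ _ F _ mu ndF
  (fun i => measurable_itv _) (fun i => mf _) F0.
rewrite -(cvg_lim _ cF)//; apply: lime_le.
  by apply: cvgP; exact: cF.
apply: nearW => n.
case: n => [|n].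
  by rewrite /F divr1 set_itv1 integral_set1 lee_fin divr_ge0 ?powR_ge0 ?subr_ge0 ?ltW.
have an : (pi / n.+2%:R < pi :> R)%R by rewrite ltr_pdivrMr// ltr_pMr// ltr1n.
have a0 : (0 < pi / n.+2%:R :> R)%R by rewrite divr_gt0.
have dG (x : R) : 0 < x ->
    is_derive x 1 (fun s : R => (1 - p)^-1 * s `^ (1 - p)) (x `^ (- p)).
  move=> x0; have dx := @is_derive1_powR R (1 - p) x x0.
  apply: is_derive_eq; rewrite /GRing.scale/= mulrA mulVf ?mul1r; last first.
    by rewrite subr_eq0 gt_eqF.
  by congr powR; ring.
have cG (x : R) : 0 < x ->
    {for x, continuous (fun s : R => (1 - p)^-1 * s `^ (1 - p))}.
  by move=> /dG[dx _]; apply: differentiable_continuous; apply/derivable1_diffP.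
rewrite (@continuous_FTC2 _ (fun s : R => s `^ (- p))
  (fun s : R => (1 - p)^-1 * s `^ (1 - p)))//.
- rewrite -EFinB lee_fin mulrC gerBl mulr_ge0 ?invr_ge0 ?powR_ge0 ?subr_ge0 ?ltW//.
- apply: derivable_within_continuous => x.
  rewrite in_itv/= => /andP[x0 _]; apply: derivable_powR.
  by rewrite in_itv/= andbT (lt_le_trans a0).
- split.
  + move=> x; rewrite in_itv/= => /andP[x0 _].
    by have [] := dG _ (lt_trans a0 x0).
  + by apply: cvg_at_right_filter; exact: cG.
  + by apply: cvg_at_left_filter; exact: cG.
- move=> x; rewrite in_itv/= => /andP[x0 _]; rewrite derive1E.
  by have [_ ->] := dG _ (lt_trans a0 x0).
Qed.

End power_weight.

Section inverse_norm.
Context {R : realType}.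
Notation mu := (@lebesgue_measure R).
Notation plane := (measurableTypeR R * measurableTypeR R)%type.

Lemma integral_powR_abs (p : R) : 0 < p < 1 ->
  (\int[mu]_(s in punctured) (`|s| `^ (- p))%:E < +oo)%E.
Proof.
move=> p01.
have mf (D : set (measurableTypeR R)) :
    measurable_fun D (fun s : measurableTypeR R => (`|s| `^ (- p))%:E).
  apply/measurable_EFinP; apply: measurable_funTS.
  by apply: (measurableT_comp (@measurable_powR R _)); exact: normr_measurable.
have pE : punctured = `]0, pi]%classic `|` `[- pi, 0[%classic :> set R.
  have := pi_gt0 R => pi0.
  apply/seteqP; split=> x; rewrite /punctured/= !in_itv/=.
    move=> [/andP[-> ->]] /eqP; rewrite neq_lt => /orP[->|->]; by [right|left].
  by move=> [|] /andP[x0 x1]; split; (try by apply/eqP; lra); apply/andP; split; lra.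
have posE : (\int[mu]_(s in `]0%R, pi]) (`|s| `^ (- p))%:E < +oo)%E.
  rewrite (eq_integral (fun s : measurableTypeR R => (s `^ (- p))%:E)); last first.
    by move=> s; rewrite inE/= in_itv/= => /andP[s0 _]; rewrite gtr0_norm.
  by apply: le_lt_trans (integral_powR_near0 p01) _; rewrite ltry.
rewrite pE ge0_integral_setU//=.
- rewrite lte_add_pinfty//.
  rewrite (@integral_transfer _ _ _ _ _ mu mu
    (fun x : measurableTypeR R => (- x : measurableTypeR R))
    (@oppr_measurable R setT) (@lebesgue_measureN R) _ _ (measurable_itv _) (mf _)).
  rewrite (_ : _ @^-1` _ = `]0%R, pi]%classic); last first.
    by apply/seteqP; split=> x; rewrite /= !in_itv/= lerN2 oppr_lt0 andbC.
  by under eq_integral do rewrite normrN.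
- apply/disj_set2P/seteqP; split=> // x []; rewrite /= !in_itv/=.
  by move=> /andP[x0 _] /andP[_]; rewrite ltNge ltW.
Qed.

(** The exponents share the singularity between the two variables so that each
factor is integrable on a line. *)
Lemma inv_enorm_le (p : R) (y : R * R) : 0 < p < 1 -> y.1 != 0 -> y.2 != 0 ->
  (enorm y)^-1 <= `|y.1| `^ (- p) * `|y.2| `^ (- (1 - p)).
Proof.
move=> /andP[p0 p1] y1 y2; rewrite !powRN -invfM lef_pV2 ?posrE; last 2 first.
- by rewrite enorm_gt0; apply: contraNneq y1 => ->.
- by rewrite mulr_gt0// powR_gt0// normr_gt0.
have -> : enorm y = enorm y `^ p * enorm y `^ (1 - p).
  rewrite -powRD; first by rewrite subrKC powRr1 ?enorm_ge0.
  by rewrite subrKC oner_eq0.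
by rewrite ler_pM ?powR_ge0// ge0_ler_powR ?nnegrE ?enorm_ge0 ?subr_ge0 ?(ltW p0) ?(ltW p1)//;
  [exact: le_norm1_enorm|exact: le_norm2_enorm].
Qed.

Lemma box1E : box 1 = `[- pi, pi]%classic `*` `[- pi, pi]%classic :> set (R * R).
Proof. by rewrite /box !mul1r. Qed.

Lemma integral_inv_enorm :
  (\int[@leb2 R]_(y in box 1) ((enorm y)^-1)%:E < +oo)%E.
Proof.
have mI : measurable (`[- pi, pi]%classic : set (measurableTypeR R)) by exact: measurable_itv.
have mi D : measurable_fun D (fun y : plane => ((enorm y)^-1)%:E).
  by apply/measurable_EFinP; apply: measurable_funTS; exact: measurable_inv_enorm.
have i0 (z : plane) : (0 <= ((enorm z)^-1)%:E)%E by rewrite lee_fin invr_ge0 enorm_ge0.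
have p2 : 0 < (2^-1 : R) < 1 by apply/andP; split; lra.
have mw D : measurable_fun D (fun s : measurableTypeR R => (`|s| `^ (- 2^-1))%:E).
  apply/measurable_EFinP; apply: measurable_funTS.
  by apply: (measurableT_comp (@measurable_powR R _)); exact: normr_measurable.
have [J JE] : exists J, (\int[mu]_(s in punctured) (`|s| `^ (- 2^-1))%:E = J%:E)%E.
  exists (fine (\int[mu]_(s in punctured) (`|s| `^ (- 2^-1))%:E)%E).
  rewrite fineK// ge0_fin_numE ?integral_powR_abs//.
  by apply: integral_ge0 => x _; rewrite lee_fin powR_ge0.
have J0 : (0 <= J%:E)%E.
  by rewrite -JE; apply: integral_ge0 => x _; rewrite lee_fin powR_ge0.
have [iE _] := @tonelli_setX _ _ _ _ R mu mu _ _ mI mI _ (mi _) (fun z _ => i0 z).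
rewrite box1E [X in (X < _)%E]iE.
rewrite -(@integral_setD1 _ _ 0); last 2 first.
- exact: measurable_punctured.
- by apply: (@measurable_tonelli_setX1 _ _ _ _ R mu _ _ measurable_punctured mI (fun z : plane => ((enorm z)^-1)%:E)).
apply: (@le_lt_trans _ _ (\int[mu]_(x in punctured) ((`|x| `^ (- 2^-1))%:E * J%:E)%E)%E).
  apply: ge0_le_integral => //=.
  - exact: measurable_punctured.
  - by move=> x _; apply: integral_ge0 => y _; exact: i0.
  - by apply: (@measurable_tonelli_setX1 _ _ _ _ R mu _ _ measurable_punctured mI (fun z : plane => ((enorm z)^-1)%:E)).
  - by apply: emeasurable_funM => //; exact: measurable_cst.
  - move=> x [_ /eqP x0].
    rewrite -(@integral_setD1 _ _ 0); last 2 first.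
    + exact: measurable_punctured.
    + exact: measurable_funTS (measurableT_comp (mi setT) (pair1_measurable x)).
    rewrite -JE -ge0_integralZl// ?lee_fin ?powR_ge0//; last exact: measurable_punctured.
    apply: ge0_le_integral => //=.
    + exact: measurable_punctured.
    + exact: measurable_funTS (measurableT_comp (mi setT) (pair1_measurable x)).
    + by apply: emeasurable_funM => //; exact: measurable_cst.
    + move=> y [_ /eqP y0]; rewrite -EFinM lee_fin.
      have := @inv_enorm_le _ (x, y) p2 x0 y0.
      by rewrite (_ : 1 - 2^-1 = 2^-1 :> R)//; lra.
rewrite ge0_integralZr//.
- by rewrite JE -EFinM ltry.
- exact: measurable_punctured.
Qed.

Lemma integrable_inv_enorm :
  (@leb2 R).-integrable (box 1) (fun y : plane => ((enorm y)^-1)%:E).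
Proof.
apply/integrableP; split.
  by apply/measurable_EFinP; apply: measurable_funTS; exact: measurable_inv_enorm.
under eq_integral do rewrite gee0_abs ?lee_fin ?invr_ge0 ?enorm_ge0//.
exact: integral_inv_enorm.
Qed.

End inverse_norm.

Section dominated_real.
Context {d} {T : measurableType d} {R : realType}.
Variables (nu : {measure set T -> \bar R}) (D : set T) (mD : measurable D).

Lemma dominated_cvg_Rintegral (f_ : nat -> T -> R) (f g : T -> R) :
  (forall n, measurable_fun D (f_ n)) -> measurable_fun D f ->
  (forall x, D x -> f_ n x @[n --> \oo] --> f x) ->
  nu.-integrable D (EFin \o g) ->
  (forall n x, D x -> `|f_ n x| <= g x) ->
  \int[nu]_(x in D) f_ n x @[n --> \oo] --> \int[nu]_(x in D) f x.
Proof.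
move=> mf_ mf cf gi fg.
have [] := @dominated_convergence _ T R nu D mD (fun n => EFin \o f_ n)
  (EFin \o f) (EFin \o g).
- by move=> n; apply/measurable_EFinP.
- exact/measurable_EFinP.
- apply: aeW => x Dx; apply: cvg_EFin; first exact: nearW.
  exact: cf.
- exact: gi.
- by apply: aeW => x n Dx; rewrite /= lee_fin fg.
- move=> fi _ h; apply: fine_cvg; rewrite fineK; last exact: integrable_fin_num.
  exact: h.
Qed.

Lemma integrable_dom (f g : T -> R) : measurable_fun D f ->
  nu.-integrable D (EFin \o g) -> (forall x, D x -> `|f x| <= g x) ->
  nu.-integrable D (EFin \o f).
Proof.
move=> mf gi fg; apply: (le_integrable mD _ _ gi); first exact/measurable_EFinP.
by move=> x Dx; rewrite /= lee_fin (le_trans (fg x Dx))// ler_norm.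
Qed.

Lemma integrable_EFinZ (k : R) (f : T -> R) : nu.-integrable D (EFin \o f) ->
  nu.-integrable D (EFin \o (fun x => k * f x)).
Proof. by move=> fi; apply: eq_integrable (integrableZl mD k fi). Qed.

Lemma integrable_EFinD (f g : T -> R) : nu.-integrable D (EFin \o f) ->
  nu.-integrable D (EFin \o g) ->
  nu.-integrable D (EFin \o (fun x => f x + g x)).
Proof. by move=> fi gi; apply: eq_integrable (integrableD mD fi gi). Qed.

Lemma integrable_EFinB (f g : T -> R) : nu.-integrable D (EFin \o f) ->
  nu.-integrable D (EFin \o g) ->
  nu.-integrable D (EFin \o (fun x => f x - g x)).
Proof. by move=> fi gi; apply: eq_integrable (integrableB mD fi gi). Qed.

End dominated_real.

(** * Principal values by symmetrisation *)

Section principal_value.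
Context {R : realType}.
Notation plane := (measurableTypeR R * measurableTypeR R)%type.
Notation leb2 := (@leb2 R).

Definition sym (F : R * R -> R) (y : R * R) : R := (F y + F (- y)) / 2.

Lemma truncated_set_measurable (e : R) :
  measurable (box 1 `&` [set y : plane | e < enorm y] : set plane).
Proof.
apply: measurableI; first exact: measurable_box.
rewrite -[X in measurable X]setTI.
rewrite (_ : [set y : plane | e < enorm y] = @enorm R @^-1` `]e, +oo[%classic); last first.
  by apply/seteqP; split=> y /=; rewrite in_itv/= andbT.
by apply: (measurable_enorm measurableT); exact: measurable_itv.
Qed.

Lemma truncated_setN (e : R) :
  (fun y : plane => (- y : plane)) @^-1` (box 1 `&` [set y | e < enorm y]) =
  box 1 `&` [set y : plane | e < enorm y].
Proof.
apply/seteqP; split=> y /= []; rewrite enormN => by1 ey; split=> //.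
  exact/boxN.
exact/(boxN 1 y).
Qed.

(** Reflection pairs the values at [y] and [- y], so that the odd part of the
    integrand, which carries the nonintegrable singularity, drops out of every
    truncated integral. *)
Lemma pv_symmetrise (F : R * R -> R) (M : R) :
  measurable_fun (box 1 : set plane) F ->
  (forall e, 0 < e -> leb2.-integrable (box 1 `&` [set y | e < enorm y]) (EFin \o F)) ->
  (forall y, box 1 y -> `|sym F y| <= M * (enorm y)^-1) ->
  [/\ leb2.-integrable (box 1) (EFin \o sym F), pv_exists (box 1) F &
    pv_int (box 1) F = \int[leb2]_(y in box 1) sym F y].
Proof.
move=> mF Fi FM.
have mB := @measurable_box R 1.
have mFN : measurable_fun (box 1 : set plane) (fun y => F (- y)).
  apply: (measurable_comp mB) mF _ => //.
    by move=> _ [y yB <-]; exact/boxN.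
  exact: measurable_funTS (@measurable_plane_opp R).
have ms : measurable_fun (box 1 : set plane) (sym F).
  by apply: measurable_funM => //; exact: measurable_funD.
have iM : leb2.-integrable (box 1) (EFin \o (fun y => M * (enorm y)^-1)).
  exact: (integrable_EFinZ mB _ (@integrable_inv_enorm R)).
have si : leb2.-integrable (box 1) (EFin \o sym F) by exact: integrable_dom iM FM.
have tE e : 0 < e -> truncated_int (box 1) F e =
    \int[leb2]_(y in box 1 `&` [set y | e < enorm y]) sym F y.
  move=> e0; rewrite /truncated_int.
  have mD := truncated_set_measurable e.
  have iF := Fi e e0.
  have := integrable_transfer (@measurable_plane_opp R) (@leb2_opp R) mD iF.
  rewrite truncated_setN => iFN.
  have FNE : \int[leb2]_(y in box 1 `&` [set y | e < enorm y]) F y =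
      \int[leb2]_(y in box 1 `&` [set y | e < enorm y]) F (- y).
    rewrite /Rintegral (integral_transfer (@measurable_plane_opp R) (@leb2_opp R))//.
      by rewrite truncated_setN.
    exact: measurable_int iF.
  rewrite /sym RintegralZr//; last exact: integrable_EFinD.
  rewrite RintegralD// -FNE.
  by rewrite -mulr2n -[X in X / 2]mulr_natr mulfK// pnatr_eq0.
have cv : truncated_int (box 1) F e @[e --> 0^'+] -->
    \int[leb2]_(y in box 1) sym F y.
  apply/cvg_at_rightP => u [u0 uc].
  under eq_fun do rewrite tE// Rintegral_mkcondr.
  apply: (@dominated_cvg_Rintegral _ _ _ _ _ mB _ _ (fun y => `|sym F y|)) => //.
  - move=> n; apply/(measurable_restrict _ _ _).1 => //.
      rewrite -[X in measurable X]setTI.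
      rewrite (_ : [set y : plane | u n < enorm y] = @enorm R @^-1` `]u n, +oo[%classic); last first.
        by apply/seteqP; split=> y /=; rewrite in_itv/= andbT.
      by apply: (measurable_enorm measurableT); exact: measurable_itv.
    exact: measurable_funS ms.
  - move=> y yB; have [->|y0] := eqVneq y 0.
      have s0 : sym F 0 = 0.
        have := FM 0 (ltac:(by apply/boxP; rewrite normr0 mul1r pi_ge0)).
        by rewrite enorm0 invr0 mulr0 normr_le0 => /eqP.
      by rewrite (_ : (fun _ => _) = cst (sym F 0)) ?s0; [exact: cvg_cst|apply/funext => n; rewrite /patch s0; case: ifP].
    apply: cvg_near_cst; rewrite -enorm_gt0 in y0.
    move/cvgrPdist_lt : uc => /(_ _ y0); apply: filterS => n /=.
    rewrite sub0r normrN ger0_norm ?ltW// => uy.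
    by rewrite /patch mem_set.
  - exact: integrable_norm.
  - move=> n y yB; rewrite /patch; case: ifP => // _.
    by rewrite normr0.
split=> //; first by split=> //; apply: cvgP cv.
exact: cvg_lim cv.
Qed.

End principal_value.

(** * Derivatives relative to a convex set *)

Section relative_derivative.
Context {R : realType}.
Implicit Types (x y v : R * R) (f g : R * R -> R) (X Y : set (R * R)).

Notation dirnbhs X v x := (within [set h : R | X (x + h *: v)] 0^').

Definition line_convex X v := forall x (a b s : R),
  X (x + a *: v) -> X (x + b *: v) -> a <= s <= b -> X (x + s *: v).

(** On a convex set containing such a point, points of the line accumulate at [x],
so that limits of difference quotients are unique. *)
Definition has_line X v x := exists2 h : R, h != 0 & X (x + h *: v).

Lemma dirnbhs_proper X v x : line_convex X v -> X x -> has_line X v x ->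
  ProperFilter (dirnbhs X v x).
Proof.
move=> cX Xx [h h0 Xh]; apply: Build_ProperFilter_ex => P.
rewrite /within/= => /nbhs_ballP[e /= e0 eP].
(* Shrinking [h] by [t] brings the increment below [e]. *)
pose t := Num.min 1 (e / 2 / `|h|).
have nh0 : 0 < `|h| by rewrite normr_gt0.
have t0 : 0 < t by rewrite lt_min ltr01/= !divr_gt0.
have t1 : t <= 1 by rewrite ge_min lexx.
exists (t * h); apply: eP.
- rewrite /ball/= sub0r normrN normrM (gtr0_norm t0).
  have : t <= e / 2 / `|h| by rewrite ge_min lexx orbT.
  by rewrite ler_pdivlMr// => /le_lt_trans; apply; lra.
- by rewrite mulf_neq0// gt_eqF.
- have [hp|hn] := ltP 0 h.
    apply: (cX x 0 h); [by rewrite scale0r addr0|by []|].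
    by apply/andP; split; nra.
  apply: (cX x h 0); [by []|by rewrite scale0r addr0|].
  by apply/andP; split; nra.
Qed.

Lemma rderiveP X v f x l : line_convex X v -> X x -> has_line X v x ->
  diff_quot v f x @ dirnbhs X v x --> l ->
  rderivable X v f x /\ rderive X v f x = l.
Proof.
move=> cX Xx hX fl; split; first exact: cvgP fl.
have FF := dirnbhs_proper cX Xx hX.
exact: cvg_lim fl.
Qed.

Lemma rderivable_cvg X v f x : rderivable X v f x ->
  diff_quot v f x @ dirnbhs X v x --> rderive X v f x.
Proof. by []. Qed.

Let diff_quot_congr X v f g x : X x -> (forall z, X z -> f z = g z) ->
  (diff_quot v f x @ dirnbhs X v x) = (diff_quot v g x @ dirnbhs X v x).
Proof.
move=> Xx fg; apply/funext => P; apply/propext; split=> H.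
  have : (0 : R)^' [set h | X (x + h *: v) -> P (diff_quot v f x h)] by exact: H.
  apply: filterS => h /= hP Xh.
  by have := hP Xh; rewrite /diff_quot !fg.
have : (0 : R)^' [set h | X (x + h *: v) -> P (diff_quot v g x h)] by exact: H.
apply: filterS => h /= hP Xh.
by have := hP Xh; rewrite /diff_quot !fg.
Qed.

Lemma eq_rderivable X v f g x : X x -> (forall z, X z -> f z = g z) ->
  rderivable X v f x -> rderivable X v g x.
Proof. by move=> Xx fg; rewrite /rderivable (diff_quot_congr v Xx fg). Qed.

Lemma eq_rderive X v f g x : X x -> (forall z, X z -> f z = g z) ->
  rderive X v f x = rderive X v g x.
Proof. by move=> Xx fg; rewrite /rderive (diff_quot_congr v Xx fg). Qed.

(** Shrinking the set and translating the argument only restricts the filter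
    along which the difference quotient converges. *)
Lemma rderive_shift X Y v f x y : line_convex X v -> X x -> has_line X v x ->
  (forall z, X z -> Y (z + y)) -> rderivable Y v f (x + y) ->
  rderivable X v (fun z => f (z + y)) x /\
  rderive X v (fun z => f (z + y)) x = rderive Y v f (x + y).
Proof.
move=> cX Xx hX XY /rderivable_cvg df; apply: rderiveP => //.
rewrite (_ : diff_quot v _ x = diff_quot v f (x + y)); last first.
  by apply/funext => h; rewrite /diff_quot addrAC.
apply: cvg_trans df; apply: cvg_app; apply: within_subset => h /= /XY.
by rewrite addrAC.
Qed.

Lemma rderive_sub X Y v f x : line_convex X v -> X x -> has_line X v x ->
  X `<=` Y -> rderivable Y v f x ->
  rderivable X v f x /\ rderive X v f x = rderive Y v f x.
Proof.
move=> cX Xx hX XY /rderivable_cvg df; apply: rderiveP => //.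
apply: cvg_trans df; apply: cvg_app; apply: within_subset => h /=.
exact: XY.
Qed.

(** Between two points of the convex set, all small increments stay in the set. *)
Lemma is_derive_line X v f x (a b s : R) : line_convex X v ->
  X (x + a *: v) -> X (x + b *: v) -> a < s < b ->
  rderivable X v f (x + s *: v) ->
  is_derive s 1 (fun s => f (x + s *: v)) (rderive X v f (x + s *: v)).
Proof.
move=> cX Xa Xb /andP[sa sb] /rderivable_cvg df.
have cf : (fun h => h^-1 *: (((fun s => f (x + s *: v)) \o shift s) (h *: 1) -
    f (x + s *: v))) @ (0 : R)^' --> rderive X v f (x + s *: v).
  rewrite (_ : (fun h => _) = diff_quot v f (x + s *: v)); last first.
    apply/funext => h.
    transitivity (h^-1 * (f (x + (h * 1 + s) *: v) - f (x + s *: v))); first by [].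
    by rewrite mulr1 scalerDl (addrC (h *: v)) addrA.
  apply: cvg_trans df; apply: cvg_app => P H.
  have {}H : (0 : R)^' [set h | X (x + s *: v + h *: v) -> P h] by exact: H.
  have e0 : 0 < Num.min (s - a) (b - s) by rewrite lt_min !subr_gt0 sa.
  have Hn : \forall h \near (0 : R)^', `|h| < Num.min (s - a) (b - s).
    exact: dnbhs0_lt.
  suff : (0 : R)^' P by [].
  apply: filterS2 H Hn => h /= H.
  rewrite lt_min !ltr_norml => /andP[/andP[? ?] /andP[? ?]]; apply: H.
  rewrite -addrA -scalerDl; apply: (cX x a b) => //.
  by apply/andP; split; lra.
by apply: DeriveDef; [exact: cvgP cf|exact: cvg_lim cf].
Qed.

(** Restricting the increments to the set can only lose information: a derivative
along the whole line is a derivative relative to the set. *)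
Lemma rderive_is_derive X v f x l : line_convex X v -> X x -> has_line X v x ->
  is_derive (0 : R) (1 : R) (fun s : R => f (x + s *: v)) l ->
  rderivable X v f x /\ rderive X v f x = l.
Proof.
move=> cX Xx hX [df dl]; apply: rderiveP => //.
have dE : (fun h => h^-1 *: (((fun s : R => f (x + s *: v)) \o shift 0) (h *: 1) -
    f (x + (0 : R) *: v))) = diff_quot v f x.
  apply/funext => h.
  transitivity (h^-1 * (f (x + (h * 1 + 0) *: v) - f (x + (0 : R) *: v))); first by [].
  by rewrite mulr1 addr0 scale0r addr0.
move: df; rewrite /derivable dE => df; move: dl; rewrite /derive dE => <-.
by apply: cvg_trans df; apply: cvg_app; exact: cvg_within.
Qed.

Lemma mvt_line X v f x (a b : R) : line_convex X v ->
  {within X, continuous f} -> (forall z, X z -> rderivable X v f z) ->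
  X (x + a *: v) -> X (x + b *: v) -> a <= b ->
  exists2 c, a <= c <= b &
    f (x + b *: v) - f (x + a *: v) = rderive X v f (x + c *: v) * (b - a).
Proof.
move=> cX cf df Xa Xb ab.
have [||c] := @MVT_segment R (fun s => f (x + s *: v))
  (fun s => rderive X v f (x + s *: v)) a b ab.
- move=> s; rewrite in_itv/= => sab; apply: (is_derive_line cX Xa Xb sab).
  by apply: df; apply: (cX x a b) => //; case/andP: sab => *; rewrite !ltW.
- apply/subspace_continuousP => s /=; rewrite in_itv/= => sab.
  have Xs := cX _ _ _ _ Xa Xb sab.
  have /subspace_continuousP/(_ _ Xs) := cf => cfs P HP.
  have HP' : nbhs (x + s *: v) [set z | X z -> P (f z)] by exact: (cfs P HP).
  rewrite /= /within/=.
  have cl : (fun t : R => x + t *: v) @ s --> x + s *: v.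
    by apply: cvgD; [exact: cvg_cst|apply: cvgZr_tmp; exact: cvg_id].
  have := cl _ HP'; apply: (@filterS _ (nbhs s)) => t /= Ht.
  by rewrite in_itv/= => tab; apply: Ht; exact: (cX _ _ _ _ Xa Xb tab).
- by rewrite in_itv/= => cab E; exists c.
Qed.

Lemma rderiveB X v f g x : line_convex X v -> X x -> has_line X v x ->
  rderivable X v f x -> rderivable X v g x ->
  rderivable X v (fun z => f z - g z) x /\
  rderive X v (fun z => f z - g z) x = rderive X v f x - rderive X v g x.
Proof.
move=> cX Xx hX /rderivable_cvg df /rderivable_cvg dg; apply: rderiveP => //.
rewrite (_ : diff_quot v _ x = diff_quot v f x \- diff_quot v g x).
  exact: cvgB.
by apply/funext => h; rewrite /diff_quot/=; ring.
Qed.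

Lemma rderiveD X v f g x : line_convex X v -> X x -> has_line X v x ->
  rderivable X v f x -> rderivable X v g x ->
  rderivable X v (fun z => f z + g z) x /\
  rderive X v (fun z => f z + g z) x = rderive X v f x + rderive X v g x.
Proof.
move=> cX Xx hX /rderivable_cvg df /rderivable_cvg dg; apply: rderiveP => //.
rewrite (_ : diff_quot v _ x = diff_quot v f x \+ diff_quot v g x).
  exact: cvgD.
by apply/funext => h; rewrite /diff_quot/=; ring.
Qed.

Lemma rderiveM X v f g x : line_convex X v -> X x -> has_line X v x ->
  rderivable X v f x -> rderivable X v g x ->
  rderivable X v (fun z => f z * g z) x /\
  rderive X v (fun z => f z * g z) x =
    rderive X v f x * g x + f x * rderive X v g x.
Proof.
move=> cX Xx hX /rderivable_cvg df /rderivable_cvg dg; apply: rderiveP => //.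
have FF := dirnbhs_proper cX Xx hX.
rewrite (_ : diff_quot v _ x =
    (fun h => diff_quot v f x h * (g x + h * diff_quot v g x h) +
              f x * diff_quot v g x h)).
  apply: cvgD; last by apply: cvgM => //; exact: cvg_cst.
  apply: cvgM => //; rewrite -[X in _ --> X]addr0; apply: cvgD; first exact: cvg_cst.
  have h0 : (h : R) @[h --> dirnbhs X v x] --> (0 : R).
    by move=> P HP; do 2 apply: cvg_within; exact: HP.
  by have := cvgM h0 dg; rewrite mul0r; apply.
apply/funext => h; rewrite /diff_quot/=; have [->|h0] := eqVneq h 0.
  by rewrite invr0 !mul0r mulr0 addr0.
by rewrite (mulrA h) mulfV// mul1r addrCA subrr addr0; ring.
Qed.

End relative_derivative.

(** * Functions of class C^k on a box *)

Section box_lines.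
Context {R : realType}.
Implicit Types (x y v : R * R) (n : nat).

Definition coord_dir v := v = e1 \/ v = e2.

Lemma coord_dir1 : coord_dir e1. Proof. by left. Qed.
Lemma coord_dir2 : coord_dir e2. Proof. by right. Qed.

Lemma box_line_convex n v : line_convex (box n) v.
Proof.
move=> x a b s /boxP[/= a1 a2] /boxP[/= b1 b2] /andP[sa sb]; apply/boxP => /=.
move: a1 a2 b1 b2; rewrite !ler_norml /GRing.scale/=.
move=> /andP[? ?] /andP[? ?] /andP[? ?] /andP[? ?].
have [v1|v1] := leP 0 v.1; have [v2|v2] := leP 0 v.2;
  by split; apply/andP; split; nra.
Qed.

Lemma addre1 x (h : R) : x + h *: e1 = (x.1 + h, x.2).
Proof. by rewrite [LHS]surjective_pairing /= /GRing.scale/= mulr1 mulr0 addr0. Qed.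

Lemma addre2 x (h : R) : x + h *: e2 = (x.1, x.2 + h).
Proof. by rewrite [LHS]surjective_pairing /= /GRing.scale/= mulr1 mulr0 addr0. Qed.

(** From any point of the interval, one of the two directions stays inside for a
length [N]. *)
Lemma interval_room (N t : R) : 0 < N -> `|t| <= N ->
  exists2 h, 0 < `|h| & forall s, 0 <= s <= 1 -> `|t + s * h| <= N.
Proof.
move=> N0; rewrite ler_norml => /andP[? ?]; have [t0|t0] := leP 0 t.
  exists (- N); first by rewrite normrN gtr0_norm.
  by move=> s /andP[? ?]; rewrite ler_norml; apply/andP; split; nra.
exists N; first by rewrite gtr0_norm.
by move=> s /andP[? ?]; rewrite ler_norml; apply/andP; split; nra.
Qed.

Lemma box_has_line n v x : coord_dir v -> box n.+1 x -> has_line (box n.+1) v x.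
Proof.
have N0 : 0 < n.+1%:R * pi :> R by rewrite mulr_gt0 ?pi_gt0.
move=> dv /boxP[x1 x2].
have [h1 h10 H1] := interval_room N0 x1; have [h2 h20 H2] := interval_room N0 x2.
have := H1 1; have := H2 1; rewrite ler01 lexx !mul1r => /(_ isT) ? /(_ isT) ?.
case: dv => ->; [exists h1|exists h2]; rewrite -?normr_gt0// ?addre1 ?addre2;
  exact/boxP.
Qed.

End box_lines.

Section class_Ck.
Context {R : realType}.
Implicit Types (x y v : R * R) (n k : nat) (f g : R * R -> R) (X Y : set (R * R)).

Lemma Ck_continuous k X f : Ck k X f -> {within X, continuous f}.
Proof. by case: k => [|k] []. Qed.

Lemma Ck_bound k X f : Ck k X f -> exists2 M, 0 <= M & forall x, X x -> `|f x| <= M.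
Proof.
have H : [bounded f x | x in X] -> exists2 M, 0 <= M & forall x, X x -> `|f x| <= M.
  move=> /pinfty_ex_gt0[M M0 HM]; exists M; first exact: ltW.
  by move=> x Xx; exact: HM.
by case: k => [|k] [_ [bf _]]; exact: H.
Qed.

Lemma Ck_rderivable k X f v x : Ck k.+1 X f -> coord_dir v -> X x ->
  rderivable X v f x.
Proof. by move=> [_ [_ df]] dv; have [+ _] := df v dv; apply. Qed.

Lemma Ck_rderive k X f v : Ck k.+1 X f -> coord_dir v -> Ck k X (rderive X v f).
Proof. by move=> [_ [_ df]] dv; have [] := df v dv. Qed.

Lemma Ck_pred k X f : Ck k.+1 X f -> Ck k X f.
Proof.
elim: k f => [|k IH] f [cf [bf df]]; first by [].
split=> //; split=> // v dv; have [dfv Cdf] := df v dv; split=> //; exact: IH.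
Qed.

Lemma Ck_iter m k X f v : Ck (m + k) X f -> coord_dir v ->
  Ck k X (iter m (rderive X v) f).
Proof.
move=> + dv; elim: m f => [//|m IH] f Cf.
rewrite iterSr; apply: IH; exact: Ck_rderive.
Qed.

Lemma within_congr X f g : (forall x, X x -> f x = g x) ->
  {within X, continuous f} -> {within X, continuous g}.
Proof.
move=> fg; apply: subspace_eq_continuous => x; rewrite inE => Xx.
exact: fg.
Qed.

Lemma bounded_congr X f g : (forall x, X x -> f x = g x) ->
  [bounded f x | x in X] -> [bounded g x | x in X].
Proof.
move=> fg; rewrite /bounded_near; apply: filterS => M HM x Xx.
by rewrite /= -fg//; exact: HM.
Qed.

(** Derivatives relative to [X] are limits along increments that stay in [X], so
they ignore the values outside of [X]. *)
Lemma eq_Ck k X f g : (forall x, X x -> f x = g x) -> Ck k X f -> Ck k X g.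
Proof.
elim: k f g => [|k IH] f g fg [cf [bf df]].
  by split; [exact: within_congr cf|split=> //; exact: bounded_congr bf].
split; first exact: within_congr cf.
split; first exact: bounded_congr bf.
move=> v dv; have [dfv Cdf] := df v dv; split=> [x Xx|].
  by apply: eq_rderivable (dfv x Xx).
by apply: IH Cdf => x Xx; exact: eq_rderive.
Qed.

Lemma within_subW X Y f : X `<=` Y ->
  {within Y, continuous f} -> {within X, continuous f}.
Proof. exact: continuous_subspaceW. Qed.

Lemma bounded_subW X Y f : X `<=` Y ->
  [bounded f x | x in Y] -> [bounded f x | x in X].
Proof.
by move=> XY; rewrite /bounded_near; apply: filterS => M HM x /XY; exact: HM.
Qed.

Lemma Ck_box_le k m n f : (m.+1 <= n)%N -> Ck k (box n) f -> Ck k (box m.+1) f.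
Proof.
move=> mn; have sub : box m.+1 `<=` (box n : set (R * R)) by move=> x; exact: box_le.
elim: k f => [|k IH] f [cf [bf df]].
  by split; [exact: within_subW cf|split=> //; exact: bounded_subW bf].
split; first exact: within_subW cf.
split; first exact: bounded_subW bf.
move=> v dv; have [dfv Cdf] := df v dv.
have E x : box m.+1 x -> rderivable (box m.+1) v f x /\
    rderive (box m.+1) v f x = rderive (box n) v f x.
  move=> Xx; apply: (rderive_sub (@box_line_convex _ _ _) Xx (box_has_line dv Xx) sub).
  exact/dfv/sub.
split=> [x /E[]//|].
by apply: eq_Ck (IH _ Cdf) => x /E[_ ->].
Qed.

Lemma bounded_le X f M : (forall x, X x -> `|f x| <= M) -> [bounded f x | x in X].
Proof.
move=> fM; exists M; split=> [|y My x Xx /=]; first exact: num_real.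
exact: le_trans (fM x Xx) (ltW My).
Qed.

Lemma boundedD X f g : [bounded f x | x in X] -> [bounded g x | x in X] ->
  [bounded f x + g x | x in X].
Proof.
move=> /pinfty_ex_gt0[M M0 HM] /pinfty_ex_gt0[N N0 HN].
apply: (@bounded_le _ _ (M + N)) => x Xx; rewrite (le_trans (ler_normD _ _))// lerD//; [exact: HM|exact: HN].
Qed.

Lemma boundedM X f g : [bounded f x | x in X] -> [bounded g x | x in X] ->
  [bounded f x * g x | x in X].
Proof.
move=> /pinfty_ex_gt0[M M0 HM] /pinfty_ex_gt0[N N0 HN].
apply: (@bounded_le _ _ (M * N)) => x Xx; rewrite normrM ler_pM//; [exact: HM|exact: HN].
Qed.

Lemma CkD k n f g : Ck k (box n.+1) f -> Ck k (box n.+1) g ->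
  Ck k (box n.+1) (fun x => f x + g x).
Proof.
elim: k f g => [|k IH] f g [cf [bf df]] [cg [bg dg]].
  by split; [move=> x; exact: (cvgD (cf x) (cg x))|split=> //; exact: boundedD].
split; first by move=> x; exact: (cvgD (cf x) (cg x)).
split; first exact: boundedD.
move=> v dv; have [dfv Cdf] := df v dv; have [dgv Cdg] := dg v dv.
have E x : box n.+1 x -> _ := fun Xx => rderiveD (@box_line_convex _ _ _) Xx
  (box_has_line dv Xx) (dfv x Xx) (dgv x Xx).
split=> [x /E[]//|].
by apply: eq_Ck (IH _ _ Cdf Cdg) => x /E[_ ->].
Qed.

Lemma CkM k n f g : Ck k (box n.+1) f -> Ck k (box n.+1) g ->
  Ck k (box n.+1) (fun x => f x * g x).
Proof.
elim: k f g => [|k IH] f g Cf Cg; move: (Cf) (Cg) => [cf [bf df]] [cg [bg dg]].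
  by split; [move=> x; exact: (cvgM (cf x) (cg x))|split=> //; exact: boundedM].
split; first by move=> x; exact: (cvgM (cf x) (cg x)).
split; first exact: boundedM.
move=> v dv; have [dfv Cdf] := df v dv; have [dgv Cdg] := dg v dv.
have E x : box n.+1 x -> _ := fun Xx => rderiveM (@box_line_convex _ _ _) Xx
  (box_has_line dv Xx) (dfv x Xx) (dgv x Xx).
split=> [x /E[]//|].
apply: eq_Ck (CkD (IH _ _ Cdf (Ck_pred Cg)) (IH _ _ (Ck_pred Cf) Cdg)) => x.
by move=> /E[_ ->].
Qed.

(** Outside of the box the values of a representative are arbitrary; composing
    with the projection onto the box gives a continuous representative on the
    whole plane. *)
Lemma Ck_clamp k n f : Ck k (box n) f -> continuous (f \o clamp n).
Proof. by move=> /Ck_continuous; exact: continuous_comp_clamp. Qed.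

End class_Ck.

(** * Mean value estimates *)

Section mean_value.
Context {R : realType}.
Implicit Types (x y z v w : R * R) (n k : nat) (f : R * R -> R) (X : set (R * R)).

Lemma mvt_line0 X v f x (h : R) : line_convex X v ->
  {within X, continuous f} -> (forall z, X z -> rderivable X v f z) ->
  X x -> X (x + h *: v) ->
  exists c, [/\ `|c| <= `|h|, X (x + c *: v) &
    f (x + h *: v) - f x = rderive X v f (x + c *: v) * h].
Proof.
move=> cX cf df Xx Xh; have X0 : X (x + 0 *: v) by rewrite scale0r addr0.
have [h0|h0] := leP 0 h.
  have [c /andP[c0 ch] E] := mvt_line cX cf df X0 Xh h0.
  exists c; split; first by rewrite !ger0_norm.
    by apply: (cX _ _ _ _ X0 Xh); rewrite c0.
  by move: E; rewrite scale0r addr0 subr0.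
have [c /andP[c0 ch] E] := mvt_line cX cf df Xh X0 (ltW h0).
exists c; split; first by rewrite !ler0_norm// ?lerN2// ltW.
  by apply: (cX _ _ _ _ Xh X0); rewrite c0.
by apply: oppr_inj; rewrite opprB -mulrN -[in RHS](sub0r h) -E scale0r addr0.
Qed.

(** The path with one side along each axis stays in the box. *)
Lemma box_lip n f (M1 M2 : R) x z : Ck 1 (box n.+1) f ->
  (forall u, box n.+1 u -> `|rderive (box n.+1) e1 f u| <= M1) ->
  (forall u, box n.+1 u -> `|rderive (box n.+1) e2 f u| <= M2) ->
  box n.+1 x -> box n.+1 z ->
  `|f z - f x| <= M1 * `|z.1 - x.1| + M2 * `|z.2 - x.2|.
Proof.
move=> Cf HM1 HM2 Xx Xz.
have cf := Ck_continuous Cf.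
have Xw : box n.+1 (x + (z.1 - x.1) *: e1).
  by move: Xx Xz => /boxP[_ ?] /boxP[? _]; rewrite addre1 addrC subrK; exact/boxP.
have zE : z = x + (z.1 - x.1) *: e1 + (z.2 - x.2) *: e2.
  by rewrite addre1 addre2/= !(addrC _ (_ - _)) !subrK -surjective_pairing.
have Xz' := Xz; rewrite zE in Xz'.
have [c [_ Xc Ec]] := mvt_line0 (@box_line_convex _ n.+1 e1) cf
  (fun u Xu => Ck_rderivable Cf coord_dir1 Xu) Xx Xw.
have [d [_ Xd Ed]] := mvt_line0 (@box_line_convex _ n.+1 e2) cf
  (fun u Xu => Ck_rderivable Cf coord_dir2 Xu) Xw Xz'.
have -> : f z - f x = (f (x + (z.1 - x.1) *: e1) - f x) +
    (f z - f (x + (z.1 - x.1) *: e1)) by ring.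
rewrite [in f z]zE Ed Ec (le_trans (ler_normD _ _))//.
rewrite !normrM.
exact: lerD (ler_wpM2r (normr_ge0 _) (HM1 _ Xc)) (ler_wpM2r (normr_ge0 _) (HM2 _ Xd)).
Qed.

(** The maximum of [|s + t|] and [|s - t|] is [|s| + |t|]; applied to the
coordinates of [x] and [y], it keeps in the box all points met on the way between
[x - y] and [x + y]. *)
Lemma normD_le (s t N : R) : `|s + t| <= N -> `|s - t| <= N -> `|s| + `|t| <= N.
Proof.
rewrite !ler_norml => /andP[? ?] /andP[? ?].
by case: (ger0P s) => ?; case: (ger0P t) => ?; lra.
Qed.

Definition sdiff f x y := 2 * f x - f (x + y) - f (x - y).

(** Going from [x] to [x + y] and to [x - y] along the coordinate axes, first
horizontally, each half of the second difference is a difference of first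
derivatives at two points at a distance of the order of [|y|], times a coordinate
of [y]. On these paths the mixed derivative occurs in one order only. *)
Lemma sdiff_le n f (M : R) x y : Ck 2 (box n.+1) f ->
  (forall u, box n.+1 u ->
    `|rderive (box n.+1) e1 (rderive (box n.+1) e1 f) u| <= M) ->
  (forall u, box n.+1 u ->
    `|rderive (box n.+1) e1 (rderive (box n.+1) e2 f) u| <= M) ->
  (forall u, box n.+1 u ->
    `|rderive (box n.+1) e2 (rderive (box n.+1) e2 f) u| <= M) ->
  box n.+1 (x + y) -> box n.+1 (x - y) ->
  `|sdiff f x y| <= 3 * M * enorm y ^+ 2.
Proof.
move=> Cf M11 M12 M22 Xp Xm; set N : R := n.+1%:R * pi.
have M0 : 0 <= M by exact: le_trans (M11 _ Xp).
have cf := Ck_continuous Cf.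
have Cf1 := Ck_rderive Cf coord_dir1; have Cf2 := Ck_rderive Cf coord_dir2.
have [M21 _ HM21] := Ck_bound (Ck_rderive Cf1 coord_dir2).
case: x y Xp Xm => [x1 x2] [a b] /boxP/= [P1 P2] /boxP/= [Q1 Q2].
have N1 := normD_le P1 Q1; have N2 := normD_le P2 Q2.
have X (s t : R) : `|s| <= `|a| -> `|t| <= `|b| -> box n.+1 (x1 + s, x2 + t).
  move=> sa tb; apply/boxP; rewrite -/N; split.
    by rewrite (le_trans (ler_normD _ _))// (le_trans _ N1)// lerD2l.
  by rewrite (le_trans (ler_normD _ _))// (le_trans _ N2)// lerD2l.
have X1 (s : R) : `|s| <= `|a| -> box n.+1 (x1 + s, x2).
  by move=> sa; rewrite -[x2]addr0; apply: X; rewrite ?normr0.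
have X0 : box n.+1 (x1, x2) by rewrite -[x1]addr0; apply: X1; rewrite normr0.
have step2 (s t : R) : `|s| <= `|a| -> `|t| <= `|b| ->
    exists2 c, `|c| <= `|b| & f (x1 + s, x2 + t) - f (x1 + s, x2) =
      rderive (box n.+1) e2 f (x1 + s, x2 + c) * t.
  move=> sa tb; have Xs := X1 s sa.
  have Xst : box n.+1 ((x1 + s, x2) + t *: e2) by rewrite addre2; exact: X.
  have [c [ct _]] := mvt_line0 (@box_line_convex _ n.+1 e2) cf
    (fun u Xu => Ck_rderivable Cf coord_dir2 Xu) Xs Xst.
  by rewrite !addre2/= => E; exists c => //; exact: le_trans tb.
have step1 (s : R) : `|s| <= `|a| ->
    exists2 c, `|c| <= `|a| & f (x1 + s, x2) - f (x1, x2) =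
      rderive (box n.+1) e1 f (x1 + c, x2) * s.
  move=> sa; have Xs : box n.+1 ((x1, x2) + s *: e1) by rewrite addre1; exact: X1.
  have [c [cs _]] := mvt_line0 (@box_line_convex _ n.+1 e1) cf
    (fun u Xu => Ck_rderivable Cf coord_dir1 Xu) X0 Xs.
  by rewrite !addre1/= => E; exists c => //; exact: le_trans sa.
have aN : `|- a| <= `|a| by rewrite normrN.
have bN : `|- b| <= `|b| by rewrite normrN.
have [c cb Ec] := step2 _ _ (lexx `|a|) (lexx `|b|).
have [d db Ed] := step2 _ _ aN bN.
have [p pa Ep] := step1 _ (lexx `|a|).
have [q qa Eq] := step1 _ aN.
have L2 := box_lip Cf2 M12 M22 (X _ _ aN db) (X _ _ (lexx `|a|) cb).
have L1 := box_lip Cf1 M11 HM21 (X1 _ qa) (X1 _ pa).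
move: L1 L2; rewrite /= subrr normr0 mulr0 addr0.
set D1p := rderive _ _ _ _; set D1q := rderive _ _ _ _.
set D2p := rderive _ _ _ _; set D2q := rderive _ _ _ _ => L1 L2.
have pq : `|x1 + p - (x1 + q)| <= 2 * `|a|.
  rewrite (_ : _ - _ = p - q); last by ring.
  by rewrite (le_trans (ler_normB _ _))// mulr_natl mulr2n lerD.
have cd : `|x2 + c - (x2 + d)| <= 2 * `|b|.
  rewrite (_ : _ - _ = c - d); last by ring.
  by rewrite (le_trans (ler_normB _ _))// mulr_natl mulr2n lerD.
have aa : `|x1 + a - (x1 - a)| = 2 * `|a|.
  by rewrite (_ : _ - _ = 2 * a); [rewrite normrM normr_nat|ring].
have SE : sdiff f (x1, x2) (a, b) = - ((D2p - D2q) * b + (D1p - D1q) * a).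
  have -> : (D2p - D2q) * b + (D1p - D1q) * a =
      (f (x1 + a, x2 + b) - f (x1 + a, x2)) + (f (x1 - a, x2 - b) - f (x1 - a, x2)) +
      (f (x1 + a, x2) - f (x1, x2)) + (f (x1 - a, x2) - f (x1, x2)).
    by rewrite Ec Ed Ep Eq /D1p /D1q /D2p /D2q; ring.
  rewrite /sdiff (_ : (x1, x2) + (a, b) = (x1 + a, x2 + b))//.
  by rewrite (_ : (x1, x2) - (a, b) = (x1 - a, x2 - b))//; ring.
rewrite SE normrN (le_trans (ler_normD _ _))// !normrM sqr_enorm/=.
rewrite -[a ^+ 2]real_normK ?num_real// -[b ^+ 2]real_normK ?num_real//.
have B2 : `|D2p - D2q| <= M * (2 * `|a| + 2 * `|b|).
  by rewrite (le_trans L2)// aa mulrDr lerD2l ler_wpM2l.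
have B1 : `|D1p - D1q| <= M * (2 * `|a|) by rewrite (le_trans L1)// ler_wpM2l.
have a0 := normr_ge0 a; have b0 := normr_ge0 b.
apply: (@le_trans _ _ (M * (2 * `|a| + 2 * `|b|) * `|b| + M * (2 * `|a|) * `|a|)).
  by rewrite lerD// ler_wpM2r.
have : 0 <= M * (`|a| - `|b|) ^+ 2 by rewrite mulr_ge0// sqr_ge0.
set A := `|a|; set B := `|b|; rewrite -subr_ge0 => H.
have H2 : 0 <= M * B ^+ 2 by rewrite mulr_ge0// sqr_ge0.
nra.
Qed.

(** The second difference quotient of [f] along two distinct axes is a value of
    the mixed derivative, in either order; continuity then identifies the two. *)
Let mixed_mvt n f x (v w : R * R) (h k : R) : Ck 2 (box n.+1) f ->
  (v = e1 /\ w = e2) \/ (v = e2 /\ w = e1) ->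
  box n.+1 x -> box n.+1 (x + h *: v) -> box n.+1 (x + k *: w) ->
  exists c d, [/\ `|c| <= `|h|, `|d| <= `|k|, box n.+1 (x + c *: v + d *: w) &
    f (x + h *: v + k *: w) - f (x + h *: v) - f (x + k *: w) + f x =
      rderive (box n.+1) w (rderive (box n.+1) v f) (x + c *: v + d *: w) * (h * k)].
Proof.
move=> Cf vw Xx Xh Xk.
have dv : coord_dir v by case: vw => -[-> _]; [left|right].
have dw : coord_dir w by case: vw => -[_ ->]; [right|left].
(* The increment in the direction [w] is a function on the smaller box [Z]. *)
pose Z := [set z | box n.+1 z /\ box n.+1 (z + k *: w)].
have ZX : Z `<=` box n.+1 by move=> z [].
have cZ : line_convex Z v.
  move=> z a b s [za zak] [zb zbk] sab; split; first exact: (box_line_convex za zb).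
  rewrite addrAC; apply: (@box_line_convex _ n.+1 v (z + k *: w) a b) => //.
    by rewrite addrAC.
  by rewrite addrAC.
have Xhk : box n.+1 (x + h *: v + k *: w).
  move: Xx Xh Xk; case: vw => -[-> ->]; rewrite ?(addre1, addre2)/= => /boxP[/= ? ?] /boxP[/= ? ?] /boxP[/= ? ?];
    exact/boxP.
have lZ z : Z z -> has_line Z v z.
  move=> [Xz Xzk]; have [a a0 Xza] := box_has_line dv Xz; exists a => //; split=> //.
  move: Xz Xzk Xza; case: vw => -[-> ->]; rewrite ?(addre1, addre2)/= => /boxP[/= ? ?] /boxP[/= ? ?] /boxP[/= ? ?];
    exact/boxP.
have Zx : Z x by [].
have Zh : Z (x + h *: v) by [].
have E z : Z z -> _ := fun Zz => rderiveB cZ Zz (lZ z Zz)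
  (rderive_shift cZ Zz (lZ z Zz) (fun u (Zu : Z u) => Zu.2)
    (Ck_rderivable Cf dv Zz.2)).1
  (rderive_sub cZ Zz (lZ z Zz) ZX (Ck_rderivable Cf dv Zz.1)).1.
have cF : {within Z, continuous (fun z => f (z + k *: w) - f z)}.
  apply/subspace_continuousP => z [Xz Xzk]; apply: cvgB.
    have /subspace_continuousP/(_ _ Xzk) := Ck_continuous Cf => cfz P HP.
    have HP' : nbhs (z + k *: w) [set u | box n.+1 u -> P (f u)] by exact: (cfz P HP).
    have cl : (fun u => u + k *: w) @ z --> z + k *: w.
      by apply: cvgD; [exact: cvg_id|exact: cvg_cst].
    have := cl _ HP'; apply: (@filterS _ (nbhs z)) => u /= Hu [_ Xu]; exact: Hu.
  have /subspace_continuousP/(_ _ Xz) := Ck_continuous Cf.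
  by apply: cvg_trans; apply: cvg_app; apply: within_subset.
have [c [ch Zc Ec]] := mvt_line0 cZ cF (fun z Zz => (E z Zz).1) Zx Zh.
move: Ec; rewrite (E _ Zc).2.
rewrite (rderive_shift cZ Zc (lZ _ Zc) (fun u (Zu : Z u) => Zu.2) (Ck_rderivable Cf dv Zc.2)).2.
rewrite (rderive_sub cZ Zc (lZ _ Zc) ZX (Ck_rderivable Cf dv Zc.1)).2 => Ec.
have Cfv := Ck_rderive Cf dv.
have [d [dk Xd Ed]] := mvt_line0 (@box_line_convex _ n.+1 w) (Ck_continuous Cfv)
  (fun u Xu => Ck_rderivable Cfv dw Xu) Zc.1 Zc.2.
exists c, d; split=> //.
have -> : f (x + h *: v + k *: w) - f (x + h *: v) - f (x + k *: w) + f x =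
  (f (x + h *: v + k *: w) - f (x + h *: v)) - (f (x + k *: w) - f x) by ring.
by rewrite Ec Ed; ring.
Qed.

(** Both orders are limits of the same mixed second difference quotient. *)
Lemma rderive_comm n f x : Ck 2 (box n.+1) f -> box n.+1 x ->
  rderive (box n.+1) e1 (rderive (box n.+1) e2 f) x =
  rderive (box n.+1) e2 (rderive (box n.+1) e1 f) x.
Proof.
move=> Cf Xx.
set D12 := rderive _ _ (rderive _ e2 f); set D21 := rderive _ _ (rderive _ e1 f).
have c12 : {within box n.+1, continuous D12}.
  exact: Ck_continuous (Ck_rderive (Ck_rderive Cf coord_dir2) coord_dir1).
have c21 : {within box n.+1, continuous D21}.
  exact: Ck_continuous (Ck_rderive (Ck_rderive Cf coord_dir1) coord_dir2).
apply/eqP; rewrite -subr_eq0 -normr_eq0 eq_le normr_ge0 andbT.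
apply/ler_addgt0Pl => e e0; rewrite addr0.
have e20 : 0 < e / 2 by rewrite divr_gt0.
have /subspace_continuousP/(_ _ Xx)/cvgrPdist_lt/(_ _ e20) := c12.
have /subspace_continuousP/(_ _ Xx)/cvgrPdist_lt/(_ _ e20) := c21.
move=> /nbhs_ballP[r1 /= r10 H1] /nbhs_ballP[r2 /= r20 H2].
pose r := Num.min r1 r2; have r0 : 0 < r by rewrite lt_min r10.
have N0 : 0 < n.+1%:R * pi :> R by rewrite mulr_gt0 ?pi_gt0.
have /boxP[x1 x2] := Xx.
have room (t : R) : `|t| <= n.+1%:R * pi ->
    exists2 h, 0 < `|h| < r & `|t + h| <= n.+1%:R * pi.
  move=> /(interval_room N0)[h h0 Hh].
  pose s := Num.min 1 (r / 2 / `|h|).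
  have s0 : 0 < s by rewrite lt_min ltr01/= !divr_gt0.
  have s1 : s <= 1 by rewrite ge_min lexx.
  exists (s * h); last by apply: Hh; rewrite ltW.
  rewrite normrM (gtr0_norm s0) mulr_gt0//=.
  have : s <= r / 2 / `|h| by rewrite ge_min lexx orbT.
  by rewrite ler_pdivlMr// => /le_lt_trans; apply; lra.
have [h /andP[h0 hr] Hh] := room _ x1; have [k /andP[k0 kr] Hk] := room _ x2.
have Xh : box n.+1 (x + h *: e1) by rewrite addre1; exact/boxP.
have Xk : box n.+1 (x + k *: e2) by rewrite addre2; exact/boxP.
have [c [d [ch dk Xcd E1]]] := mixed_mvt Cf (or_introl (conj erefl erefl)) Xx Xh Xk.
have [c' [d' [ch' dk' Xcd' E2]]] := mixed_mvt Cf (or_intror (conj erefl erefl)) Xx Xk Xh.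
have hk0 : h * k != 0 by rewrite mulf_neq0// -normr_gt0.
have E : D21 (x + c *: e1 + d *: e2) = D12 (x + c' *: e2 + d' *: e1).
  apply: (mulIf hk0); rewrite /D21 /D12 -E1 [h * k]mulrC -E2.
  by rewrite (addrAC x (k *: e2)); ring.
have near1 : `|D21 x - D21 (x + c *: e1 + d *: e2)| < e / 2.
  apply: H1 => //; rewrite addre1 addre2/=; split=> /=; rewrite /ball/= opprD addNKr normrN.
    by rewrite (le_lt_trans ch)// (lt_le_trans hr)// ge_min lexx.
  by rewrite (le_lt_trans dk)// (lt_le_trans kr)// ge_min lexx.
have near2 : `|D12 x - D12 (x + c' *: e2 + d' *: e1)| < e / 2.
  apply: H2 => //; rewrite addre2 addre1/=; split=> /=; rewrite /ball/= opprD addNKr normrN.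
    by rewrite (le_lt_trans dk')// (lt_le_trans hr)// ge_min lexx orbT.
  by rewrite (le_lt_trans ch')// (lt_le_trans kr)// ge_min lexx orbT.
have -> : D12 x - D21 x = (D12 x - D12 (x + c' *: e2 + d' *: e1)) -
    (D21 x - D21 (x + c *: e1 + d *: e2)) by rewrite E; ring.
apply: (le_trans (ler_normB _ _)); rewrite (splitr e).
exact: lerD (ltW near2) (ltW near1).
Qed.

End mean_value.

(** * The periodised kernel *)

Section esum_bounds.
Context {R : realType}.

(** The integers are enumerated in pairs consisting of [n] and [- n - 1]. *)
Lemma esum_int_le (a : int -> R) (C : R) : (forall j, 0 <= a j) ->
  (forall N, \sum_(0 <= n < N) (a (Posz n) + a (Negz n)) <= C) ->
  (\esum_(j in [set: int]) (a j)%:E <= C%:E)%E.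
Proof.
move=> a0 aC.
have TE : [set: int] = Posz @` setT `|` Negz @` setT.
  by apply/seteqP; split=> // -[n|n] _; [left|right]; exists n.
rewrite (esumID (range Posz)); last by move=> j _; rewrite lee_fin.
rewrite setTI (_ : _ `&` ~` _ = range Negz); last first.
  apply/seteqP; split=> [[n|n] [_ /= h]|_ [n _ <-]].
  - by exfalso; apply: h; exists n.
  - by exists n.
  - by split=> // -[].
rewrite !esum_image; [|by move=> ? ? _ _ [] |by move=> ? ? _ _ []].
rewrite -esumD; [|by move=> *; rewrite lee_fin..].
rewrite -nneseries_esumT; last by move=> n; rewrite adde_ge0// lee_fin.
apply: lime_le.
  by apply: is_cvg_nneseries => n _ _; rewrite adde_ge0// lee_fin.
apply: nearW => N.
rewrite (eq_bigr (fun n => (a (Posz n) + a (Negz n))%:E)); last by move=> n _; rewrite EFinD.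
by rewrite sumEFin lee_fin.
Qed.

(** The power [(n + 1)^(-3/2)], with a square root in place of a real exponent. *)
Definition wt (n : nat) : R := (Num.sqrt n.+1%:R) ^- 3.

Lemma wt_ge0 n : 0 <= wt n.
Proof. by rewrite invr_ge0 exprn_ge0// sqrtr_ge0. Qed.

(** Comparison with the integral of [t^(-3/2)], written as a telescoping bound. *)
Lemma wt_tail (n : nat) : wt n.+1 <= 2 / Num.sqrt n.+1%:R - 2 / Num.sqrt n.+2%:R.
Proof.
rewrite /wt; set a := Num.sqrt n.+1%:R; set b := Num.sqrt n.+2%:R.
have a0 : 0 < a by rewrite sqrtr_gt0.
have b0 : 0 < b by rewrite sqrtr_gt0.
have ab : a <= b by rewrite ler_wsqrtr// ler_nat.
have E : (b - a) * (a + b) = 1.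
  have -> : (b - a) * (a + b) = b ^+ 2 - a ^+ 2 by ring.
  by rewrite !sqr_sqrtr// -natrB// subSnn.
have -> : 2 / a - 2 / b = 2 * (b - a) / (a * b).
  by field; rewrite !gt_eqF.
have -> : b - a = (a + b)^-1.
  by apply: (mulIf (_ : a + b != 0)); rewrite ?gt_eqF ?addr_gt0// E mulVf// gt_eqF// addr_gt0.
rewrite -mulrA -invfM -[b ^- 3]mul1r ler_pdivrMr ?exprn_gt0//.
rewrite mulrAC ler_pdivlMr ?mulr_gt0 ?addr_gt0// mul1r.
have -> : 2 * b ^+ 3 = (b + b) * (b * b) by ring.
apply: ler_pM; [by rewrite addr_ge0 ?ltW|by rewrite mulr_ge0 ?ltW|by rewrite lerD|].
by apply: ler_wpM2r => //; exact: ltW.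
Qed.

Lemma sum_wt N : \sum_(0 <= n < N) wt n <= 3.
Proof.
case: N => [|N]; first by rewrite big_nil.
suff : \sum_(0 <= n < N.+1) wt n <= 3 - 2 / Num.sqrt N.+1%:R.
  by move/le_trans; apply; rewrite gerBl divr_ge0// sqrtr_ge0.
elim: N => [|N IH].
  by rewrite big_nat1 /wt !sqrtr1 expr1n !invr1 mulr1; lra.
rewrite big_nat_recr//=; have := wt_tail N; lra.
Qed.

Lemma esum_wt_le (c : R) : 0 <= c ->
  (\esum_(j in [set: int]) (c * wt `|j|%N)%:E <= (c * 6)%:E)%E.
Proof.
move=> c0; apply: esum_int_le => [j|N]; first by rewrite mulr_ge0// wt_ge0.
under eq_bigr do rewrite -mulrDr.
rewrite -mulr_sumr ler_wpM2l// big_split/=.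
have S1 : \sum_(0 <= n < N) wt `|Posz n|%N <= 3 by exact: sum_wt.
have S2 : \sum_(0 <= n < N) wt `|Negz n|%N <= 3.
  apply: le_trans (sum_wt N.+1); rewrite big_nat_recl//=.
  by rewrite lerDr wt_ge0.
lra.
Qed.

End esum_bounds.

Section kernel.
Context {R : realType}.
Implicit Types (y : R * R) (k : int * int).
Notation plane := (measurableTypeR R * measurableTypeR R)%type.

Definition Kconst : R := 2 * Gamma (3 / 2) / (`|Gamma (- (1 / 2) : R)| * pi).

Definition lattice_sum y : R :=
  fine (esum [set k : int * int | k <> (0, 0)]
          (fun k => (enorm (y - lattice_pt k) ^- 3)%:E)).

Lemma KE y : K y = Kconst * (enorm y ^- 3 + lattice_sum y).
Proof. by []. Qed.

(** Only the numerator needs an argument, the denominator being an absolute value: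
at [3 / 2] the function [Gamma] is the integral of a nonnegative function. *)
Lemma Kconst_ge0 : 0 <= Kconst.
Proof.
have G0 : 0 <= Gamma (3 / 2) :> R.
  have h : (0 < 3 / 2 :> R) = true by apply/idP; lra.
  rewrite /Gamma h big_ord0 divr1 /Gamma_pos; apply: Rintegral_ge0 => t _.
  by rewrite mulr_ge0 ?powR_ge0 ?expR_ge0.
apply: divr_ge0; first exact: mulr_ge0.
by apply: mulr_ge0 => //; exact: pi_ge0.
Qed.

Let lattice_term_ge0 y k : (0 <= (enorm (y - lattice_pt k) ^- 3)%:E)%E.
Proof. by rewrite lee_fin invr_ge0 exprn_ge0// enorm_ge0. Qed.

Lemma lattice_sum_ge0 y : 0 <= lattice_sum y.
Proof. by apply: fine_ge0; apply: esum_ge0 => k _; exact: lattice_term_ge0. Qed.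

Lemma lattice_dist y (j : int) (t : R) : `|t| <= pi -> (0 < `|j|)%N ->
  `|j|%N%:R * pi <= `|t - (pi *+ 2) * j%:~R|.
Proof.
move=> tp j0; have pi0 := pi_gt0 R.
have E : `|(pi *+ 2) * j%:~R| = 2 * (`|j|%N%:R * pi) :> R.
  by rewrite normrM -(mulr_natl pi) normrM normr_nat (gtr0_norm pi0) natr_absz intr_norm; ring.
have := lerB_dist ((pi *+ 2) * j%:~R) t; rewrite E distrC.
have : 1 <= `|j|%N%:R :> R by rewrite ler1n.
nra.
Qed.

(** On the box the distance to the lattice point indexed by [k] is at least
    [pi] times the sup norm of [k], so the sum is dominated by a product of two
    convergent one-dimensional sums. *)
Lemma lattice_term_le y k : box 1 y -> k <> (0, 0) ->
  enorm (y - lattice_pt k) ^- 3 <= wt `|k.1|%N * wt `|k.2|%N.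
Proof.
move=> /boxP[]; rewrite mul1r; case: k => a b /= y1 y2 k0.
set E := enorm _; set m := `|a|%N; set n := `|b|%N.
have pi2 : 2 <= pi :> R by exact: pi_ge2.
have m0 : 0 <= m%:R :> R by []. have n0 : 0 <= n%:R :> R by [].
have sE : m.+1%:R * n.+1%:R <= E ^+ 2.
  rewrite sqr_enorm /= -!natr1.
  have H1 : (0 < m)%N -> (m%:R * pi) ^+ 2 <= (y.1 - pi *+ 2 * a%:~R) ^+ 2.
    move=> m1; rewrite -[leRHS]real_normK ?num_real// ler_pXn2r ?nnegrE ?mulr_ge0 ?pi_ge0//.
    exact: lattice_dist.
  have H2 : (0 < n)%N -> (n%:R * pi) ^+ 2 <= (y.2 - pi *+ 2 * b%:~R) ^+ 2.
    move=> n1; rewrite -[leRHS]real_normK ?num_real// ler_pXn2r ?nnegrE ?mulr_ge0 ?pi_ge0//.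
    exact: lattice_dist.
  have Q1 := sqr_ge0 (y.1 - pi *+ 2 * a%:~R); have Q2 := sqr_ge0 (y.2 - pi *+ 2 * b%:~R).
  have sq (t : R) : 0 <= t -> (t * 2) ^+ 2 <= (t * pi) ^+ 2.
    by move=> t0; rewrite ler_pXn2r ?nnegrE ?mulr_ge0 ?pi_ge0// ler_wpM2l.
  have Sm := sq _ m0; have Sn := sq _ n0.
  have [m1|m1] := posnP m; have [n1|n1] := posnP n.
  - exfalso; apply: k0; move/eqP: m1; move/eqP: n1; rewrite !absz_eq0.
    by move=> /eqP -> /eqP ->.
  - have := H2 n1; have : 1 <= n%:R :> R by rewrite ler1n.
    rewrite m1; nra.
  - have := H1 m1; have : 1 <= m%:R :> R by rewrite ler1n.
    rewrite n1; nra.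
  - have := H1 m1; have := H2 n1; have : 1 <= n%:R :> R by rewrite ler1n.
    have : 1 <= m%:R :> R by rewrite ler1n.
    move=> m1' n1' h2 h1.
    have h3 : (m%:R + 1) * (n%:R + 1) <= (2 * m%:R) * (2 * n%:R) :> R.
      by apply: ler_pM; lra.
    have := sqr_ge0 (m%:R - n%:R : R); nra.
have ab0 : 0 < Num.sqrt m.+1%:R * Num.sqrt n.+1%:R :> R.
  by rewrite mulr_gt0// sqrtr_gt0.
rewrite /wt -invfM -exprMn lef_pV2 ?posrE ?exprn_gt0//; last first.
  rewrite lt_def enorm_ge0 andbT; apply: contraTneq sE; rewrite -/E => ->.
  by rewrite expr0n/= -ltNge mulr_gt0.
apply: lerXn2r; rewrite ?nnegrE; [exact: ltW|exact: enorm_ge0|].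
rewrite leNgt; apply/negP => lt_E.
have E0 : 0 <= E by exact: enorm_ge0.
have : (Num.sqrt m.+1%:R * Num.sqrt n.+1%:R) ^+ 2 = m.+1%:R * n.+1%:R :> R.
  by rewrite exprMn !sqr_sqrtr.
nra.
Qed.

Lemma lattice_esum_le y : box 1 y ->
  (\esum_(k in [set k : int * int | k <> (0, 0)%R])
     (enorm (y - lattice_pt k) ^- 3)%:E <= (36 : R)%:E)%E.
Proof.
move=> y1.
apply: (@le_trans _ _ (\esum_(k in [set: int] `*`` (fun=> [set: int]))
    (wt `|k.1|%N * wt `|k.2|%N : R)%:E)%E).
  rewrite esum_mkcond (_ : _ `*`` _ = [set: int * int]); last first.
    by apply/seteqP; split.
  apply: le_esum => k _; case: ifPn => [/set_mem k0|_].
    by rewrite lee_fin; exact: lattice_term_le.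
  by rewrite lee_fin mulr_ge0 ?wt_ge0.
rewrite -(@esum_esum _ _ _ setT (fun=> setT) (fun i j => (wt `|i|%N * wt `|j|%N : R)%:E)).
  apply: (@le_trans _ _ (\esum_(i in [set: int]) (6 * wt `|i|%N : R)%:E)%E).
    by apply: le_esum => i _; rewrite mulrC; apply: esum_wt_le; exact: wt_ge0.
  by apply: le_trans (esum_wt_le _) _; [|rewrite lee_fin; lra].
by move=> i j _ _; rewrite lee_fin mulr_ge0 ?wt_ge0.
Qed.

Lemma lattice_sum_le y : box 1 y -> lattice_sum y <= 36.
Proof.
move=> /lattice_esum_le yS; rewrite -lee_fin /lattice_sum fineK//.
rewrite ge0_fin_numE; first by apply: le_lt_trans yS _; rewrite ltry.
by apply: esum_ge0 => k _; exact: lattice_term_ge0.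
Qed.

(** The set of nonzero lattice points is symmetric. *)
Lemma lattice_sumN y : lattice_sum (- y) = lattice_sum y.
Proof.
rewrite /lattice_sum; congr fine.
rewrite (@reindex_esum _ _ _ [set k : int * int | k <> (0, 0)] _ (fun k => (- k.1, - k.2))).
  apply: eq_esum => k _; rewrite (_ : - y - _ = - (y - lattice_pt k)) ?enormN//.
  rewrite opprB [RHS]addrC; congr (_ + _).
  by rewrite /lattice_pt /= [LHS]surjective_pairing/= !mulrNz !mulrN !opprK.
split=> [[a b] /= k0 []|[a b] [c d] _ _ [] /oppr_inj -> /oppr_inj -> //|[a b] /= k0].
  by move=> /eqP; rewrite oppr_eq0 => /eqP a0 /eqP; rewrite oppr_eq0 => /eqP b0; apply: k0; rewrite a0 b0.
exists (- a, - b); last by rewrite /= !opprK.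
by move=> [] /eqP; rewrite oppr_eq0 => /eqP a0 /eqP; rewrite oppr_eq0 => /eqP b0; apply: k0; rewrite a0 b0.
Qed.

Lemma measurable_invn_enorm (p : nat) (a : plane) :
  measurable_fun [set: plane] (fun y : plane => enorm (y - a) ^- p).
Proof.
rewrite (_ : (fun y => _) = (fun y => ((enorm (- a + y))^-1) ^+ p)); last first.
  by apply/funext => y; rewrite exprVn addrC.
apply: measurable_funX.
exact: (measurableT_comp (@measurable_inv_enorm R) (measurable_plane_add (- a))).
Qed.

(** Pickling turns the sum over the lattice into a series, which is measurable
termwise. *)
Lemma measurable_lattice_sum : measurable_fun [set: plane] (fun y : plane => lattice_sum y).
Proof.
pose P := [set n : nat | exists2 k : int * int, k <> (0, 0) & pickle k = n].
pose e (n : nat) : int * int := odflt (0, 0) (unpickle n).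
have eK k : e (pickle k) = k by rewrite /e pickleK.
have PE : [set k : int * int | k <> (0, 0)] = [set e n | n in P].
  apply/seteqP; split=> [k k0|_ [_ [k k0 <-] <-]]; last by rewrite eK.
  by exists (pickle k); rewrite ?eK//; exists k.
have einj : set_inj P e.
  by move=> _ _ /set_mem[k _ <-] /set_mem[l _ <-]; rewrite !eK => ->.
apply: (measurableT_comp (fine_measurable measurableT)).
rewrite (_ : (fun y => _) = (fun y : plane =>
    \sum_(i <oo | i \in P) (enorm (y - lattice_pt (e i)) ^- 3)%:E)%E); last first.
  by apply/funext => y; rewrite PE esum_set_image.
apply: ge0_emeasurable_sum => [n y _ _|n _]; first exact: lattice_term_ge0.
by apply/measurable_EFinP; exact: measurable_invn_enorm.
Qed.

Lemma measurable_K : measurable_fun [set: plane] (fun y : plane => K y).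
Proof.
apply: measurable_funM => //; apply: measurable_funD; last exact: measurable_lattice_sum.
have := measurable_invn_enorm 3 0; apply: eq_measurable_fun => y _.
by rewrite subr0.
Qed.

Lemma K_ge0 y : 0 <= K y.
Proof.
rewrite KE mulr_ge0 ?Kconst_ge0// addr_ge0 ?lattice_sum_ge0//.
by rewrite invr_ge0 exprn_ge0// enorm_ge0.
Qed.

Lemma KN y : K (- y) = K y.
Proof. by rewrite !KE enormN lattice_sumN. Qed.

(** On the box [K y <= Kbound * |y|^-3]; the diameter of the box turns the bound
[36] of the lattice sum into a multiple of [|y|^-3]. *)
Definition Kbound : R := Kconst * (1 + 36 * (2 * pi) ^+ 3).

Lemma Kbound_ge0 : 0 <= Kbound.
Proof.
by rewrite mulr_ge0 ?Kconst_ge0// addr_ge0// mulr_ge0// exprn_ge0// mulr_ge0 ?pi_ge0.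
Qed.

Lemma K_mul_sqr_le y : box 1 y -> enorm y ^+ 2 * K y <= Kbound * (enorm y)^-1.
Proof.
move=> y1; have [->|y0] := eqVneq y 0.
  by rewrite enorm0 expr0n/= mul0r invr0 mulr0.
have E0 : 0 < enorm y by rewrite enorm_gt0.
have E2 : enorm y <= 2 * pi by have := enorm_box y1; rewrite mul1r.
rewrite KE /Kbound mulrCA -mulrA ler_wpM2l ?Kconst_ge0// mulrDr mulrDl mul1r.
have -> : enorm y ^+ 2 * enorm y ^- 3 = (enorm y)^-1.
  by field; rewrite gt_eqF.
rewrite lerD2l ler_pdivlMr// mulrAC -exprSr mulrC.
apply: ler_pM; [exact: lattice_sum_ge0|by rewrite exprn_ge0// ltW|exact: lattice_sum_le|].
by apply: lerXn2r => //; rewrite ?nnegrE ?mulr_ge0 ?pi_ge0 ?ltW.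
Qed.

End kernel.

(** * The operator as an absolutely convergent integral *)

Section symmetrised_operator.
Context {R : realType}.
Notation plane := (measurableTypeR R * measurableTypeR R)%type.
Notation leb2 := (@leb2 R).
Implicit Types (x y v : R * R) (f phi : R * R -> R).

Lemma within_measurable n f : {within box n, continuous f} ->
  measurable_fun (box n : set plane) f.
Proof.
move=> cf; apply: (eq_measurable_fun (f \o clamp n)).
  by move=> x /set_mem xn /=; rewrite clamp_id.
apply: measurable_funTS; apply: continuous_measurable_plane.
exact: continuous_comp_clamp.
Qed.

Lemma within_shift n f (X : set (R * R)) y : {within box n, continuous f} ->
  (forall z, X z -> box n (z + y)) ->
  {within X, continuous (fun z => f (z + y))}.
Proof.
move=> cf Xn; apply: (@within_congr _ _ (fun z => (f \o clamp n) (z + y))).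
  by move=> z /Xn zn /=; rewrite clamp_id.
apply: continuous_subspaceT => z.
have cl : (fun z => z + y) @ z --> z + y.
  by apply: cvgD; [exact: cvg_id|exact: cvg_cst].
by move=> P /(continuous_comp_clamp cf) HP; exact: (cl _ HP).
Qed.

Lemma within_measurable_shift m n f x : {within box n, continuous f} ->
  (forall y, box m y -> box n (x + y)) ->
  measurable_fun (box m : set plane) (fun y : plane => f (x + y)).
Proof.
move=> cf xn; apply: (measurable_comp (@measurable_box R n)) (within_measurable cf) _.
  by move=> _ [y ym <-]; exact: xn.
exact: measurable_funTS (measurable_plane_add x).
Qed.

Lemma sym_Lambda_integrand f x y :
  sym (Lambda_integrand f x) y = sdiff f x y / 2 * K y.
Proof. by rewrite /sym /Lambda_integrand KN /sdiff; field. Qed.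

(** The mixed derivative is taken in the order that the paths in [sdiff_le] meet. *)
Definition C2bound n f (M : R) :=
  [/\ forall u, box n u -> `|rderive (box n) e1 (rderive (box n) e1 f) u| <= M,
      forall u, box n u -> `|rderive (box n) e1 (rderive (box n) e2 f) u| <= M &
      forall u, box n u -> `|rderive (box n) e2 (rderive (box n) e2 f) u| <= M].

Lemma C2bound_ex n f : Ck 2 (box n) f -> exists2 M, 0 <= M & C2bound n f M.
Proof.
move=> Cf; have Cf1 := Ck_rderive Cf coord_dir1; have Cf2 := Ck_rderive Cf coord_dir2.
have [M1 M10 H1] := Ck_bound (Ck_rderive Cf1 coord_dir1).
have [M2 M20 H2] := Ck_bound (Ck_rderive Cf2 coord_dir1).
have [M3 M30 H3] := Ck_bound (Ck_rderive Cf2 coord_dir2).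
exists (M1 + M2 + M3); first by rewrite !addr_ge0.
split=> u Xu.
- by apply: le_trans (H1 u Xu) _; lra.
- by apply: le_trans (H2 u Xu) _; lra.
- by apply: le_trans (H3 u Xu) _; lra.
Qed.

Lemma sdiff_K_le n f M x y : Ck 2 (box n.+1) f -> C2bound n.+1 f M ->
  box n x -> box 1 y ->
  `|sdiff f x y / 2 * K y| <= 3 / 2 * M * Kbound * (enorm y)^-1.
Proof.
move=> Cf [M1 M2 M3] xn y1.
have xy : box n.+1 (x + y) by rewrite -addn1; exact: boxD.
have xy' : box n.+1 (x - y) by rewrite -addn1; apply: boxD => //; exact/boxN.
have M0 : 0 <= M by exact: le_trans (M1 _ xy).
have Sd := sdiff_le Cf M1 M2 M3 xy xy'.
rewrite normrM (ger0_norm (K_ge0 y)) normrM (@ger0_norm _ 2^-1) ?invr_ge0//.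
apply: (@le_trans _ _ (3 / 2 * M * (enorm y ^+ 2 * K y))).
  rewrite [leRHS]mulrA ler_wpM2r ?K_ge0//.
  rewrite (_ : 3 / 2 * M * enorm y ^+ 2 = 3 * M * enorm y ^+ 2 / 2); last by field.
  by rewrite ler_wpM2r ?invr_ge0.
by rewrite -[leRHS]mulrA ler_wpM2l ?mulr_ge0// K_mul_sqr_le.
Qed.

(** The even part of the integrand is a second difference times the even kernel, of
the order of [|y|^2 |y|^-3]; the truncated integrands are bounded. *)
Lemma Lambda_pv n f x : Ck 2 (box n.+1) f -> box n x ->
  [/\ leb2.-integrable (box 1) (EFin \o (fun y : plane => sdiff f x y / 2 * K y)),
    pv_exists (box 1) (Lambda_integrand f x) &
    Lambda f x = \int[leb2]_(y in box 1) (sdiff f x y / 2 * K y)].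
Proof.
move=> Cf xn.
have [M M0 HM] := C2bound_ex Cf; have [B B0 HB] := Ck_bound Cf.
have xy y : box 1 y -> box n.+1 (x + y) by move=> y1; rewrite -addn1; exact: boxD.
have Xx : box n.+1 x by exact: box_le xn.
have mF : measurable_fun (box 1 : set plane) (Lambda_integrand f x).
  apply: measurable_funM; last exact: measurable_funTS (@measurable_K R).
  apply: measurable_funB => //.
  exact: (within_measurable_shift (Ck_continuous Cf)).
have mB := @measurable_box R 1.
have iF e : 0 < e ->
    leb2.-integrable (box 1 `&` [set y | e < enorm y]) (EFin \o Lambda_integrand f x).
  move=> e0; have mD := @truncated_set_measurable R e.
  apply: (@integrable_dom _ _ _ _ _ mD _
    (fun y : plane => (2 * B / e ^+ 2 * Kbound) * (enorm y)^-1)).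
  - exact: measurable_funS mF.
  - apply: integrable_EFinZ => //.
    by apply: integrableS (@integrable_inv_enorm R).
  move=> y [y1 ey]; rewrite normrM (ger0_norm (K_ge0 y)).
  have fB : `|f x - f (x + y)| <= 2 * B.
    rewrite (le_trans (ler_normB _ _))// mulr_natl mulr2n lerD ?HB//; exact: xy.
  have KE2 := K_mul_sqr_le y1.
  have ee : e ^+ 2 <= enorm y ^+ 2.
    by apply: lerXn2r; rewrite ?nnegrE ?enorm_ge0 ?ltW.
  have e20 : 0 < e ^+ 2 by rewrite exprn_gt0.
  apply: (@le_trans _ _ (2 * B * (enorm y ^+ 2 * K y / e ^+ 2))).
    rewrite ler_pM ?K_ge0// ler_pdivlMr// mulrC ler_wpM2r ?K_ge0//.
  have -> : 2 * B / e ^+ 2 * Kbound * (enorm y)^-1 =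
      2 * B * (Kbound * (enorm y)^-1 / e ^+ 2) by ring.
  by apply: ler_wpM2l; [exact: mulr_ge0|apply: ler_wpM2r => //; rewrite invr_ge0 ltW].
have FM y : box 1 y -> `|sym (Lambda_integrand f x) y| <=
    (3 / 2 * M * Kbound) * (enorm y)^-1.
  by move=> y1; rewrite sym_Lambda_integrand; exact: sdiff_K_le Cf HM xn y1.
have [si pe pE] := pv_symmetrise mF iF FM.
rewrite (_ : (fun y : plane => _) = sym (Lambda_integrand f x)); last first.
  by apply/funext => y; rewrite sym_Lambda_integrand.
by split.
Qed.

Definition inv_enorm_int : R := \int[leb2]_(y in box 1) (enorm y)^-1.

Lemma inv_enorm_int_ge0 : 0 <= inv_enorm_int.
Proof. by apply: Rintegral_ge0 => y _; rewrite invr_ge0 enorm_ge0. Qed.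

Definition Lconst : R := 3 / 2 * Kbound * inv_enorm_int.

Lemma Lconst_ge0 : 0 <= Lconst.
Proof.
apply: mulr_ge0; last exact: inv_enorm_int_ge0.
by apply: mulr_ge0; [rewrite divr_ge0|exact: Kbound_ge0].
Qed.

Lemma Lambda_le n f M x : Ck 2 (box n.+1) f -> C2bound n.+1 f M -> box n x ->
  `|Lambda f x| <= Lconst * M.
Proof.
move=> Cf HM xn; have [si _ ->] := Lambda_pv Cf xn.
have mB := @measurable_box R 1.
rewrite (le_trans (le_normr_Rintegral mB si))//.
have -> : Lconst * M = \int[leb2]_(y in box 1) ((3 / 2 * M * Kbound) * (enorm y)^-1).
  rewrite RintegralZl//; last exact: integrable_inv_enorm.
  by rewrite /Lconst /inv_enorm_int; ring.
apply: le_Rintegral => //.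
- exact: integrable_norm.
- by apply: integrable_EFinZ => //; exact: integrable_inv_enorm.
- by move=> y y1; exact: sdiff_K_le Cf HM xn y1.
Qed.

(** The integration variable ranges over the fundamental box only. *)
Lemma eq_Lambda n f g x : (forall z, box n.+1 z -> f z = g z) -> box n x ->
  Lambda f x = Lambda g x.
Proof.
move=> fg xn.
have E y : box 1 y -> Lambda_integrand f x y = Lambda_integrand g x y.
  move=> y1; rewrite /Lambda_integrand (fg x (box_le (leqnSn n) xn)) fg//.
  by rewrite -addn1; exact: boxD.
rewrite /Lambda /pv_int.
suff -> : truncated_int (box 1) (Lambda_integrand f x) =
    truncated_int (box 1) (Lambda_integrand g x) by [].
by apply/funext => e; apply: eq_Rintegral => y /set_mem[y1 _]; exact: E.
Qed.

End symmetrised_operator.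

(** * Differentiation of the operator *)

Section differentiation.
Context {R : realType}.
Notation plane := (measurableTypeR R * measurableTypeR R)%type.
Notation leb2 := (@leb2 R).
Implicit Types (x y v : R * R) (f phi : R * R -> R).

(** Sequences suffice to test a limit, which makes dominated convergence available. *)
Lemma cvg_within_seq (P : set R) (f : R -> R) (l : R) :
  (forall u : R^nat, (forall n, u n != 0) -> (forall n, P (u n)) ->
     u n @[n --> \oo] --> 0 -> f (u n) @[n --> \oo] --> l) ->
  f h @[h --> within P 0^'] --> l.
Proof.
move=> H; apply: contrapT => nc.
have [e e0 He] : exists2 e : R, 0 < e & forall d : R, 0 < d ->
    exists h, [/\ `|h| < d, h != 0, P h & e <= `|l - f h|].
  apply: contrapT => ne; apply: nc; apply/cvgrPdist_lt => e e0.
  apply: contrapT => nd; apply: ne; exists e => // d d0.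
  apply: contrapT => nh; apply: nd; apply/nbhs_ballP; exists d => //= h.
  rewrite /ball/= sub0r normrN => hd h0 Ph; rewrite ltNge; apply/negP => eh.
  by apply: nh; exists h.
have [u Hu] := choice (fun n : nat => He n.+1%:R^-1 (ltac:(by rewrite invr_gt0))).
have /cvgrPdist_lt/(_ _ e0) : f (u n) @[n --> \oo] --> l.
  apply: H => [n|n|]; [by have [] := Hu n|by have [] := Hu n|].
  apply/cvgrPdist_lt => d d0.
  apply: filterS (near_infty_natSinv_lt (PosNum d0)) => n /= nd.
  by rewrite sub0r normrN; have [h _ _ _] := Hu n; exact: lt_trans nd.
move=> [N _ /(_ N (leqnn _))] /=; have [_ _ _] := Hu N.
by rewrite leNgt => /negP.
Qed.

Lemma sdiff_rderive f v y z : Ck 1 (box 2) f -> coord_dir v ->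
  box 1 y -> box 1 z ->
  rderivable (box 1) v (fun z => sdiff f z y) z /\
  rderive (box 1) v (fun z => sdiff f z y) z = sdiff (rderive (box 2) v f) z y.
Proof.
move=> Cf dv y1 z1.
have cX := @box_line_convex R 1 v; have lz := box_has_line dv z1.
have sub (w : R * R) : box 1 w -> forall u, box 1 u -> box 2 (u + w).
  by move=> w1 u u1; exact: (@boxD _ 1 1).
have y1' : box 1 (- y) by exact/boxN.
have [d1 E1] := rderive_shift cX z1 lz (sub y y1) (Ck_rderivable Cf dv (sub y y1 z z1)).
have [d2 E2] := rderive_shift cX z1 lz (sub _ y1') (Ck_rderivable Cf dv (sub _ y1' z z1)).
have s12 : box 1 `<=` (box 2 : set (R * R)) by move=> u; exact: box_le.
have [d0 E0] := rderive_sub cX z1 lz s12 (Ck_rderivable Cf dv (s12 z z1)).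
have [d00 E00] := rderiveD cX z1 lz d0 d0.
have [d3 E3] := rderiveB cX z1 lz d00 d1.
have [d4 E4] := rderiveB cX z1 lz d3 d2.
have E : (fun z => sdiff f z y) = (fun z => f z + f z - f (z + y) - f (z - y)).
  by apply/funext => u; rewrite /sdiff; ring.
by rewrite E; split=> //; rewrite E4 E3 E00 E0 E1 E2 /sdiff; ring.
Qed.

(** Under the integral the difference quotient of [sdiff f] is, by the mean value
theorem, a second difference of the derivative of [f], dominated as in [Lambda_pv]. *)
Lemma Lambda_rderive f v x : Ck 3 (box 2) f -> coord_dir v -> box 1 x ->
  rderivable (box 1) v (Lambda f) x /\
  rderive (box 1) v (Lambda f) x = Lambda (rderive (box 2) v f) x.
Proof.
move=> Cf dv x1.
have Cf2 := Ck_pred Cf; have Cf1 := Ck_pred Cf2; have Cv := Ck_rderive Cf dv.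
have [M M0 HM] := C2bound_ex Cv.
have [iv _ vE] := Lambda_pv Cv x1.
apply: (rderiveP (@box_line_convex R 1 v) x1 (box_has_line dv x1)).
rewrite vE; apply: cvg_within_seq => u u0 uP uc.
have mB := @measurable_box R 1.
(* The difference quotient under the integral sign. *)
pose F n (y : plane) := (u n)^-1 * (sdiff f (x + u n *: v) y - sdiff f x y) / 2 * K y.
have Fi n := (Lambda_pv Cf2 (uP n)).
have [ix _ xE] := Lambda_pv Cf2 x1.
have FE n : diff_quot v (Lambda f) x (u n) = \int[leb2]_(y in box 1) F n y.
  have [iu _ uE] := Fi n.
  rewrite /diff_quot uE xE -RintegralB// -RintegralZl//; last exact: integrable_EFinB.
  by apply: eq_Rintegral => y _; rewrite /F; ring.
rewrite (_ : (fun n : nat => (u n)^-1 * _) = (fun n => \int[leb2]_(y in box 1) F n y));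
  last by apply/funext => n; rewrite -FE.
apply: (@dominated_cvg_Rintegral _ _ _ _ _ mB _ _
  (fun y : plane => (3 / 2 * M * Kbound) * (enorm y)^-1)).
- move=> n; have [iu _ _] := Fi n.
  have -> : F n = (fun y : plane => (u n)^-1 *
      (sdiff f (x + u n *: v) y / 2 * K y - sdiff f x y / 2 * K y)).
    by apply/funext => y; rewrite /F; ring.
  apply: measurable_funM => //; apply: measurable_funB.
    by apply/measurable_EFinP; exact: measurable_int iu.
  by apply/measurable_EFinP; exact: measurable_int ix.
- by apply/measurable_EFinP; exact: measurable_int iv.
- move=> y y1; have [dy Ey] := sdiff_rderive Cf1 dv y1 x1.
  move/rderivable_cvg : dy; rewrite Ey => dy.
  apply: cvgM; last exact: cvg_cst.
  apply: cvgM; last exact: cvg_cst.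
  have du : u n @[n --> \oo] --> within [set h | box 1 (x + h *: v)] 0^'.
    move=> A /uc [N _ HN]; exists N => // n Nn; exact: HN.
  exact: (cvg_comp _ _ du dy).
- by apply: integrable_EFinZ => //; exact: integrable_inv_enorm.
- move=> n y y1.
  have cS : {within box 1, continuous (fun z => sdiff f z y)}.
    have cf := Ck_continuous Cf.
    have sub (w : R * R) : box 1 w -> forall u, box 1 u -> box 2 (u + w).
      by move=> w1 z z1; exact: (@boxD _ 1 1).
    have y1' : box 1 (- y) by exact/boxN.
    have c0 : {within box 1, continuous f}.
      by apply: within_subW cf => z; exact: box_le.
    have cp := within_shift cf (sub y y1); have cm := within_shift cf (sub _ y1').
    move=> z; apply: cvgB; last exact: cm.
    apply: cvgB; last exact: cp.
    by apply: cvgM; [exact: cvg_cst|exact: c0].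
  have [c [_ c1 cE]] := mvt_line0 (@box_line_convex R 1 v) cS
    (fun z z1 => (sdiff_rderive Cf1 dv y1 z1).1) x1 (uP n).
  have -> : F n y = sdiff (rderive (box 2) v f) (x + c *: v) y / 2 * K y.
    rewrite /F cE (sdiff_rderive Cf1 dv y1 c1).2; field; exact: u0.
  exact: sdiff_K_le Cv HM c1 y1.
Qed.

End differentiation.

(** * Essential suprema and mixed partial derivatives *)

Section essential_supremum.
Context {R : realType}.
Notation mu := (@lebesgue_measure R).
Notation plane := (measurableTypeR R * measurableTypeR R)%type.
Notation leb2 := (@leb2 R).
Implicit Types (x y v : R * R) (f : R * R -> R).

Let subinterval (N t d : R) : 0 < N -> 0 < d -> `|t| <= N ->
  exists a b, [/\ a < b, `[a, b]%classic `<=` [set s | `|s| <= N] &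
    `[a, b]%classic `<=` [set s | `|t - s| < d]].
Proof.
move=> N0 d0 /(interval_room N0)[h h0 Hh].
pose s := Num.min 1 (d / 2 / `|h|).
have s0 : 0 < s by rewrite lt_min ltr01/= !divr_gt0.
have s1 : s <= 1 by rewrite ge_min lexx.
have sh : s * `|h| < d.
  have : s <= d / 2 / `|h| by rewrite ge_min lexx orbT.
  by rewrite ler_pdivlMr// => /le_lt_trans; apply; lra.
have tN : `|t| <= N by have := Hh 0; rewrite mul0r addr0 lexx ler01 => /(_ isT).
have tsN : `|t + s * h| <= N by apply: Hh; rewrite (ltW s0).
move: tN tsN; rewrite !ler_norml => /andP[? ?] /andP[? ?].
have [hp|hn] := ltP 0 h.
  rewrite gtr0_norm// in sh h0; have sh0 : 0 < s * h by rewrite mulr_gt0.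
  exists t, (t + s * h); split; first by lra.
    by move=> r /=; rewrite in_itv/= ler_norml => /andP[? ?]; apply/andP; split; lra.
  by move=> r /=; rewrite in_itv/= ltr_norml => /andP[? ?]; apply/andP; split; lra.
rewrite ler0_norm// in sh h0; have sh0 : s * h < 0 by nra.
exists (t + s * h), t; split; first by lra.
  by move=> r /=; rewrite in_itv/= ler_norml => /andP[? ?]; apply/andP; split; lra.
by move=> r /=; rewrite in_itv/= ltr_norml => /andP[? ?]; apply/andP; split; lra.
Qed.

(** Near every point of the box, corners and sides included, there is a rectangle of
positive measure inside the box. *)
Lemma box_ball_pos n x (d : R) : 0 < d -> box n.+1 x ->
  exists V : set plane, [/\ measurable V, V `<=` box n.+1, V `<=` ball x d &
    (0 < leb2 V)%E].
Proof.
move=> d0 /boxP[x1 x2].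
have N0 : 0 < n.+1%:R * pi :> R by rewrite mulr_gt0 ?pi_gt0.
have [a [b [ab abN abd]]] := subinterval N0 d0 x1.
have [a' [b' [ab' abN' abd']]] := subinterval N0 d0 x2.
exists (`[a, b]%classic `*` `[a', b']%classic); split.
- by apply: measurableX; exact: measurable_itv.
- by move=> y [y1 y2]; apply/boxP; split; [exact: abN|exact: abN'].
- by move=> y [y1 y2]; split; [exact: abd|exact: abd'].
- rewrite -[X in (_ < X)%E]/((mu \x mu)%E _) product_measure1E; [|exact: measurable_itv..].
  rewrite -[X in (_ < X)%E]/(mu `[a, b]%classic * mu `[a', b']%classic)%E.
  rewrite !lebesgue_measure_itv/= !lte_fin ab ab' -!EFinD -EFinM lte_fin.
  by rewrite mulr_gt0// subr_gt0.
Qed.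

(** A value larger than the essential supremum would persist, by continuity, on a
set of positive measure. *)
Lemma le_Linf n f x : {within box n.+1, continuous f} -> box n.+1 x ->
  (`|f x|%:E <= Lpnorm +oo (box n.+1) f)%E.
Proof.
move=> cf Xx; rewrite /Lpnorm unlock /Lnorm.
have T0 : (0 < leb2 [set: plane])%E.
  have [V [mV _ _ V0]] := box_ball_pos ltr01 Xx.
  by apply: lt_le_trans V0 _; apply: le_measure; rewrite ?inE.
rewrite T0 leNgt; apply/negP => lt_sup.
have aeS := ess_sup_ge leb2 (abse \o (EFin \o f \_ (box n.+1))).
set S := ess_sup _ _ in lt_sup aeS.
have [s Ss sf] : exists2 s : R, (S <= s%:E)%E & s < `|f x|.
  move: lt_sup; case: S {aeS} => [s|//|_].
    by rewrite lte_fin => sf; exists s.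
  by exists (`|f x| - 1)%R; [exact: leNye|rewrite ltrBlDr ltrDl].
have sf0 : 0 < `|f x| - s by rewrite subr_gt0.
have /subspace_continuousP/(_ _ Xx)/cvgrPdist_lt/(_ _ sf0) := cf.
move=> /nbhs_ballP[d /= d0 Hd].
have [V [mV VX Vd V0]] := box_ball_pos d0 Xx.
case: aeS => N [mN N0 subN].
have VN : V `<=` N.
  move=> z Vz; apply: subN => /=; rewrite patchT ?inE; last exact: VX.
  move=> fzS; have := le_trans fzS Ss; rewrite lee_fin leNgt => /negP; apply.
  have := Hd z (Vd z Vz) (VX z Vz); have := lerB_dist (f x) (f z).
  by rewrite /from_subspace/=; lra.
have : (leb2 V <= leb2 N)%E by apply: le_measure; rewrite ?inE.
by rewrite N0 leNgt V0.
Qed.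

End essential_supremum.

Section mixed_partials.
Context {R : realType}.
Implicit Types (x y v : R * R) (f g : R * R -> R) (X : set (R * R)).

Lemma eq_iter_rderive X v m f g : (forall x, X x -> f x = g x) ->
  forall x, X x -> iter m (rderive X v) f x = iter m (rderive X v) g x.
Proof.
move=> fg; elim: m => [//|m IH] x Xx /=; exact: eq_rderive.
Qed.

Lemma rderive_iter_comm n m f x : Ck m.+1 (box n.+1) f -> box n.+1 x ->
  rderive (box n.+1) e2 (iter m (rderive (box n.+1) e1) f) x =
  iter m (rderive (box n.+1) e1) (rderive (box n.+1) e2 f) x.
Proof.
elim: m f x => [//|m IH] f x Cf Xx.
rewrite !iterSr (IH _ x (Ck_rderive Cf coord_dir1) Xx).
apply: eq_iter_rderive Xx => z Xz; apply/esym; apply: rderive_comm Xz.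
have : Ck (m + 2) (box n.+1) f by rewrite addn2.
by elim: m {IH Cf} => [//|m IH]; rewrite addSn => /Ck_pred.
Qed.

Lemma Ck_partials k n (a : nat * nat) f : Ck (a.1 + a.2 + k) (box n) f ->
  Ck k (box n) (partials (box n) a f).
Proof.
move=> Cf; apply: Ck_iter coord_dir1; apply: Ck_iter coord_dir2.
by rewrite addnCA addnA.
Qed.

(** Reordering by [rderive_comm] brings each second derivative of a partial
derivative to the normal form in which it occurs in the Sobolev norm. *)
Lemma C2bound_partials n (a : nat * nat) f (w : R) :
  Ck (a.1 + a.2).+2 (box n.+1) f ->
  (Wknorm (a.1 + a.2).+2 (box n.+1) f <= w%:E)%E ->
  C2bound n.+1 (partials (box n.+1) a f) w.
Proof.
case: a => i j /= Cf Ww; set X := box n.+1.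
have W (p q : nat) u : (p + q = (i + j).+2)%N -> X u ->
    `|partials X (p, q) f u| <= w.
  move=> pq Xu; rewrite -lee_fin; apply: le_trans Ww.
  apply: le_trans (le_Linf _ Xu) _.
    by apply: (@Ck_continuous _ 0); apply: Ck_partials; rewrite /= addn0 pq.
  have p3 : (p < (i + j).+3)%N by rewrite -pq ltnS leq_addr.
  have q3 : (q < (i + j).+3)%N by rewrite -pq ltnS leq_addl.
  have := @le_bigmax_cond _ _ _ (0%E : \bar R) (Ordinal p3, Ordinal q3)
    (fun a : 'I_(i + j).+3 * 'I_(i + j).+3 => (a.1 + a.2 <= (i + j).+2)%N)
    (fun a => Lpnorm +oo X (partials X (nat_of_ord a.1, nat_of_ord a.2) f)).
  by rewrite /= pq leqnn => /(_ isT).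
pose g := iter j (rderive X e2) f.
have Cg : Ck i.+2 X g.
  by apply: Ck_iter coord_dir2; rewrite addnS addnS addnC.
have Cg1 : Ck i.+1 X (rderive X e2 g) by exact: Ck_rderive coord_dir2.
have c2 u : X u -> rderive X e2 (partials X (i, j) f) u = partials X (i, j.+1) f u.
  by move=> Xu; exact: (rderive_iter_comm (Ck_pred Cg) Xu).
split=> u Xu.
- by rewrite -[X in `|X|]/(partials X (i.+2, j) f u) W.
- rewrite (eq_rderive _ Xu c2) -[X in `|X|]/(partials X (i.+1, j.+1) f u) W//.
  by rewrite addSn addnS.
- rewrite (eq_rderive _ Xu c2) (rderive_iter_comm Cg1 Xu).
  by rewrite -[X in `|X|]/(partials X (i, j.+2) f u) W// !addnS.
Qed.

(** The function [g] is only known to agree with [Lambda f] on the box, as is the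
case for the derivatives that arise in the induction. *)
Lemma iter_Lambda m v f g : Ck (m + 2) (box 2) f -> coord_dir v ->
  (forall x, box 1 x -> g x = Lambda f x) ->
  (forall j, (j < m)%N -> forall x, box 1 x ->
     rderivable (box 1) v (iter j (rderive (box 1) v) g) x) /\
  (forall x, box 1 x -> iter m (rderive (box 1) v) g x =
     Lambda (iter m (rderive (box 2) v) f) x).
Proof.
move=> + dv; elim: m f g => [//|m IH] f g Cf gE.
have Cf3 : Ck 3 (box 2) f.
  have : Ck (m + 3) (box 2) f by rewrite addnS -addSn.
  by elim: m {IH Cf} => [//|m IH]; rewrite addSn => /Ck_pred.
have gE' x : box 1 x -> rderive (box 1) v g x = Lambda (rderive (box 2) v f) x.
  by move=> x1; rewrite (eq_rderive _ x1 gE) (Lambda_rderive Cf3 dv x1).2.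
have [dj E] := IH _ _ (Ck_rderive Cf dv) gE'.
split=> [[_ x x1|j jm x x1]|x x1]; last 2 first.
- by rewrite iterSr; exact: dj.
- by rewrite !iterSr E.
apply: (eq_rderivable x1 (fun z z1 => esym (gE z z1))).
exact: (Lambda_rderive Cf3 dv x1).1.
Qed.

Lemma Lambda_partials (a : nat * nat) f : Ck (a.1 + a.2).+2 (box 2) f ->
  has_partials (box 1) a (Lambda f) /\
  forall x, box 1 x -> partials (box 1) a (Lambda f) x = Lambda (partials (box 2) a f) x.
Proof.
case: a => i j /= Cf.
have Cj : Ck (j + 2) (box 2) f.
  have : Ck (i + (j + 2)) (box 2) f by rewrite addnA addn2.
  by elim: i {Cf} => [//|i IH]; rewrite addSn => /Ck_pred.
have [d2 E2] := iter_Lambda Cj coord_dir2 (fun x _ => erefl (Lambda f x)).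
have Ci : Ck (i + 2) (box 2) (iter j (rderive (box 2) e2) f).
  by apply: Ck_iter coord_dir2; rewrite addnA (addnC j) addn2.
have [d1 E1] := iter_Lambda Ci coord_dir1 E2.
by split.
Qed.

Lemma Lambda_partials_le (a : nat * nat) f x : Ck (a.1 + a.2).+2 (box 2) f ->
  box 1 x ->
  (`|partials (box 1) a (Lambda f) x|%:E <=
     (Lconst + 1 : R)%:E * Wknorm (a.1 + a.2).+2 (box 2) f)%E.
Proof.
move=> Cf x1; rewrite (Lambda_partials Cf).2//.
have C0 : 0 < Lconst + 1 :> R by have := @Lconst_ge0 R; lra.
have W0 : (0 <= Wknorm (a.1 + a.2).+2 (box 2) f)%E by rewrite bigmax_ge_id.
have CP : Ck 2 (box 2) (partials (box 2) a f).
  by apply: Ck_partials; rewrite addn2.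
move: (@C2bound_partials 1 a f) W0; case: (Wknorm _ _ _) => [w|_ _|//].
  move=> /(_ w Cf (lexx _)) HM; rewrite lee_fin => w0.
  rewrite -EFinM lee_fin (le_trans (Lambda_le CP HM x1))// ler_wpM2r//; lra.
by rewrite gt0_muley ?lte_fin// leey.
Qed.

End mixed_partials.

(** * Integration on lines and products *)

Section interval_integrals.
Context {R : realType}.
Notation mu := (@lebesgue_measure R).

Lemma Rintegral_is_derive (u du : R -> R) (a b : R) : a < b ->
  continuous u -> continuous du ->
  (forall s, a < s < b -> is_derive s 1 u (du s)) ->
  \int[mu]_(s in `[a, b]) du s = u b - u a.
Proof.
move=> ab cu cdu Hd; rewrite /Rintegral (@continuous_FTC2 _ du u)//.
- exact: continuous_subspaceT.
- split.
  + by move=> s; rewrite in_itv/= => /Hd[].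
  + by apply: cvg_at_right_filter; exact: cu.
  + by apply: cvg_at_left_filter; exact: cu.
- by move=> s; rewrite in_itv/= => /Hd[_ <-]; rewrite derive1E.
Qed.

(** A single point is negligible. *)
Lemma Rintegral_punctured (f h : R -> R) :
  measurable_fun (`[- pi, pi]%classic : set (measurableTypeR R)) f ->
  measurable_fun (`[- pi, pi]%classic : set (measurableTypeR R)) h ->
  (forall s, s != 0 -> s \in `[- pi, pi] -> f s = h s) ->
  \int[mu]_(s in `[- pi, pi]) f s = \int[mu]_(s in `[- pi, pi]) h s.
Proof.
move=> mf mh fh; rewrite /Rintegral; congr fine.
have mp := @measurable_punctured R.
have sub : punctured `<=` (`[- pi, pi]%classic : set R) by rewrite /punctured => s [].  
have mI : measurable (`[- pi, pi]%classic : set (measurableTypeR R)) by exact: measurable_itv.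
rewrite -(@integral_setD1 _ _ 0)//; last first.
  by apply: measurable_funS mI sub _; exact/measurable_EFinP.
rewrite -[RHS](@integral_setD1 _ _ 0)//; last first.
  by apply: measurable_funS mI sub _; exact/measurable_EFinP.
by apply: eq_integral => s /set_mem[sI /eqP s0]; rewrite fh.
Qed.

End interval_integrals.

Section plane_measure_sigma_finite.
Context {R : realType}.
Notation plane := (measurableTypeR R * measurableTypeR R)%type.

(** A name to which the sigma-finite structure required by the Fubini theorems is
attached. *)
Definition sleb2 : set plane -> \bar R := @leb2 R.

HB.instance Definition _ := Measure.copy sleb2 (@leb2 R).

Lemma sleb2_sigma_finite : sigma_finite [set: plane] sleb2.
Proof.
have /sigma_finiteP[F [TF ndF Foo]] := sigma_finiteT (@lebesgue_measure R).
exists (fun n => (F n `*` F n : set plane)).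
  apply/seteqP; split=> // -[x y] _.
  have [n _ Fx] : (\bigcup_i F i) x by rewrite -TF.
  have [k _ Fy] : (\bigcup_i F i) y by rewrite -TF.
  exists (maxn n k) => //; split.
  - by move: x Fx; exact/subsetPset/ndF/leq_maxl.
  - by move: y Fy; exact/subsetPset/ndF/leq_maxr.
move=> k; have [mF Fk] := Foo k; split; first exact: measurableX.
by rewrite /sleb2 /leb2/= product_measure1E// lte_mul_pinfty// ge0_fin_numE.
Qed.

HB.instance Definition _ :=
  Measure_isSigmaFinite.Build _ _ _ sleb2 sleb2_sigma_finite.

End plane_measure_sigma_finite.

Section product_integrability.
Context {d} {T : measurableType d} {R : realType}.
Notation plane := (measurableTypeR R * measurableTypeR R)%type.
Notation mu := (@lebesgue_measure R).
Variable m : {sigma_finite_measure set T -> \bar R}.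

(** By Tonelli, the singularity [1 / |y|] being integrable on the box. *)
Lemma integrable_singular (A : set T) (F : T * plane -> R) (C : R) :
  measurable A -> (m A < +oo)%E -> 0 <= C ->
  measurable_fun (A `*` box 1) F ->
  (forall a y, A a -> box 1 y -> `|F (a, y)| <= C * (enorm y)^-1) ->
  (m \x (@sleb2 R))%E.-integrable (A `*` box 1) (EFin \o F).
Proof.
move=> mA Afin C0 mF FC.
have mB := @measurable_box R 1.
have mAB : measurable (A `*` (box 1 : set plane)) by exact: measurableX.
have mi : measurable_fun setT (fun z : T * plane => C * (enorm z.2)^-1).
  by apply: measurable_funM => //; exact: (measurableT_comp (@measurable_inv_enorm R) measurable_snd).
apply: (@integrable_dom _ _ _ (m \x (@sleb2 R))%E _ mAB F (fun z : T * plane => C * (enorm z.2)^-1) mF) => //; last first.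
  by move=> [a y] [/= Aa y1]; exact: FC.
apply/integrableP; split; first by apply/measurable_EFinP; exact: measurable_funTS.
have [tE _] := @tonelli_setX _ _ _ _ R m (@sleb2 R) A (box 1) mA mB
  (fun z : T * plane => `|(C * (enorm z.2)^-1)%:E|%E)
  (measurable_funTS (measurableT_comp (@abse_measurable R setT) ((measurable_EFinP _ _).2 mi)))
  (fun z _ => abse_ge0 _).
rewrite [X in (X < _)%E]tE.
rewrite (eq_integral (fun=> (C * @inv_enorm_int R)%:E)); last first.
  move=> a _ /=.
  rewrite (eq_integral (fun y : plane => (C%:E * ((enorm y)^-1)%:E)%E)); last first.
    by move=> y _; rewrite /= ger0_norm ?mulr_ge0 ?invr_ge0 ?enorm_ge0.
  rewrite ge0_integralZl_EFin//.
  - rewrite EFinM; congr (_ * _)%E; rewrite /inv_enorm_int /Rintegral fineK//.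
    exact: integrable_fin_num (@integrable_inv_enorm R).
  - by move=> y _; rewrite lee_fin invr_ge0 enorm_ge0.
  - by apply/measurable_EFinP; apply: measurable_funTS; exact: measurable_inv_enorm.
rewrite integral_cst//; apply: lte_mul_pinfty => //.
by rewrite lee_fin mulr_ge0 ?inv_enorm_int_ge0.
Qed.

End product_integrability.

Section bounded_integrability.
Context {d} {T : measurableType d} {R : realType}.
Variable m : {measure set T -> \bar R}.

Lemma integrable_bounded (A : set T) (F : T -> R) (C : R) :
  measurable A -> (m A < +oo)%E -> measurable_fun A F ->
  (forall a, A a -> `|F a| <= C) -> m.-integrable A (EFin \o F).
Proof.
move=> mA Afin mF FC; apply: measurable_bounded_integrable => //.
exists C; split=> [|y Cy a Aa /=]; first exact: num_real.
exact: le_trans (FC a Aa) (ltW Cy).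
Qed.

End bounded_integrability.

Section plane_maps.
Context {d} {T : measurableType d} {R : realType}.
Notation plane := (measurableTypeR R * measurableTypeR R)%type.
Implicit Types (X Y : T -> plane) (g : R * R -> R).

Lemma measurable_pairR (f h : T -> R) : measurable_fun setT f ->
  measurable_fun setT h -> measurable_fun setT (fun a => (f a, h a) : plane).
Proof. by move=> mf mh; apply/measurable_fun_pairP. Qed.

Lemma measurable_coord1 X : measurable_fun setT X ->
  measurable_fun setT (fun a => (X a).1 : R).
Proof. by move=> /measurable_fun_pairP[]. Qed.

Lemma measurable_addp X Y : measurable_fun setT X -> measurable_fun setT Y ->
  measurable_fun setT (fun a => X a + Y a : plane).
Proof.
move=> /measurable_fun_pairP[X1 X2] /measurable_fun_pairP[Y1 Y2].
by apply/measurable_fun_pairP; split; [exact: (measurable_funD X1 Y1)|exact: (measurable_funD X2 Y2)].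
Qed.

Lemma measurable_subp X Y : measurable_fun setT X -> measurable_fun setT Y ->
  measurable_fun setT (fun a => X a - Y a : plane).
Proof.
move=> mX mY; apply: measurable_addp => //.
exact: (measurableT_comp (@measurable_plane_opp R) mY).
Qed.

Definition odiff g (x y : R * R) : R := (g (x + y) - g (x - y)) / 2.

Lemma measurable_odiff g X Y : continuous g -> measurable_fun setT X ->
  measurable_fun setT Y -> measurable_fun setT (fun a => odiff g (X a) (Y a)).
Proof.
move=> /continuous_measurable_plane mg mX mY.
apply: measurable_funM => //; apply: measurable_funB.
  exact: (measurableT_comp mg (measurable_addp mX mY)).
exact: (measurableT_comp mg (measurable_subp mX mY)).
Qed.

Lemma measurable_sdiff g X Y : continuous g -> measurable_fun setT X ->
  measurable_fun setT Y -> measurable_fun setT (fun a => sdiff g (X a) (Y a)).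
Proof.
move=> /continuous_measurable_plane mg mX mY.
apply: measurable_funB; first apply: measurable_funB.
- by apply: measurable_funM => //; exact: (measurableT_comp mg mX).
- exact: (measurableT_comp mg (measurable_addp mX mY)).
- exact: (measurableT_comp mg (measurable_subp mX mY)).
Qed.

Lemma measurable_inv_enorm_comp X : measurable_fun setT X ->
  measurable_fun setT (fun a => (enorm (X a))^-1 : R).
Proof. exact: (measurableT_comp (@measurable_inv_enorm R)). Qed.

End plane_maps.

Section line_kernel.
Context {R : realType}.

Lemma is_derive_inv_enorm (s t : R) : t != 0 ->
  is_derive s 1 (fun s : R => (enorm (s, t))^-1) (- (s * (enorm (s, t))^-1 ^+ 3)).
Proof.
move=> t0.
have p0 : 0 < s ^+ 2 + t ^+ 2.
  by rewrite ltr_wpDl ?sqr_ge0// exprn_even_gt0.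
have E0 : 0 < enorm (s, t) by rewrite sqrtr_gt0.
have dp : is_derive s 1 (fun s : R => s ^+ 2 + t ^+ 2) (2 * s).
  apply: is_derive_eq; rewrite /GRing.scale/=; ring.
have dq := @is_derive1_comp _ _ (fun s : R => s ^+ 2 + t ^+ 2) _ _ _ (is_derive1_sqrt p0) dp.
have dv := is_deriveV (lt0r_neq0 E0 : (Num.sqrt \o (fun s : R => s ^+ 2 + t ^+ 2)) s != 0) dq.
apply: is_derive_eq dv _; rewrite /GRing.scale/= -[Num.sqrt _]/(enorm (s, t)).
by field; exact: lt0r_neq0.
Qed.

Lemma continuous_inv_enorm (t : R) : t != 0 ->
  continuous (fun s : R => (enorm (s, t))^-1).
Proof.
move=> t0 s; have [ds _] := is_derive_inv_enorm s t0.
by apply: differentiable_continuous; apply/derivable1_diffP.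
Qed.

End line_kernel.

(** * Averages of second differences *)

Section averages.
Context {R : realType}.
Notation mu := (@lebesgue_measure R).
Notation plane := (measurableTypeR R * measurableTypeR R)%type.
Notation sleb2 := (@sleb2 R).
Implicit Types (x y : R * R) (G : R * R -> R).

Lemma measure_itv_lty (a b : R) : (mu `[a, b] < +oo)%E.
Proof. by rewrite -ge0_fin_numE// lebesgue_measure_itv; case: ifP. Qed.

Lemma measure_box_lty n : (sleb2 (box n) < +oo)%E.
Proof.
rewrite /box /sleb2 /leb2/= product_measure1E//; try exact: measurable_itv.
have I := @measure_itv_lty (- (n%:R * pi)) (n%:R * pi).
by apply: lte_mul_pinfty; [exact: measure_ge0|rewrite ge0_fin_numE|].
Qed.

Lemma integrable_box n G (C : R) : continuous G ->
  (forall x, box n x -> `|G x| <= C) -> sleb2.-integrable (box n) (EFin \o G).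
Proof.
move=> /continuous_measurable_plane mG GC.
apply: (@integrable_bounded _ _ _ _ _ _ C) => //.
- exact: measurable_box.
- exact: measure_box_lty.
- exact: measurable_funTS.
Qed.

(** A translate of the fundamental box by one of its points lies in the double
box. *)
Lemma integral_shift_le (f : R * R -> \bar R) y :
  measurable_fun [set: plane] f -> (forall z, (0 <= f z)%E) -> box 1 y ->
  (\int[sleb2]_(x in box 1) f (x + y)%R <= \int[sleb2]_(x in box 2) f x)%E.
Proof.
move=> mf f0 y1.
pose T (x : plane) : plane := y + x.
have mT : measurable_fun [set: plane] T by exact: measurable_plane_add.
pose D : set plane := [set z | box 1 (z - y)].
have mD : measurable D.
  rewrite -[D]setTI; rewrite (_ : D = (fun z : plane => - y + z : plane) @^-1` box 1).
    by apply: measurable_plane_add => //; exact: measurable_box.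
  by apply/seteqP; split=> z; rewrite /D/= addrC.
have TD : T @^-1` D = box 1.
  by apply/seteqP; split=> z; rewrite /D /T/= addrAC subrr add0r.
rewrite (eq_integral (fun x : plane => f (T x))); last first.
  by move=> x _; rewrite /T addrC.
rewrite -TD -(@integral_transfer _ _ _ _ _ _ _ _ mT (leb2_translate y) D)//; last first.
  exact: measurable_funTS.
apply: ge0_subset_integral => //.
- exact: measurable_box.
- exact: measurable_funTS.
- by move=> z; rewrite /D/= => /boxD -/(_ 1%N y y1); rewrite subrK.
Qed.

Lemma Rintegral_shift_le G (C : R) y : continuous G ->
  (forall x, box 2 x -> `|G x| <= C) -> box 1 y ->
  \int[sleb2]_(x in box 1) `|G (x + y)| <= \int[sleb2]_(x in box 2) `|G x|.
Proof.
move=> cG GC y1; have mG := continuous_measurable_plane cG.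
have i2 := integrable_box cG GC.
have mnG : measurable_fun [set: plane] (fun x => `|G x|%:E).
  by apply/measurable_EFinP; exact: measurableT_comp.
rewrite /Rintegral fine_le//; last exact: (integral_shift_le mnG _ y1).
- suff h : sleb2.-integrable (box 1) (EFin \o (fun x : plane => `|G (x + y)|)).
    exact: (integrable_fin_num (measurable_box 1) h).
  apply: (@integrable_bounded _ _ _ _ _ (fun x : plane => `|G (x + y)|) C).
  + exact: measurable_box.
  + exact: measure_box_lty.
  + apply: measurable_funTS; apply: measurableT_comp => //.
    apply: (measurableT_comp mG).
    by apply: measurable_addp; [exact: measurable_id|exact: measurable_cst].
  + by move=> x x1; rewrite normr_id GC//; exact: (boxD x1 y1).
- exact: (integrable_fin_num (measurable_box 2) (integrable_norm i2)).
Qed.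

End averages.

Section weighted_average.
Context {d} {T : measurableType d} {R : realType}.
Notation plane := (measurableTypeR R * measurableTypeR R)%type.
Notation sleb2 := (@sleb2 R).
Variables (m : {sigma_finite_measure set T -> \bar R}) (A : set T).
Variables (Y : T -> plane) (w : T -> R) (W : R) (G : R * R -> R) (C : R).
Hypotheses (mA : measurable A) (Afin : (m A < +oo)%E).
Hypotheses (mY : measurable_fun setT Y) (AY : forall a, A a -> box 1 (Y a)).
Hypotheses (mw : measurable_fun setT w) (wW : forall a, A a -> `|w a| <= W).
Hypothesis cG : continuous G.
Hypothesis GC : forall x, box 2 x -> `|G x| <= C.

Let sdiff_bound x y : box 1 x -> box 1 y -> `|sdiff G x y| <= 4 * C.
Proof.
move=> x1 y1; have x2 := box_le (isT : (1 <= 2)%N) x1.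
have xy := boxD x1 y1; have xy' := boxD x1 ((boxN 1 y).2 y1).
rewrite (_ : 4 * C = 2 * C + C + C); last by ring.
by rewrite (le_trans (ler_normB _ _))// lerD ?GC// (le_trans (ler_normB _ _))// lerD ?GC// normrM ger0_norm// ler_pM2l// GC.
Qed.

Lemma integrable_weighted_sdiff :
  (sleb2 \x m)%E.-integrable (box 1 `*` A)
    (EFin \o (fun z : plane * T => w z.2 * sdiff G z.1 (Y z.2))).
Proof.
apply: (@integrable_bounded _ _ _ _ _ _ (W * (4 * C))).
- exact: measurableX (measurable_box 1) mA.
- rewrite /= product_measure1E//; last exact: measurable_box.
  have := @measure_box_lty R 1; rewrite -ge0_fin_numE ?measure_ge0// => Bfin.
  by apply: lte_mul_pinfty => //; rewrite measure_ge0.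
- apply: measurable_funTS; apply: measurable_funM.
    exact: (measurableT_comp mw measurable_snd).
  exact: (measurable_sdiff cG measurable_fst (measurableT_comp mY measurable_snd)).
- move=> [x a] [/= x1 Aa]; rewrite normrM ler_pM// ?wW//.
  exact: sdiff_bound (AY Aa).
Qed.

Let Q := \int[sleb2]_(x in box 2) `|G x|.

Let sdiff_average y : box 1 y -> `|\int[sleb2]_(x in box 1) sdiff G x y| <= 4 * Q.
Proof.
move=> y1; have mG := continuous_measurable_plane cG.
have mB := @measurable_box R 1.
have y1' := (boxN 1 y).2 y1.
have msd : measurable_fun [set: plane] (fun x : plane => sdiff G x y).
  by apply: measurable_sdiff.
have ib (f : plane -> R) (D : R) : measurable_fun [set: plane] f ->
    (forall x, box 1 x -> `|f x| <= D) -> sleb2.-integrable (box 1) (EFin \o f).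
  move=> mf fD; apply: (@integrable_bounded _ _ _ _ _ _ D) => //.
    exact: measure_box_lty.
  exact: measurable_funTS.
have mGs u : measurable_fun [set: plane] (fun x : plane => `|G (x + u)|).
  apply: measurableT_comp => //; apply: (measurableT_comp mG).
  by apply: measurable_addp; [exact: measurable_id|exact: measurable_cst].
have iGs u : box 1 u -> sleb2.-integrable (box 1) (EFin \o (fun x : plane => `|G (x + u)|)).
  by move=> u1; apply: (ib _ C) => // x x1; rewrite normr_id GC//; exact: (boxD x1 u1).
have o1 : box 1 (0 : R * R) by apply/boxP; rewrite /= normr0 mul1r pi_ge0.
have isd : sleb2.-integrable (box 1) (EFin \o (fun x : plane => sdiff G x y)).
  by apply: (ib _ (4 * C)) => // x x1; exact: sdiff_bound.
apply: le_trans (le_normr_Rintegral mB isd) _.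
have i1 := integrable_EFinZ mB 2 (iGs _ o1).
have i2 := integrable_EFinD mB i1 (iGs _ y1).
have i3 := integrable_EFinD mB i2 (iGs _ y1').
apply: le_trans (le_Rintegral mB _ i3 _) _.
- exact: integrable_norm isd.
- move=> x x1; rewrite addr0 /sdiff.
  by rewrite (le_trans (ler_normB _ _))// lerD// (le_trans (ler_normB _ _))// lerD// normrM ger0_norm.
have e3 := RintegralD mB i2 (iGs _ y1').
have e2 := RintegralD mB i1 (iGs _ y1).
have e1 := RintegralZl 2 mB (iGs _ o1).
rewrite [leLHS]e3 e2 e1.
rewrite (_ : 4 * Q = 2 * Q + Q + Q); last by ring.
by rewrite !lerD// ?ler_pM2l//; exact: (Rintegral_shift_le cG GC).
Qed.

(** Exchanging the two integrals leaves averages over a box of the three values in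
[sdiff G _ (Y a)]; the bounded weight allows each to be estimated on its own. *)
Lemma weighted_average_le :
  `|\int[sleb2]_(x in box 1) \int[m]_(a in A) (w a * sdiff G x (Y a))| <=
  4 * W * Q * fine (m A).
Proof.
have mB := @measurable_box R 1.
have [_ <-] := fubini_Rintegral1 mB mA integrable_weighted_sdiff.
have [ia ->] := fubini_Rintegral2 mB mA integrable_weighted_sdiff.
apply: le_trans (le_normr_Rintegral mA ia) _ => /=.
rewrite -Rintegral_cst//; apply: le_Rintegral => //.
- exact: integrable_norm ia.
- apply: (@integrable_bounded _ _ _ _ _ _ `|4 * W * Q|) => //.
- move=> a Aa; rewrite RintegralZl//.
    rewrite normrM (_ : 4 * W * Q = W * (4 * Q)); last by ring.
    by apply: ler_pM => //; [exact: wW|exact: sdiff_average (AY Aa)].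
  apply: (@integrable_bounded _ _ _ _ _ _ (4 * C)) => //.
  + exact: measure_box_lty.
  + apply: measurable_funTS; exact: measurable_sdiff.
  + by move=> x x1; apply: sdiff_bound => //; exact: AY.
Qed.

End weighted_average.

(** * Integration of the singular kernel along lines *)

Section inverse_norm_bounds.
Context {R : realType}.
Implicit Types (y : R * R).

Definition rho y : R := (enorm y)^-1.

Lemma rho_ge0 y : 0 <= rho y. Proof. by rewrite invr_ge0 enorm_ge0. Qed.

Lemma rhoN y : rho (- y) = rho y. Proof. by rewrite /rho enormN. Qed.

Lemma rho_swap y : rho (swap y) = rho y. Proof. by rewrite /rho enorm_swap. Qed.

Lemma enorm_rho y : enorm y * rho y <= 1.
Proof.
rewrite /rho; have [->|e0] := eqVneq (enorm y) 0; first by rewrite mul0r.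
by rewrite divff.
Qed.

Lemma norm1_rho y : `|y.1| * rho y <= 1.
Proof. by apply: le_trans (enorm_rho y); rewrite ler_wpM2r ?rho_ge0// le_norm1_enorm. Qed.

(* With the convention 0^-1 = 0 the identity also holds at the origin. *)
Lemma sqr_rho y : (y.1 ^+ 2 + y.2 ^+ 2) * rho y ^+ 5 = rho y ^+ 3.
Proof.
rewrite -sqr_enorm /rho; have [->|e0] := eqVneq (enorm y) 0.
  by rewrite invr0 !expr0n/= mulr0.
by field.
Qed.

Lemma odd_kernel_le (a M : R) y : 0 <= M -> `|a| <= M * enorm y ->
  `|y.1 * rho y ^+ 3 * a| <= M * rho y.
Proof.
move=> M0 aM; have r0 := rho_ge0 y.
have h : `|a| * rho y <= M.
  apply: le_trans (ler_wpM2r r0 aM) _.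
  by rewrite -mulrA -[leRHS]mulr1 ler_wpM2l// enorm_rho.
rewrite 2!normrM normrX (ger0_norm r0).
rewrite (_ : _ * _ * _ = (`|y.1| * rho y) * (`|a| * rho y) * rho y); last by ring.
by rewrite ler_wpM2r// -[leRHS]mul1r ler_pM ?mulr_ge0// norm1_rho.
Qed.

(** The factor of [a / 2] is minus a second derivative of [1 / |y|], homogeneous
of degree -3. *)
Lemma hessian_kernel_le (a M : R) y : 0 <= M -> `|a| <= M * enorm y ^+ 2 ->
  `|a / 2 * (rho y ^+ 3 - 3 * y.1 ^+ 2 * rho y ^+ 5)| <= 2 * M * rho y.
Proof.
move=> M0 aM; have r0 := rho_ge0 y.
have k4 : `|rho y ^+ 3 - 3 * y.1 ^+ 2 * rho y ^+ 5| <= 4 * rho y ^+ 3.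
  have h : y.1 ^+ 2 * rho y ^+ 5 <= rho y ^+ 3.
    by rewrite -[leRHS]sqr_rho ler_wpM2r ?exprn_ge0// lerDl sqr_ge0.
  have h0 : 0 <= y.1 ^+ 2 * rho y ^+ 5 by rewrite mulr_ge0 ?sqr_ge0 ?exprn_ge0.
  have h3 : 0 <= rho y ^+ 3 by rewrite exprn_ge0.
  by rewrite ler_norml -mulrA; apply/andP; split; lra.
have h : `|a| * rho y ^+ 2 <= M.
  apply: le_trans (ler_wpM2r (exprn_ge0 2 r0) aM) _.
  rewrite -mulrA -exprMn -[leRHS]mulr1 ler_wpM2l// expr_le1// ?enorm_rho//.
  by rewrite mulr_ge0// enorm_ge0.
rewrite normrM normf_div (ger0_norm (_ : 0 <= 2))//.
apply: (@le_trans _ _ (`|a| / 2 * (4 * rho y ^+ 3))).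
  by rewrite ler_wpM2l// divr_ge0.
rewrite (_ : _ / _ * _ = 2 * (`|a| * rho y ^+ 2) * rho y); last by field.
by rewrite ler_wpM2r// ler_wpM2l.
Qed.

End inverse_norm_bounds.

Section lines_in_the_plane.
Context {R : realType}.
Implicit Types (x y : R * R) (G : R * R -> R).

Lemma cts_id : continuous (fun s : R => s).
Proof. by move=> s; exact: cvg_id. Qed.

Lemma cts_cst (c : R) : continuous (fun _ : R => c).
Proof. by move=> s; exact: cvg_cst. Qed.

Lemma ctsD (f g : R -> R) : continuous f -> continuous g ->
  continuous (fun s => f s + g s).
Proof. by move=> cf cg s; exact: cvgD (cf s) (cg s). Qed.

Lemma ctsB (f g : R -> R) : continuous f -> continuous g ->
  continuous (fun s => f s - g s).
Proof. by move=> cf cg s; exact: cvgB (cf s) (cg s). Qed.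

Lemma ctsN (f : R -> R) : continuous f -> continuous (fun s => - f s).
Proof. by move=> cf s; exact: cvgN (cf s). Qed.

Lemma ctsM (f g : R -> R) : continuous f -> continuous g ->
  continuous (fun s => f s * g s).
Proof. by move=> cf cg s; exact: cvgM (cf s) (cg s). Qed.

Lemma ctsX (f : R -> R) n : continuous f -> continuous (fun s => f s ^+ n).
Proof.
move=> cf s; exact: (@continuous_comp _ _ _ f (fun s => s ^+ n) s (cf s) (@exprn_continuous _ n _)).
Qed.

Lemma continuous_line G x (t : R) : continuous G ->
  continuous (fun s => G (x + (s, t))) /\ continuous (fun s => G (x - (s, t))).
Proof.
move=> cG; split.
  move=> s; apply: (@continuous_comp _ _ _ (fun s : R => (x.1 + s, x.2 + t) : R * R) G s); last exact: cG.
  by apply: continuous_pair; [exact: (ctsD (@cts_cst _) cts_id)|exact: cts_cst].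
move=> s; apply: (@continuous_comp _ _ _ (fun s : R => (x.1 - s, x.2 - t) : R * R) G s); last exact: cG.
by apply: continuous_pair; [exact: (ctsB (@cts_cst _) cts_id)|exact: cts_cst].
Qed.

Lemma continuous_sdiff_line G x (t : R) : continuous G ->
  continuous (fun s => sdiff G x (s, t)).
Proof.
by move=> /(continuous_line x t)[cp cm]; exact: (ctsB (ctsB (@cts_cst _) cp) cm).
Qed.

Lemma continuous_odiff_line G x (t : R) : continuous G ->
  continuous (fun s => odiff G x (s, t)).
Proof.
by move=> /(continuous_line x t)[cp cm]; exact: (ctsM (ctsB cp cm) (@cts_cst _)).
Qed.

Lemma is_derive_mul (f g : R -> R) (s a b : R) : is_derive s 1 f a ->
  is_derive s 1 g b -> is_derive s 1 (fun s => f s * g s) (a * g s + f s * b).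
Proof.
move=> df dg; have d := is_deriveM df dg.
by apply: is_derive_eq d _; rewrite /GRing.scale/=; ring.
Qed.

Lemma is_derive_sub (f g : R -> R) (s a b : R) : is_derive s 1 f a ->
  is_derive s 1 g b -> is_derive s 1 (fun s => f s - g s) (a - b).
Proof. by move=> df dg; exact: is_deriveB. Qed.

Lemma is_derive_opp (f : R -> R) (s a : R) : is_derive s 1 f a ->
  is_derive s 1 (fun s => - f s) (- a).
Proof. by move=> df; exact: is_deriveN. Qed.

Lemma is_derive_mulc (f : R -> R) (s a c : R) : is_derive s 1 f a ->
  is_derive s 1 (fun s => f s * c) (a * c).
Proof.
move=> df; have d := is_derive_mul df (is_derive_cst c s 1).
by apply: is_derive_eq d _; rewrite mulr0 addr0.
Qed.

Lemma is_derive_line_shift (F : R -> R) (a s l : R) :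
  is_derive (a + s) 1 F l -> is_derive s 1 (fun s => F (a + s)) l.
Proof.
move=> dF.
have da : is_derive s 1 (fun s : R => a + s) (0 + 1).
  by apply: is_deriveD.
have := @is_derive1_comp _ F (fun s : R => a + s) s l (0 + 1) dF da.
by rewrite add0r mulr1.
Qed.

Lemma is_derive_line_opp (F : R -> R) (a s l : R) :
  is_derive (a - s) 1 F l -> is_derive s 1 (fun s => F (a - s)) (- l).
Proof.
move=> dF.
have da : is_derive s 1 (fun s : R => a - s) (0 - 1).
  by apply: is_deriveB.
have := @is_derive1_comp _ F (fun s : R => a - s) s l (0 - 1) dF da.
by rewrite sub0r mulrN1.
Qed.

End lines_in_the_plane.

Section horizontal_integration.
Context {R : realType}.
Notation mu := (@lebesgue_measure R).
Notation plane := (measurableTypeR R * measurableTypeR R)%type.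
Notation sleb2 := (@sleb2 R).
Notation I := (`[- pi, pi]%classic : set (measurableTypeR R)).
Implicit Types (x y : R * R).
Variables (G G1 : R * R -> R) (M C : R).
Hypotheses (cG : continuous G) (cG1 : continuous G1) (M0 : 0 <= M).
Hypothesis GC : forall x, box 2 x -> `|G x| <= C.
Hypothesis dG : forall s t, `|s| < 2 * pi -> `|t| <= 2 * pi ->
  is_derive (s : R) 1 (fun s => G (s, t)) (G1 (s, t)).
Hypothesis sdM : forall x y, box 1 x -> box 1 y -> `|sdiff G x y| <= M * enorm y ^+ 2.
Hypothesis odM : forall x y, box 1 x -> box 1 y -> `|odiff G x y| <= M * enorm y.
Hypothesis od1M : forall x y, box 1 x -> box 1 y -> `|odiff G1 x y| <= M * enorm y.

(** Minus half of the second difference times the derivative in [y.1] of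
[y.1 * |y|^-3]. *)
Definition hessian_part x y : R :=
  - (sdiff G x y / 2 * (rho y ^+ 3 - 3 * y.1 ^+ 2 * rho y ^+ 5)).

Definition odd_part x y : R := y.1 * rho y ^+ 3 * odiff G1 x y.

(** The difference of the values of the primitive at the two ends of the
horizontal line at height [t]. *)
Definition edge_term x (t : R) : R :=
  - (pi / 2 * rho (pi, t) ^+ 3) * (sdiff G x (pi, t) + sdiff G x (- pi, t)).

Lemma is_derive_sdiff x (s t : R) : box 1 x -> `|s| < pi -> `|t| <= pi ->
  is_derive s 1 (fun s => sdiff G x (s, t)) (- (2 * odiff G1 x (s, t))).
Proof.
move=> /boxP; rewrite !mul1r => -[x1 x2] s1 t1.
have dp : is_derive s 1 (fun s => G (x.1 + s, x.2 + t)) (G1 (x.1 + s, x.2 + t)).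
  apply: (@is_derive_line_shift _ (fun s => G (s, x.2 + t))); apply: dG.
    by rewrite (le_lt_trans (ler_normD _ _))// mulr_natl mulr2n ler_ltD.
  by rewrite (le_trans (ler_normD _ _))// mulr_natl mulr2n lerD.
have dm : is_derive s 1 (fun s => G (x.1 - s, x.2 - t)) (- G1 (x.1 - s, x.2 - t)).
  apply: (@is_derive_line_opp _ (fun s => G (s, x.2 - t))); apply: dG.
    by rewrite (le_lt_trans (ler_normB _ _))// mulr_natl mulr2n ler_ltD.
  by rewrite (le_trans (ler_normB _ _))// mulr_natl mulr2n lerD.
have d := is_deriveB (is_deriveB (is_derive_cst (2 * G x) s 1) dp) dm.
by apply: is_derive_eq d _; rewrite /odiff; field.
Qed.

(** The integrand is the derivative in [s] of
[- sdiff G x (s, t) / 2 * s * rho (s, t) ^+ 3]: the derivative of the second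
difference is minus twice an odd difference of [G1]. For [t] different from 0 the
line avoids the singularity. *)
Lemma hessian_line x t : box 1 x -> `|t| <= pi -> t != 0 ->
  \int[mu]_(s in I) (hessian_part x (s, t) + odd_part x (s, t)) = edge_term x t.
Proof.
move=> x1 t1 t0.
pose V (s : R) : R := - (sdiff G x (s, t) / 2) * (s * rho (s, t) ^+ 3).
have crho : continuous (fun s : R => rho (s, t)) by exact: continuous_inv_enorm.
have cX n := @ctsX _ _ n crho.
have csd := @continuous_sdiff_line _ G x t cG.
have pi0 : - pi < pi :> R by rewrite gtrN ?pi_gt0.
have cV : continuous V.
  exact: (ctsM (ctsN (ctsM csd (@cts_cst _ _))) (ctsM (@cts_id _) (cX 3))).
have cdV : continuous (fun s => hessian_part x (s, t) + odd_part x (s, t)).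
  apply: ctsD.
    apply: ctsN; apply: (ctsM (ctsM csd (@cts_cst _ _))).
    exact: (ctsB (cX 3) (ctsM (ctsM (@cts_cst _ _) (@ctsX _ _ 2 (@cts_id _))) (cX 5))).
  exact: (ctsM (ctsM (@cts_id _) (cX 3)) (@continuous_odiff_line _ G1 x t cG1)).
have dV (s : R) : - pi < s < pi -> is_derive s 1 V (hessian_part x (s, t) + odd_part x (s, t)).
  move=> s12; have s1 : `|s| < pi by rewrite ltr_norml.
  have sd := is_derive_sdiff x1 s1 t1.
  have dr := is_derive_inv_enorm s t0.
  have dr3 : is_derive s 1 (fun s : R => rho (s, t) ^+ 3) (- (3 * s * rho (s, t) ^+ 5)).
    have d3 := @is_deriveX _ _ (fun s : R => (enorm (s, t))^-1) 3 s 1 _ dr.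
    apply: (is_derive_eq d3); rewrite /GRing.scale/= -/(rho _); ring.
  have d := is_derive_mul (is_derive_opp (is_derive_mulc 2^-1 sd)) (is_derive_mul (is_derive_id s 1) dr3).
  apply: is_derive_eq d _.
  by rewrite /hessian_part /odd_part /=; field.
apply: etrans (Rintegral_is_derive pi0 cV cdV dV) _.
rewrite /V /edge_term -(rhoN (- pi, t)) -[- (- pi, t)]/(- - pi, - t) opprK.
rewrite (_ : rho (pi, - t) = rho (pi, t)); last by rewrite /rho /enorm/= sqrrN.
by field.
Qed.

Let mI : measurable I. Proof. exact: measurable_itv. Qed.
Let mB : measurable (box 1 : set plane). Proof. exact: measurable_box. Qed.

Lemma measurable_odd_kernel {d} {T : measurableType d} (Y : T -> plane) n :
  measurable_fun setT Y -> measurable_fun setT (fun a => (Y a).1 * rho (Y a) ^+ n : R).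
Proof.
move=> mY; apply: measurable_funM; first exact: measurable_coord1.
by apply: measurable_funX; exact: measurable_inv_enorm_comp.
Qed.

Lemma measurable_odd_part {d} {T : measurableType d} (X Y : T -> plane) :
  measurable_fun setT X -> measurable_fun setT Y ->
  measurable_fun setT (fun a => odd_part (X a) (Y a)).
Proof.
move=> mX mY; apply: measurable_funM; first exact: measurable_odd_kernel.
exact: measurable_odiff.
Qed.

Lemma measurable_hessian_part {d} {T : measurableType d} (X Y : T -> plane) :
  measurable_fun setT X -> measurable_fun setT Y ->
  measurable_fun setT (fun a => hessian_part (X a) (Y a)).
Proof.
move=> mX mY; apply: measurableT_comp => //; apply: measurable_funM.
  by apply: measurable_funM => //; exact: measurable_sdiff.
have mr n : measurable_fun setT (fun a => rho (Y a) ^+ n : R).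
  by apply: measurable_funX; exact: measurable_inv_enorm_comp.
apply: measurable_funB; first exact: mr.
apply: measurable_funM; last exact: mr.
apply: measurable_funM => //.
by apply: measurable_funX; exact: measurable_coord1.
Qed.

Lemma odd_part_le x y : box 1 x -> box 1 y -> `|odd_part x y| <= M * rho y.
Proof. by move=> x1 y1; apply: odd_kernel_le => //; exact: od1M. Qed.

Lemma hessian_part_le x y : box 1 x -> box 1 y -> `|hessian_part x y| <= 2 * M * rho y.
Proof. by move=> x1 y1; rewrite normrN; apply: hessian_kernel_le => //; exact: sdM. Qed.

Lemma integrable_odd_part : (sleb2 \x sleb2)%E.-integrable (box 1 `*` box 1)
  (EFin \o (fun z : plane * plane => odd_part z.1 z.2)).
Proof.
apply: (@integrable_singular _ _ _ _ _ _ M) => //.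
- exact: measure_box_lty.
- by apply: measurable_funTS; exact: (measurable_odd_part measurable_fst measurable_snd).
- by move=> x y; exact: odd_part_le.
Qed.

Lemma integrable_hessian_part : (sleb2 \x sleb2)%E.-integrable (box 1 `*` box 1)
  (EFin \o (fun z : plane * plane => hessian_part z.1 z.2)).
Proof.
apply: (@integrable_singular _ _ _ _ _ _ (2 * M)) => //.
- exact: measure_box_lty.
- by rewrite mulr_ge0.
- by apply: measurable_funTS; exact: (measurable_hessian_part measurable_fst measurable_snd).
- by move=> x y; exact: hessian_part_le.
Qed.

Lemma measurable_edge_weight : measurable_fun [set: measurableTypeR R]
  (fun t : measurableTypeR R => - (pi / 2 * rho (pi, t) ^+ 3) : R).
Proof.
apply: measurableT_comp => //; apply: measurable_funM => //.
apply: measurable_funX; apply: measurable_inv_enorm_comp.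
by apply: measurable_pairR => //; exact: measurable_cst.
Qed.

Lemma hessian_box x : box 1 x ->
  \int[sleb2]_(y in box 1) (hessian_part x y + odd_part x y) =
  \int[mu]_(t in I) edge_term x t.
Proof.
move=> x1; have mx : measurable_fun [set: plane] (fun _ : plane => x : plane) by exact: measurable_cst.
have mF : measurable_fun [set: plane] (fun y : plane => hessian_part x y + odd_part x y).
  apply: measurable_funD.
    exact: (measurable_hessian_part mx (@measurable_id _ _ setT)).
  exact: (measurable_odd_part mx (@measurable_id _ _ setT)).
have iF : (mu \x mu)%E.-integrable (I `*` I)
    (EFin \o (fun y : plane => hessian_part x y + odd_part x y)).
  rewrite -box1E; apply: (integrable_dom mB (g := fun y => 3 * M * (enorm y)^-1)).
  - exact: measurable_funTS.
  - exact: integrable_EFinZ (@integrable_inv_enorm R).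
  - move=> y y1; rewrite (le_trans (ler_normD _ _))//.
    by have := hessian_part_le x1 y1; have := odd_part_le x1 y1; rewrite /rho; lra.
have [it e] := fubini_Rintegral2 mI mI iF.
rewrite box1E; apply: etrans e _.
apply: Rintegral_punctured.
- by apply/measurable_EFinP; exact: (measurable_int _ it).
- apply: measurable_funTS; apply: measurable_funM; first exact: measurable_edge_weight.
  have mxR : measurable_fun [set: measurableTypeR R] (fun _ : measurableTypeR R => x : plane) by exact: measurable_cst.
  have mp (c : R) : measurable_fun [set: measurableTypeR R] (fun t : measurableTypeR R => (c, t) : plane).
    by apply: measurable_pairR => //; exact: measurable_cst.
  by apply: measurable_funD; exact: measurable_sdiff.
- move=> t t0; rewrite in_itv/= => tI; apply: hessian_line => //.
  by rewrite ler_norml.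
Qed.

Definition edge_bound : R := 2 * (4 * (pi / 2 * pi^-1 ^+ 3) * fine (mu I)).

Lemma edge_average_le :
  `|\int[sleb2]_(x in box 1) \int[mu]_(t in I) edge_term x t| <=
  edge_bound * \int[sleb2]_(x in box 2) `|G x|.
Proof.
pose w (t : measurableTypeR R) : R := - (pi / 2 * rho (pi, t) ^+ 3).
pose Y (c : R) (t : measurableTypeR R) : plane := (c, t).
have mY c : measurable_fun setT (Y c).
  by apply: measurable_pairR => //; exact: measurable_cst.
have IY c t : `|c| = pi -> I t -> box 1 (Y c t).
  by move=> cpi; rewrite /= in_itv/= -ler_norml => tI; apply/boxP; rewrite mul1r /= cpi.
have pi0 := @pi_gt0 R.
have npi : `|pi : R| = pi by rewrite gtr0_norm.
have nNpi : `|- pi : R| = pi by rewrite normrN.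
have wW t : I t -> `|w t| <= pi / 2 * pi^-1 ^+ 3.
  move=> _; rewrite /w normrN ger0_norm; last first.
    by rewrite mulr_ge0 ?exprn_ge0 ?rho_ge0// divr_ge0 ?pi_ge0.
  rewrite ler_wpM2l ?divr_ge0 ?pi_ge0// lerXn2r ?nnegrE ?rho_ge0 ?invr_ge0 ?pi_ge0//.
  have le := le_norm1_enorm (pi : R, t : R); rewrite /= npi in le.
  by rewrite lef_pV2 ?posrE//; exact: lt_le_trans le.
have If := @measure_itv_lty R (- pi) pi.
have ip := integrable_weighted_sdiff mI If (mY pi) (fun t => IY _ t npi) measurable_edge_weight wW cG GC.
have im := integrable_weighted_sdiff mI If (mY (- pi)) (fun t => IY _ t nNpi) measurable_edge_weight wW cG GC.
have bp := weighted_average_le mI If (mY pi) (fun t => IY _ t npi) measurable_edge_weight wW cG GC.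
have bm := weighted_average_le mI If (mY (- pi)) (fun t => IY _ t nNpi) measurable_edge_weight wW cG GC.
have [_ ep] := fubini_Rintegral1 mB mI ip.
have [_ em] := fubini_Rintegral1 mB mI im.
have iD := integrable_EFinD (measurableX mB mI) ip im.
have [_ eD] := fubini_Rintegral1 mB mI iD.
have -> : \int[sleb2]_(x in box 1) \int[mu]_(t in I) edge_term x t =
    \int[sleb2]_(x in box 1) \int[mu]_(t in I) (w t * sdiff G x (Y pi t) + w t * sdiff G x (Y (- pi) t)).
  by apply: eq_Rintegral => x _; apply: eq_Rintegral => t _; rewrite -mulrDr.
rewrite -[X in `|X|]eD (RintegralD (measurableX mB mI) ip im).
rewrite [X in `|X + _|]ep [X in `|_ + X|]em.
apply: le_trans (ler_normD _ _) _.
rewrite (_ : edge_bound * _ = 4 * (pi / 2 * pi^-1 ^+ 3) * (\int[sleb2]_(x in box 2) `|G x|) * fine (mu I) + 4 * (pi / 2 * pi^-1 ^+ 3) * (\int[sleb2]_(x in box 2) `|G x|) * fine (mu I)).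
  exact: lerD bp bm.
by rewrite /edge_bound; ring.
Qed.

(** The even part in [y] of the integrand of the principal value at the point
[(c, t)], for the normal [e1]. *)
Definition side_term (c t : R) y : R := y.1 * rho y ^+ 3 * odiff G (c, t) y.

Definition side_integral (c : R) : R :=
  \int[mu]_(t in I) \int[sleb2]_(y in box 1) side_term c t y.

(** The fundamental theorem of calculus in the first coordinate of [x]. *)
Lemma odiff_average y : box 1 y ->
  \int[sleb2]_(x in box 1) odiff G1 x y =
  \int[mu]_(t in I) (odiff G (pi, t) y - odiff G (- pi, t) y).
Proof.
move=> y1.
have my : measurable_fun [set: plane] (fun _ : plane => y : plane) by exact: measurable_cst.
have iF : (mu \x mu)%E.-integrable (I `*` I) (EFin \o (fun x : plane => odiff G1 x y)).
  rewrite -box1E; apply: (@integrable_bounded _ _ _ sleb2 _ _ (M * enorm y)) => //.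
  - exact: measure_box_lty.
  - by apply: measurable_funTS; exact: (measurable_odiff cG1 (@measurable_id _ _ setT) my).
  - by move=> x x1; exact: od1M.
have [it e] := fubini_Rintegral2 mI mI iF.
rewrite box1E; apply: etrans e _; apply: eq_Rintegral => t /set_mem/=.
rewrite in_itv/= -ler_norml => t1.
have pi0 : - pi < pi :> R by rewrite gtrN ?pi_gt0.
have cl (F : R * R -> R) : continuous F -> continuous (fun s : R => odiff F (s, t) y).
  move=> cF; apply: (ctsM _ (@cts_cst _ _)); apply: ctsB.
    have [+ _] := @continuous_line _ F y t cF.
    by under eq_fun do rewrite addrC.
  have [+ _] := @continuous_line _ F (- y) t cF.
  by under eq_fun do rewrite addrC.
apply: (Rintegral_is_derive pi0 (cl _ cG) (cl _ cG1)) => s s12.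
have s1 : `|s| < pi by rewrite ltr_norml.
move: (y1) => /boxP; rewrite !mul1r => -[y11 y12].
have sh (a b : R) : `|a| <= pi -> `|b| <= pi ->
    is_derive s 1 (fun s => G (s + a, t + b)) (G1 (s + a, t + b)).
  move=> a1 b1; under eq_fun do rewrite addrC.
  rewrite [in G1 _]addrC.
  apply: (@is_derive_line_shift _ (fun s => G (s, t + b)) a s); apply: dG.
    by rewrite (le_lt_trans (ler_normD _ _))// mulr_natl mulr2n ler_ltD.
  by rewrite (le_trans (ler_normD _ _))// mulr_natl mulr2n lerD.
have d := is_derive_mulc 2^-1 (is_derive_sub (sh _ _ y11 y12) (sh (- y.1) (- y.2) _ _)).
by apply: d; rewrite normrN.
Qed.

Lemma side_box (c t : R) : `|c| = pi -> I t -> box 1 (c, t).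
Proof.
by move=> cpi; rewrite /= in_itv/= -ler_norml => tI; apply/boxP; rewrite mul1r /= cpi.
Qed.

Lemma integrable_side_term c : `|c| = pi ->
  (mu \x sleb2)%E.-integrable (I `*` box 1)
    (EFin \o (fun z : measurableTypeR R * plane => side_term c z.1 z.2)).
Proof.
move=> cpi; apply: (@integrable_singular _ _ _ _ _ _ M) => //.
- exact: measure_itv_lty.
- apply: measurable_funTS; apply: measurable_funM.
    exact: (measurable_odd_kernel 3 measurable_snd).
  apply: measurable_odiff => //; apply: measurable_pairR; first exact: measurable_cst.
  exact: measurable_fst.
- move=> t y tI y1; apply: odd_kernel_le => //; apply: odM => //.
  exact: side_box.
Qed.

Lemma side_integralE c : `|c| = pi ->
  \int[(mu \x sleb2)%E]_(z in I `*` box 1) side_term c z.1 z.2 = side_integral c.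
Proof. by move=> cpi; exact: (fubini_Rintegral1 mI mB (integrable_side_term cpi)).2. Qed.

(** Integrating in [x] first, the derivative in the odd part is integrated
exactly. *)
Lemma odd_part_total :
  \int[sleb2]_(x in box 1) \int[sleb2]_(y in box 1) odd_part x y =
  side_integral pi - side_integral (- pi).
Proof.
have npi : `|pi : R| = pi by rewrite gtr0_norm ?pi_gt0.
have nNpi : `|- pi : R| = pi by rewrite normrN.
have ip := integrable_side_term npi; have im := integrable_side_term nNpi.
have mIB := measurableX mI mB.
rewrite -(side_integralE npi) -(side_integralE nNpi) -(RintegralB mIB ip im).
have [_ e1] := fubini_Rintegral1 mB mB integrable_odd_part.
have [_ e2] := fubini_Rintegral2 mB mB integrable_odd_part.
have [_ e3] := fubini_Rintegral2 mI mB (integrable_EFinB mIB ip im).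
rewrite e3; apply: etrans (esym e1) _; apply: etrans e2 _.
apply: eq_Rintegral => y /set_mem y1 /=.
have my : measurable_fun [set: plane] (fun _ : plane => y : plane) by exact: measurable_cst.
have ix : sleb2.-integrable (box 1) (EFin \o (fun x : plane => odiff G1 x y)).
  apply: (@integrable_bounded _ _ _ sleb2 _ _ (M * enorm y)) => //.
  - exact: measure_box_lty.
  - by apply: measurable_funTS; exact: (measurable_odiff cG1 (@measurable_id _ _ setT) my).
  - by move=> x x1; exact: od1M.
have myR : measurable_fun [set: measurableTypeR R] (fun _ : measurableTypeR R => y : plane) by exact: measurable_cst.
have it c : `|c| = pi -> mu.-integrable I (EFin \o (fun t => odiff G (c, t) y)).
  move=> cpi; apply: (@integrable_bounded _ _ _ mu _ _ (M * enorm y)) => //.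
  - exact: measure_itv_lty.
  - have mc : measurable_fun [set: measurableTypeR R] (fun t : measurableTypeR R => (c, t) : plane).
      by apply: measurable_pairR => //; exact: measurable_cst.
    by apply: measurable_funTS; exact: measurable_odiff.
  - by move=> t tI; apply: odM => //; exact: side_box.
have e4 := RintegralZl (y.1 * rho y ^+ 3) mB ix.
have e5 := RintegralZl (y.1 * rho y ^+ 3) mI (integrable_EFinB mI (it _ npi) (it _ nNpi)).
rewrite [LHS]e4 odiff_average//.
apply: etrans (esym e5) _; apply: eq_Rintegral => t _.
by rewrite /side_term mulrBr.
Qed.

(** The hessian and odd parts together integrate to edge terms, in which the
singularity has disappeared. *)
Lemma hessian_total_le :
  `|\int[(sleb2 \x sleb2)%E]_(z in box 1 `*` box 1) hessian_part z.1 z.2 +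
    (side_integral pi - side_integral (- pi))| <=
  edge_bound * \int[sleb2]_(x in box 2) `|G x|.
Proof.
have ih := integrable_hessian_part; have io := integrable_odd_part.
have mBB := measurableX mB mB.
have [_ e1] := fubini_Rintegral1 mB mB io.
have [_ e2] := fubini_Rintegral1 mB mB (integrable_EFinD mBB ih io).
rewrite -odd_part_total -[X in _ + X]e1 -[X in `|X|](RintegralD mBB ih io).
rewrite [X in `|X|]e2.
have e3 : \int[sleb2]_(x in box 1) \int[sleb2]_(y in box 1) (hessian_part x y + odd_part x y) =
    \int[sleb2]_(x in box 1) \int[mu]_(t in I) edge_term x t.
  by apply: eq_Rintegral => x /set_mem; exact: hessian_box.
by rewrite [X in `|X|]e3; exact: edge_average_le.
Qed.

End horizontal_integration.

(** * Exchange of coordinates and the average of the operator *)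

Section exchange_of_coordinates.
Context {R : realType}.
Notation plane := (measurableTypeR R * measurableTypeR R)%type.
Notation leb2 := (@leb2 R).
Implicit Types (x y : R * R) (f g : R * R -> R).

Lemma swapD x y : swap (x + y) = swap x + swap y.
Proof. by case: x y => [? ?] [? ?]. Qed.

Lemma swapB x y : swap (x - y) = swap x - swap y.
Proof. by case: x y => [? ?] [? ?]. Qed.

Lemma box_swap n x : box n (swap x) <-> box n x.
Proof. by case: x => a b; rewrite /box/=; split => -[]. Qed.

Lemma swap_e1 x (h : R) : swap (x + h *: e1) = swap x + h *: e2.
Proof. by case: x => a b; rewrite addre1 addre2. Qed.

Lemma swap_e2 x (h : R) : swap (x + h *: e2) = swap x + h *: e1.
Proof. by case: x => a b; rewrite addre1 addre2. Qed.

Lemma clamp_swap n x : clamp n (swap x) = swap (clamp n x).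
Proof. by case: x. Qed.

(** An equality of difference quotients and of the filters along which they are
considered, hence valid without differentiability. *)
Lemma rderive_swap n v w f x :
  (forall x (h : R), swap (x + h *: v) = swap x + h *: w) ->
  rderive (box n) v (f \o @swap R R) x = rderive (box n) w f (swap x) /\
  (rderivable (box n) w f (swap x) -> rderivable (box n) v (f \o @swap R R) x).
Proof.
move=> vw.
have e1 : diff_quot v (f \o @swap R R) x = diff_quot w f (swap x).
  by apply/funext => h; rewrite /diff_quot/= vw.
have e2 : [set h : R | box n (x + h *: v)] = [set h : R | box n (swap x + h *: w)].
  by apply/seteqP; split=> h /=; rewrite -vw => /box_swap.
by rewrite /rderive /rderivable e1 e2.
Qed.

Lemma within_continuous_swap n f : {within box n, continuous f} ->
  {within box n, continuous f \o @swap R R}.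
Proof.
move=> cf; apply: (@within_congr _ _ ((f \o clamp n) \o @swap R R)).
  by move=> z zn /=; rewrite clamp_id//; exact/box_swap.
apply: continuous_subspaceT => z.
apply: (@continuous_comp _ _ _ (fun z : R * R => (z.2, z.1)) (f \o clamp n) z).
  by apply: continuous_pair => w; [exact: cvg_snd|exact: cvg_fst].
exact: continuous_comp_clamp.
Qed.

Lemma Ck_swap k n f : Ck k (box n) f -> Ck k (box n) (f \o @swap R R).
Proof.
elim: k f => [|k IH] f Cf.
all: have [M M0 fM] := Ck_bound Cf.
all: split; first exact: within_continuous_swap (Ck_continuous Cf).
all: split; first by apply: (@bounded_le _ _ _ M) => x /box_swap; exact: fM.
- by [].
move=> v [] ->; split.
- move=> x xn; apply: (rderive_swap n f x swap_e1).2.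
  by apply: Ck_rderivable Cf coord_dir2 _; exact/box_swap.
- rewrite (_ : rderive _ _ _ = rderive (box n) e2 f \o @swap R R).
    exact: IH (Ck_rderive Cf coord_dir2).
  by apply/funext => x; exact: (rderive_swap n f x swap_e1).1.
- move=> x xn; apply: (rderive_swap n f x swap_e2).2.
  by apply: Ck_rderivable Cf coord_dir1 _; exact/box_swap.
- rewrite (_ : rderive _ _ _ = rderive (box n) e1 f \o @swap R R).
    exact: IH (Ck_rderive Cf coord_dir1).
  by apply/funext => x; exact: (rderive_swap n f x swap_e2).1.
Qed.

End exchange_of_coordinates.

Section first_order_bounds.
Context {R : realType}.
Implicit Types (x y : R * R) (f g : R * R -> R).

Lemma odiff_le f : Ck 1 (box 2) f -> exists2 M, 0 <= M &
  forall x y, box 1 x -> box 1 y -> `|odiff f x y| <= M * enorm y.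
Proof.
move=> cf.
have [M1 M10 f1] := Ck_bound (Ck_rderive cf coord_dir1).
have [M2 M20 f2] := Ck_bound (Ck_rderive cf coord_dir2).
exists (M1 + M2); first exact: addr_ge0.
move=> x y x1 y1; rewrite /odiff normrM (ger0_norm (_ : 0 <= 2^-1)) ?invr_ge0//.
rewrite ler_pdivrMr//.
apply: le_trans (box_lip cf f1 f2 (boxD x1 ((boxN 1 y).2 y1)) (boxD x1 y1)) _.
have d1 : `|(x + y).1 - (x - y).1| <= 2 * enorm y.
  rewrite (_ : _ - _ = 2 * y.1); last by rewrite /=; ring.
  by rewrite normrM ger0_norm// ler_pM2l// le_norm1_enorm.
have d2 : `|(x + y).2 - (x - y).2| <= 2 * enorm y.
  rewrite (_ : _ - _ = 2 * y.2); last by rewrite /=; ring.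
  by rewrite normrM ger0_norm// ler_pM2l// le_norm2_enorm.
rewrite -mulrA (mulrC (enorm y)) mulrDl.
by apply: lerD; apply: ler_wpM2l.
Qed.

(** The horizontal lines at the top and the bottom of the box are included: only
the first coordinate has to be interior. *)
Lemma clamp_is_derive f (s t : R) : Ck 1 (box 2) f ->
  `|s| < 2 * pi -> `|t| <= 2 * pi ->
  is_derive s 1 (fun s => (f \o clamp 2) (s, t)) ((rderive (box 2) e1 f \o clamp 2) (s, t)).
Proof.
move=> cf s2 t2.
have e (a : R) : ((0, t) : R * R) + a *: e1 = (a, t) by rewrite addre1/= add0r.
have bx (a : R) : `|a| <= 2 * pi -> box 2 (((0, t) : R * R) + a *: e1).
  by move=> a2; rewrite e; apply/boxP.
have n2 : `|2 * pi : R| = 2 * pi by rewrite ger0_norm// mulr_ge0// pi_ge0.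
have s2' := ltW s2.
have df : rderivable (box 2) e1 (f \o clamp 2) (((0, t) : R * R) + s *: e1).
  apply: (@eq_rderivable _ _ _ f); [exact: bx| |exact: Ck_rderivable cf coord_dir1 (bx _ s2')].
  by move=> z z2; rewrite /= clamp_id.
have b1 : box 2 (((0, t) : R * R) + (- (2 * pi)) *: e1) by apply: bx; rewrite normrN n2.
have b2 : box 2 (((0, t) : R * R) + (2 * pi) *: e1) by apply: bx; rewrite n2.
have s12 : - (2 * pi) < s < 2 * pi by rewrite -ltr_norml.
have := is_derive_line (@box_line_convex _ 2 e1) b1 b2 s12 df.
rewrite (@eq_rderive _ _ _ (f \o clamp 2) f _ (bx _ s2')); last first.
  by move=> z z2; rewrite /= clamp_id.
rewrite e /= clamp_id; last by rewrite -e; exact: bx.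
by under eq_fun do rewrite e.
Qed.

Notation sleb2 := (@sleb2 R).

Lemma hessian_box_le g : Ck 2 (box 2) g ->
  (sleb2 \x sleb2)%E.-integrable (box 1 `*` box 1)
    (EFin \o (fun z => hessian_part (g \o clamp 2) z.1 z.2)) /\
  `|\int[(sleb2 \x sleb2)%E]_(z in box 1 `*` box 1) hessian_part (g \o clamp 2) z.1 z.2 +
    (side_integral (g \o clamp 2) pi - side_integral (g \o clamp 2) (- pi))| <=
  edge_bound * \int[sleb2]_(x in box 2) `|g x|.
Proof.
move=> cg.
pose G := g \o clamp 2; pose G1 := rderive (box 2) e1 g \o clamp 2.
have [M2 M20 [b11 b12 b22]] := C2bound_ex cg.
have [M1 M10 o1] := odiff_le (Ck_pred cg).
have [M3 M30 o3] := odiff_le (Ck_rderive cg coord_dir1).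
have [C C0 gC] := Ck_bound cg.
pose M := 3 * M2 + M1 + M3.
have M0 : 0 <= M by rewrite /M !addr_ge0// mulr_ge0.
have Gg z : box 2 z -> G z = g z by move=> z2; rewrite /G /= clamp_id.
have G1g z : box 2 z -> G1 z = rderive (box 2) e1 g z by move=> z2; rewrite /G1 /= clamp_id.
have bp x y : box 1 x -> box 1 y -> box 2 (x + y) by exact: (@boxD _ 1 1).
have bm x y : box 1 x -> box 1 y -> box 2 (x - y) by move=> x1 /(boxN 1); exact: (@boxD _ 1 1).
have cG : continuous G by exact: Ck_clamp cg.
have cG1 : continuous G1 by exact: Ck_clamp (Ck_rderive cg coord_dir1).
have GC z : box 2 z -> `|G z| <= C by move=> z2; rewrite Gg// gC.
have dG (s t : R) : `|s| < 2 * pi -> `|t| <= 2 * pi -> is_derive s 1 (fun s => G (s, t)) (G1 (s, t)).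
  by move=> s2 t2; exact: clamp_is_derive (Ck_pred cg) s2 t2.
have sdM x y : box 1 x -> box 1 y -> `|sdiff G x y| <= M * enorm y ^+ 2.
  move=> x1 y1; rewrite /sdiff (Gg _ (box_le (isT : (1 <= 2)%N) x1)) (Gg _ (bp _ _ x1 y1)) (Gg _ (bm _ _ x1 y1)).
  apply: le_trans (sdiff_le cg b11 b12 b22 (bp _ _ x1 y1) (bm _ _ x1 y1)) _.
  by rewrite ler_wpM2r ?sqr_ge0// /M -addrA lerDl addr_ge0.
have odM x y : box 1 x -> box 1 y -> `|odiff G x y| <= M * enorm y.
  move=> x1 y1; rewrite /odiff (Gg _ (bp _ _ x1 y1)) (Gg _ (bm _ _ x1 y1)).
  apply: le_trans (o1 _ _ x1 y1) _; rewrite ler_wpM2r ?enorm_ge0// /M.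
  by have := M20; have := M30; lra.
have od1M x y : box 1 x -> box 1 y -> `|odiff G1 x y| <= M * enorm y.
  move=> x1 y1; rewrite /odiff (G1g _ (bp _ _ x1 y1)) (G1g _ (bm _ _ x1 y1)).
  apply: le_trans (o3 _ _ x1 y1) _; rewrite ler_wpM2r ?enorm_ge0// /M.
  by have := M20; have := M10; lra.
split; first exact: integrable_hessian_part cG M0 sdM.
have -> : \int[sleb2]_(x in box 2) `|g x| = \int[sleb2]_(x in box 2) `|G x|.
  by apply: eq_Rintegral => x /set_mem x2; rewrite Gg.
exact: (hessian_total_le cG cG1 M0 GC dG sdM odM od1M).
Qed.

End first_order_bounds.

Section Lambda_average.
Context {R : realType}.
Notation plane := (measurableTypeR R * measurableTypeR R)%type.
Notation sleb2 := (@sleb2 R).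
Implicit Types (x y : R * R) (f g : R * R -> R).

Let mB : measurable (box 1 : set plane). Proof. exact: measurable_box. Qed.

Definition swap2 (z : plane * plane) : plane * plane := (swap z.1, swap z.2).

Lemma measurable_swap2 : measurable_fun setT swap2.
Proof.
apply/measurable_fun_pairP; split.
  exact: (measurableT_comp (@measurable_swap _ _ _ _) measurable_fst).
exact: (measurableT_comp (@measurable_swap _ _ _ _) measurable_snd).
Qed.

Lemma measure_swap2 (D : set (plane * plane)) : measurable D ->
  (sleb2 \x sleb2)%E (swap2 @^-1` D) = (sleb2 \x sleb2)%E D.
Proof.
apply: product_measure_preimage; first exact: measurable_swap2.
move=> A B mA mB'.
rewrite (_ : swap2 @^-1` (A `*` B) = (@swap _ _ @^-1` A) `*` (@swap _ _ @^-1` B))//.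
have mS (E : set plane) : measurable E -> measurable (@swap _ _ @^-1` E : set plane).
  by move=> mE; rewrite -[_ @^-1` _]setTI; apply: measurable_swap.
apply: etrans (product_measure1E _ _ (mS _ mA) (mS _ mB')) _.
by congr (_ * _)%E; exact: leb2_swap.
Qed.

Lemma box_swap2 : swap2 @^-1` (box 1 `*` box 1) = box 1 `*` box 1.
Proof. by apply/seteqP; split => -[x y] [/= /box_swap x1 /box_swap y1]; split. Qed.

(** The contribution of the vertical sides, and that of the horizontal sides
expressed by exchanging the coordinates. *)
Definition boundary_integral g : R :=
  let sides f := side_integral (f \o clamp 2) pi - side_integral (f \o clamp 2) (- pi) in
  sides g + sides (g \o @swap R R).

Definition average_bound : R :=
  @Kconst R * (2 * @edge_bound R + 4 * 18 * fine (sleb2 (box 1))).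

(** The trace of the matrix of second derivatives: since
[y.1 ^+ 2 + y.2 ^+ 2 = |y|^2], the two factors [|y|^-3 - 3 y_i^2 |y|^-5] add up to
[- |y|^-3]. This is where the dimension enters. *)
Lemma kernel_split g x y :
  sdiff g x y / 2 * K y =
  Kconst * (hessian_part g x y +
    hessian_part (g \o @swap R R) (swap x) (swap y) +
    lattice_sum y / 2 * sdiff g x y).
Proof.
rewrite /hessian_part /sdiff /= !(swapD, swapB) !rho_swap.
have sK (z : R * R) : swap (swap z) = z by case: z.
rewrite -!swapD -!swapB !sK KE -exprVn -/(rho y) -(sqr_rho y).
by field.
Qed.

Lemma normD3_le (a b c A B C : R) : `|a| <= A -> `|b| <= B -> `|c| <= C ->
  `|a + b + c| <= A + B + C.
Proof.
move=> aA bB cC; apply: le_trans (ler_normD _ _) _; apply: lerD cC.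
by apply: le_trans (ler_normD _ _) _; exact: lerD.
Qed.

Lemma half_lattice_sum_le y : box 1 y -> `|lattice_sum y / 2| <= 18.
Proof.
move=> y1; rewrite ger0_norm ?divr_ge0 ?lattice_sum_ge0// ler_pdivrMr//.
by rewrite (le_trans (lattice_sum_le y1))// -natrM.
Qed.

Lemma Rintegral_swap_box n f : measurable_fun (box n : set plane) f ->
  \int[sleb2]_(x in box n) f (swap x) = \int[sleb2]_(x in box n) f x.
Proof.
move=> mf; have mfE : measurable_fun (box n : set plane) (EFin \o f) by exact/measurable_EFinP.
have e := integral_transfer (@measurable_swap _ _ _ _) (@leb2_swap R) (measurable_box n) mfE.
have bs : @swap R R @^-1` box n = box n by apply/seteqP; split=> x /box_swap.
by rewrite /Rintegral; congr fine; rewrite bs in e; rewrite [RHS]e.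
Qed.

(** Up to averages of [g], the integral of [Lambda g] over the box is a boundary
integral, in which only the odd singularity is left. *)
Lemma Lambda_average g : Ck 2 (box 2) g ->
  (@leb2 R).-integrable (box 1) (EFin \o Lambda g) /\
  `|\int[@leb2 R]_(x in box 1) Lambda g x + Kconst * boundary_integral g| <=
  average_bound * \int[sleb2]_(x in box 2) `|g x|.
Proof.
move=> cg; have cgs := Ck_swap cg.
pose G := g \o clamp 2; pose Gs := (g \o @swap R R) \o clamp 2.
have Gsw : G \o @swap R R = Gs by apply/funext => z; rewrite /G /Gs /= clamp_swap.
have [i1 l1] := hessian_box_le cg; have [i2 l2] := hessian_box_le cgs.
rewrite -/G in i1 l1; rewrite -/Gs in i2 l2.
have mBB : measurable (box 1 `*` box 1 : set (plane * plane)) := measurableX mB mB.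
have i2' := integrable_transfer measurable_swap2 measure_swap2 mBB i2.
have e2' := integral_transfer measurable_swap2 measure_swap2 mBB (measurable_int _ i2).
rewrite box_swap2 in i2' e2'.
have [C C0 gC] := Ck_bound cg.
have cG : continuous G by exact: Ck_clamp cg.
have Gg z : box 2 z -> G z = g z by move=> z2; rewrite /G /= clamp_id.
have GC z : box 2 z -> `|G z| <= C by move=> z2; rewrite Gg// gC.
have mw : measurable_fun [set: plane] (fun y : plane => lattice_sum y / 2).
  by apply: measurable_funM => //; exact: measurable_lattice_sum.
have wW := half_lattice_sum_le.
have idb (y : plane) : (box 1 : set plane) y -> box 1 ((fun y : plane => y) y) by [].
have mid : measurable_fun [set: plane] (fun y : plane => y) by exact: measurable_id.
have Bf := @measure_box_lty R 1.
have i3 := integrable_weighted_sdiff mB Bf mid idb mw wW cG GC.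
have l3 := weighted_average_le mB Bf mid idb mw wW cG GC.
have [_ e3] := fubini_Rintegral1 mB mB i3.
have i12 := integrable_EFinD mBB i1 i2'.
have i123 := integrable_EFinD mBB i12 i3.
have iK := integrable_EFinZ mBB Kconst i123.
have [ix ex] := fubini_Rintegral1 mB mB iK.
have LE x : box 1 x -> Lambda g x = \int[sleb2]_(y in box 1) (Kconst *
    (hessian_part G x y + hessian_part Gs (swap x) (swap y) + lattice_sum y / 2 * sdiff G x y)).
  move=> x1; have [_ _ ->] := Lambda_pv cg x1.
  apply: eq_Rintegral => y /set_mem y1; rewrite -Gsw -kernel_split.
  rewrite /sdiff (Gg _ (box_le (isT : (1 <= 2)%N) x1)) (Gg _ (boxD x1 y1)).
  by rewrite (Gg _ (boxD x1 ((boxN 1 y).2 y1))).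
have -> : \int[@leb2 R]_(x in box 1) Lambda g x = \int[(sleb2 \x sleb2)%E]_(z in box 1 `*` box 1)
   (Kconst * (hessian_part G z.1 z.2 + hessian_part Gs (swap z.1) (swap z.2) + lattice_sum z.2 / 2 * sdiff G z.1 z.2)).
  by rewrite [RHS]ex; apply: eq_Rintegral => x /set_mem; exact: LE.
split.
  apply: eq_integrable ix => // x /set_mem x1.
  by rewrite /= LE.
have r1 := RintegralZl Kconst mBB i123.
have r2 := RintegralD mBB i12 i3.
have r3 := RintegralD mBB i1 i2'.
rewrite [X in `|X + _|]r1 [X in Kconst * X]r2 [X in Kconst * (X + _)]r3.
have {}e2' : \int[(sleb2 \x sleb2)%E]_(z in box 1 `*` box 1) hessian_part Gs z.1 z.2 =
    \int[(sleb2 \x sleb2)%E]_(z in box 1 `*` box 1) hessian_part Gs (swap z.1) (swap z.2).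
  by rewrite /Rintegral; congr fine; exact: e2'.
have q2 : \int[sleb2]_(x in box 2) `|(g \o @swap R R) x| = \int[sleb2]_(x in box 2) `|g x|.
  apply: (@Rintegral_swap_box _ (fun x => `|g x|)); apply: measurableT_comp => //.
  exact: within_measurable (Ck_continuous cg).
have q3 : \int[sleb2]_(x in box 2) `|G x| = \int[sleb2]_(x in box 2) `|g x|.
  by apply: eq_Rintegral => x /set_mem x2; rewrite Gg.
rewrite q2 in l2; rewrite q3 -[X in `|X|]e3 in l3.
rewrite -[X in Kconst * (_ + X + _)]e2' /boundary_integral -/G -/Gs.
set Q := \int[sleb2]_(x in box 2) `|g x| in l1 l2 l3 *.
set H1 := (X in `|X + _| <= _) in l1.
set H2 := (X in `|X + _| <= _) in l2.
set S := (X in `|X| <= _) in l3.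
set s1 := _ - _ in l1; set s2 := _ - _ in l2.
rewrite (_ : Kconst * (H1 + H2 + S) + Kconst * (s1 + s2) =
  Kconst * ((H1 + s1) + (H2 + s2) + S)); last by ring.
rewrite normrM (ger0_norm Kconst_ge0) /average_bound -mulrA.
rewrite ler_wpM2l ?Kconst_ge0//.
rewrite (_ : (2 * edge_bound + 4 * 18 * fine (sleb2 (box 1))) * Q =
  edge_bound * Q + edge_bound * Q + 4 * 18 * Q * fine (sleb2 (box 1))); last by ring.
exact: (normD3_le l1 l2 l3).
Qed.

End Lambda_average.

(** * The boundary integral as a principal value *)

Section boundary_principal_values.
Context {R : realType}.
Notation mu := (@lebesgue_measure R).
Notation plane := (measurableTypeR R * measurableTypeR R)%type.
Notation leb2 := (@leb2 R).
Notation sleb2 := (@sleb2 R).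
Notation I := (`[- pi, pi]%classic : set (measurableTypeR R)).
Implicit Types (x y nu : R * R) (f g phi : R * R -> R).

Lemma dotN y nu : dot (- y) nu = - dot y nu.
Proof. by rewrite /dot /=; ring. Qed.

(** Symmetrisation leaves the odd difference of [g], which is Lipschitz, against
a kernel of degree -2. *)
Lemma pv_odd_kernel g nu x : Ck 1 (box 2) g -> box 1 x ->
  (forall y, `|dot y nu| <= enorm y) ->
  leb2.-integrable (box 1)
    (EFin \o (fun y : plane => dot y nu * rho y ^+ 3 * odiff g x y)) /\
  pv_int (box 1) (fun y => dot y nu * g (x + y) / enorm y ^+ 3) =
    \int[leb2]_(y in box 1) (dot y nu * rho y ^+ 3 * odiff g x y).
Proof.
move=> cg x1 dle.
pose F y := dot y nu * g (x + y) / enorm y ^+ 3.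
have symE y : sym F y = dot y nu * rho y ^+ 3 * odiff g x y.
  by rewrite /sym /F /odiff enormN dotN -!exprVn -/(rho y); field.
have [M M0 oM] := odiff_le cg; have [C C0 gC] := Ck_bound cg.
have mB := @measurable_box R 1.
have mF : measurable_fun (box 1 : set plane) F.
  apply: measurable_funM; last first.
    apply: measurable_funTS.
    by under eq_fun do rewrite -exprVn; apply: measurable_funX; exact: measurable_inv_enorm.
  apply: measurable_funM.
    apply: measurable_funTS; rewrite /dot; by apply: measurable_funD; apply: measurable_funM.
  apply: within_measurable_shift (Ck_continuous cg) _ => y; exact: (@boxD _ 1 1).
have iF e : 0 < e -> leb2.-integrable (box 1 `&` [set y | e < enorm y]) (EFin \o F).
  move=> e0; have mT := truncated_set_measurable e.
  apply: (@integrable_bounded _ _ _ leb2 _ _ (C * e^-1 ^+ 2)) => //.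
  - by apply: le_lt_trans (@measure_box_lty R 1); apply: le_measure; rewrite ?inE//; exact: subIsetl.
  - by apply: measurable_funS mF => //; exact: subIsetl.
  - move=> y [y1 /= ey].
    have re : rho y <= e^-1 by rewrite lef_pV2 ?posrE ?ltW// (lt_trans e0).
    have dr : `|dot y nu| * rho y <= 1.
      by apply: le_trans (enorm_rho y); rewrite ler_wpM2r ?rho_ge0.
    rewrite /F -exprVn -/(rho y) 2!normrM normrX (ger0_norm (rho_ge0 y)).
    rewrite (_ : _ * _ * _ = (`|dot y nu| * rho y) * `|g (x + y)| * rho y ^+ 2); last by ring.
    rewrite ler_pM ?mulr_ge0 ?exprn_ge0 ?rho_ge0//.
      by rewrite -[leRHS]mul1r ler_pM ?mulr_ge0 ?rho_ge0// gC//; exact: (@boxD _ 1 1).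
    have e0' := ltW e0.
    by rewrite lerXn2r// nnegrE ?rho_ge0// invr_ge0.
have bF y : box 1 y -> `|sym F y| <= M * (enorm y)^-1.
  move=> y1; rewrite symE -/(rho y).
  have h := oM x y x1 y1.
  have r0 := rho_ge0 y.
  have dr : `|dot y nu| * rho y <= 1.
    by apply: le_trans (enorm_rho y); rewrite ler_wpM2r.
  have orM : `|odiff g x y| * rho y <= M.
    apply: le_trans (ler_wpM2r r0 h) _.
    by rewrite -mulrA -[leRHS]mulr1 ler_wpM2l// enorm_rho.
  rewrite 2!normrM normrX (ger0_norm r0).
  rewrite (_ : _ * _ * _ = (`|dot y nu| * rho y) * (`|odiff g x y| * rho y) * rho y); last by ring.
  by rewrite ler_wpM2r// -[leRHS]mul1r ler_pM ?mulr_ge0.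
have [i1 _ e1] := pv_symmetrise mF iF bF.
split; first by apply: eq_integrable i1 => // y _; rewrite /= symE.
by rewrite e1; apply: eq_Rintegral => y _; rewrite symE.
Qed.

Lemma integrable_side g c : Ck 1 (box 2) g -> `|c| = pi ->
  mu.-integrable I (fun t => (\int[sleb2]_(y in box 1) side_term (g \o clamp 2) c t y)%:E).
Proof.
move=> cg cpi; have [M M0 oM] := odiff_le cg.
have bp x y : box 1 x -> box 1 y -> box 2 (x + y) by exact: (@boxD _ 1 1).
have bm x y : box 1 x -> box 1 y -> box 2 (x - y) by move=> x1 /(boxN 1); exact: (@boxD _ 1 1).
have oM' x y : box 1 x -> box 1 y -> `|odiff (g \o clamp 2) x y| <= M * enorm y.
  move=> x1 y1; rewrite /odiff /= (clamp_id (bp _ _ x1 y1)) (clamp_id (bm _ _ x1 y1)).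
  exact: oM.
have i := integrable_side_term (Ck_clamp cg) M0 oM' cpi.
have mI : measurable I by exact: measurable_itv.
by have [h _] := fubini_Rintegral1 mI (measurable_box 1) i.
Qed.

Lemma side_clamp g c (t : R) y : `|c| = pi -> I t -> box 1 y ->
  side_term (g \o clamp 2) c t y = side_term g c t y.
Proof.
move=> cpi tI y1; have s1 := side_box cpi tI.
have bp : box 2 ((c, t) + y) by exact: (@boxD _ 1 1).
have bm : box 2 ((c, t) - y) by apply: (@boxD _ 1 1) => //; exact/boxN.
by rewrite /side_term /odiff /= (clamp_id bp) (clamp_id bm).
Qed.

Lemma int_bdryE g : Ck 1 (box 2) g ->
  int_bdry (fun x nu => pv_int (box 1) (fun y => dot y nu * g (x + y) / enorm y ^+ 3)) =
  boundary_integral g.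
Proof.
move=> cg; have cgs := Ck_swap cg.
have npi : `|pi : R| = pi by rewrite gtr0_norm ?pi_gt0.
have nNpi : `|- pi : R| = pi by rewrite normrN.
have d1 y : `|dot y e1| <= enorm y by rewrite /dot /= mulr1 mulr0 addr0 le_norm1_enorm.
have d1' y : `|dot y (- e1)| <= enorm y by rewrite /dot /= oppr0 mulrN1 mulr0 addr0 normrN le_norm1_enorm.
have d2 y : `|dot y e2| <= enorm y by rewrite /dot /= mulr1 mulr0 add0r le_norm2_enorm.
have d2' y : `|dot y (- e2)| <= enorm y by rewrite /dot /= oppr0 mulrN1 mulr0 add0r normrN le_norm2_enorm.
have P1 c (t : R) : `|c| = pi -> I t ->
    pv_int (box 1) (fun y => dot y e1 * g ((c, t) + y) / enorm y ^+ 3) =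
    \int[sleb2]_(y in box 1) side_term (g \o clamp 2) c t y.
  move=> cpi tI; have [_ ->] := pv_odd_kernel cg (side_box cpi tI) d1.
  apply: eq_Rintegral => y /set_mem y1; rewrite side_clamp//.
  by rewrite /side_term /dot /= mulr1 mulr0 addr0.
have P1' c (t : R) : `|c| = pi -> I t ->
    pv_int (box 1) (fun y => dot y (- e1) * g ((c, t) + y) / enorm y ^+ 3) =
    - 1 * \int[sleb2]_(y in box 1) side_term (g \o clamp 2) c t y.
  move=> cpi tI; have [_ ->] := pv_odd_kernel cg (side_box cpi tI) d1'.
  rewrite -P1//; have [i ->] := pv_odd_kernel cg (side_box cpi tI) d1.
  rewrite -(RintegralZl (- 1) (measurable_box 1) i).
  by apply: eq_Rintegral => y _; rewrite /dot /= ; ring.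
have msw c (t : R) : `|c| = pi -> I t -> measurable_fun (box 1 : set plane) (fun y : plane => side_term (g \o @swap R R) c t y).
  move=> cpi tI; have [i _] := pv_odd_kernel cgs (side_box cpi tI) d1.
  have := (measurable_EFinP _ _).1 (measurable_int _ i).
  by apply: eq_measurable_fun => y _; rewrite /side_term /dot /= mulr1 mulr0 addr0.
have P2 c (t : R) : `|c| = pi -> I t ->
    \int[sleb2]_(y in box 1) (y.2 * rho y ^+ 3 * odiff g (t, c) y) =
    \int[sleb2]_(y in box 1) side_term ((g \o @swap R R) \o clamp 2) c t y.
  move=> cpi tI.
  have -> : \int[sleb2]_(y in box 1) side_term ((g \o @swap R R) \o clamp 2) c t y = \int[sleb2]_(y in box 1) side_term (g \o @swap R R) c t y.
    by apply: eq_Rintegral => y /set_mem y1; rewrite side_clamp.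
  rewrite -(Rintegral_swap_box (msw c t cpi tI)).
  apply: eq_Rintegral => y _; rewrite /side_term /odiff /= rho_swap !(swapD, swapB).
  by rewrite (_ : swap (swap y) = y)//; case: y.
have s2 c (t : R) : `|c| = pi -> I t -> box 1 (t, c) by move=> cpi tI; apply/box_swap; exact: side_box.
have P2' c (t : R) : `|c| = pi -> I t ->
    pv_int (box 1) (fun y => dot y e2 * g ((t, c) + y) / enorm y ^+ 3) =
    \int[sleb2]_(y in box 1) side_term ((g \o @swap R R) \o clamp 2) c t y.
  move=> cpi tI; rewrite -P2//; have [_ ->] := pv_odd_kernel cg (s2 _ _ cpi tI) d2.
  by apply: eq_Rintegral => y _; rewrite /dot /= mulr1 mulr0 add0r.
have P2'' c (t : R) : `|c| = pi -> I t ->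
    pv_int (box 1) (fun y => dot y (- e2) * g ((t, c) + y) / enorm y ^+ 3) =
    - 1 * \int[sleb2]_(y in box 1) side_term ((g \o @swap R R) \o clamp 2) c t y.
  move=> cpi tI; have [_ ->] := pv_odd_kernel cg (s2 _ _ cpi tI) d2'.
  rewrite -P2'//; have [i ->] := pv_odd_kernel cg (s2 _ _ cpi tI) d2.
  rewrite -(RintegralZl (- 1) (measurable_box 1) i).
  by apply: eq_Rintegral => y _; rewrite /dot /= ; ring.
have mI : measurable I by exact: measurable_itv.
have z1 := RintegralZl (- 1) mI (integrable_side cg nNpi).
have z2 := RintegralZl (- 1) mI (integrable_side cgs nNpi).
have E1 (f : R -> R) (h : R -> R) : (forall t, I t -> f t = h t) -> \int[mu]_(t in I) f t = \int[mu]_(t in I) h t.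
  by move=> fh; apply: eq_Rintegral => t /set_mem; exact: fh.
pose Gs := (g \o @swap R R) \o clamp 2.
have w1 : \int[mu]_(t in I) pv_int (box 1) (fun y => dot y e1 * g ((pi, t) + y) / enorm y ^+ 3) = side_integral (g \o clamp 2) pi.
  exact: E1 (fun t => P1 pi t npi).
have w2 : \int[mu]_(t in I) pv_int (box 1) (fun y => dot y (- e1) * g ((- pi, t) + y) / enorm y ^+ 3) = - side_integral (g \o clamp 2) (- pi).
  by apply: etrans (E1 _ _ (fun t => P1' (- pi) t nNpi)) _; apply: etrans z1 _; exact: mulN1r.
have w3 : \int[mu]_(t in I) pv_int (box 1) (fun y => dot y e2 * g ((t, pi) + y) / enorm y ^+ 3) = side_integral Gs pi.
  exact: E1 (fun t => P2' pi t npi).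
have w4 : \int[mu]_(t in I) pv_int (box 1) (fun y => dot y (- e2) * g ((t, - pi) + y) / enorm y ^+ 3) = - side_integral Gs (- pi).
  by apply: etrans (E1 _ _ (fun t => P2'' (- pi) t nNpi)) _; apply: etrans z2 _; exact: mulN1r.
by rewrite /int_bdry w1 w2 w3 w4 /boundary_integral -addrA.
Qed.

End boundary_principal_values.

(** * Square norms and the quadratic functional *)

Section integral_monotone.
Context {d} {T : measurableType d} {R : realType}.
Variable m : {measure set T -> \bar R}.

(** The integral of a nonnegative function is a supremum over the simple
functions below it, so that monotonicity holds for arbitrary functions. *)
Lemma le_integral_unmeasured (f g : T -> \bar R) : (forall x, (0 <= f x)%E) ->
  (forall x, (f x <= g x)%E) -> (\int[m]_x f x <= \int[m]_x g x)%E.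
Proof.
move=> f0 fg; have g0 x : (0 <= g x)%E by exact: le_trans (fg x).
rewrite !ge0_integralTE//; apply: le_ereal_sup => _ [h hf <-].
by exists h => // x; exact: le_trans (hf x) (fg x).
Qed.

End integral_monotone.

Section square_norms.
Context {R : realType}.
Notation leb2 := (@leb2 R).
Notation plane := (measurableTypeR R * measurableTypeR R)%type.
Implicit Types (x y : R * R) (f g : R * R -> R) (X : set (R * R)).

Lemma expe2_poweR (x : \bar R) : (0 <= x -> x ^+ 2 = x `^ 2%R)%E.
Proof.
case: x => [r||//]; last by rewrite poweRyr.
by rewrite lee_fin => r0; rewrite -EFin_expe poweR_EFin powR_mulrn.
Qed.

Lemma sqrt_expe2 (x : \bar R) : (0 <= x -> (x ^+ 2) `^ (2^-1)%R = x)%E.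
Proof. by move=> x0; rewrite expe2_poweR// -poweRrM mulfV// poweRe1. Qed.

Lemma Lpnorm2_sqr X f :
  (Lpnorm 2%:E X f ^+ 2 = \int[leb2]_(x in X) (f x ^+ 2)%:E)%E.
Proof.
rewrite expe2_poweR; last exact: Lnorm_ge0.
rewrite /Lpnorm poweR_Lnorm// [RHS]integral_mkcond; apply: eq_integral => x _ /=.
rewrite /patch/=; case: ifPn => _ /=.
  by rewrite powR_mulrn// real_normK ?num_real.
by rewrite normr0 powR0.
Qed.

Lemma Lpnorm2_le X (Y : set (R * R)) f g : (forall x, X x -> Y x /\ `|f x| <= `|g x|) ->
  (Lpnorm 2%:E X f <= Lpnorm 2%:E Y g)%E.
Proof.
move=> fg.
have N0 (Z : set (R * R)) (h : R * R -> R) : (0 <= Lpnorm 2%:E Z h)%E by exact: Lnorm_ge0.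
rewrite -(sqrt_expe2 (N0 X f)) -(sqrt_expe2 (N0 Y g)).
have S0 (Z : set (R * R)) (h : R * R -> R) : (0 <= Lpnorm 2%:E Z h ^+ 2)%E by exact: expe_ge0.
suff le : (Lpnorm 2%:E X f ^+ 2 <= Lpnorm 2%:E Y g ^+ 2)%E.
  by apply: gt0_ler_poweR le; rewrite ?in_itv/= ?leey ?andbT ?S0 ?invr_ge0.
rewrite !Lpnorm2_sqr integral_mkcond [leRHS]integral_mkcond.
apply: le_integral_unmeasured => x; rewrite /patch.
  by case: ifP => // _; rewrite lee_fin sqr_ge0.
case: ifPn => [/set_mem /fg[Yx le]|_].
  by rewrite mem_set// lee_fin -real_normK ?num_real// -[leRHS]real_normK ?num_real// lerXn2r ?nnegrE.
by case: ifP => // _; rewrite lee_fin sqr_ge0.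
Qed.

Lemma H1norm_ge X f h : [\/ h = f, h = rderive X e1 f | h = rderive X e2 f] ->
  (Lpnorm 2%:E X h <= H1norm X f)%E.
Proof.
move=> hE.
have S0 k : (0 <= Lpnorm 2%:E X k ^+ 2)%E by apply: expe_ge0; exact: Lnorm_ge0.
have N0 : (0 <= Lpnorm 2%:E X h)%E by exact: Lnorm_ge0.
rewrite -(sqrt_expe2 N0) /H1norm.
have le : (Lpnorm 2%:E X h ^+ 2 <= Lpnorm 2%:E X f ^+ 2 +
    Lpnorm 2%:E X (rderive X e1 f) ^+ 2 + Lpnorm 2%:E X (rderive X e2 f) ^+ 2)%E.
  by case: hE => ->; [rewrite -addeA leeDl ?adde_ge0|rewrite -addeA addeCA leeDl ?adde_ge0|rewrite leeDr ?adde_ge0].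
by apply: gt0_ler_poweR le; rewrite ?in_itv/= ?leey ?andbT ?S0 ?invr_ge0// ?adde_ge0 ?S0.
Qed.

End square_norms.

Section quadratic_functional.
Context {R : realType}.
Notation leb2 := (@leb2 R).
Notation sleb2 := (@sleb2 R).
Notation plane := (measurableTypeR R * measurableTypeR R)%type.
Implicit Types (x y : R * R) (f g phi : R * R -> R).

Definition sqr_fun phi x : R := phi x ^+ 2.

(** Defined through the values of [Lambda] on the fundamental box, it depends on
the values of [phi] on the double box only. *)
Definition quad_functional phi : R :=
  2^-1 * \int[leb2]_(x in box 1) Lambda (sqr_fun phi) x.

Lemma Ck_sqr k n phi : Ck k (box n.+1) phi -> Ck k (box n.+1) (sqr_fun phi).
Proof. by move=> cp; apply: eq_Ck (CkM cp cp) => x _; rewrite /sqr_fun expr2. Qed.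

Lemma eq_quad_functional f g : (forall x, box 5 x -> f x = g x) ->
  quad_functional f = quad_functional g.
Proof.
move=> fg; rewrite /quad_functional.
have e x : x \in box 1 -> Lambda (sqr_fun f) x = Lambda (sqr_fun g) x.
  move=> /set_mem x1; apply: (@eq_Lambda _ 1 _ _ _ _ x1) => z z2.
  by rewrite /sqr_fun fg//; apply: box_le z2.
by rewrite (eq_Rintegral leb2 e).
Qed.

(** The difference of the two sides is half of the sum of the squares of
[phi x - phi (x + y)] and [phi x - phi (x - y)]. *)
Lemma sdiff_sqr_le phi x y :
  sdiff (sqr_fun phi) x y / 2 <= phi x * sdiff phi x y.
Proof.
rewrite -subr_ge0 /sdiff /sqr_fun.
rewrite (_ : _ - _ = ((phi x - phi (x + y)) ^+ 2 + (phi x - phi (x - y)) ^+ 2) / 2).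
  by rewrite divr_ge0// addr_ge0 ?sqr_ge0.
by field.
Qed.

Lemma Lambda_sqr_le phi x : Ck 2 (box 2) phi -> box 1 x ->
  2^-1 * Lambda (sqr_fun phi) x <= phi x * Lambda phi x.
Proof.
move=> cp x1; have mB := @measurable_box R 1.
have [i1 _ ->] := Lambda_pv (Ck_sqr cp) x1; have [i2 _ ->] := Lambda_pv cp x1.
rewrite -(RintegralZl 2^-1 mB i1) -(RintegralZl (phi x) mB i2).
apply: (le_Rintegral mB); [exact: integrable_EFinZ|exact: integrable_EFinZ|].
move=> y _ /=.
rewrite (_ : 2^-1 * _ = sdiff (sqr_fun phi) x y / 2 * (K y / 2)); last by ring.
rewrite (_ : phi x * _ = phi x * sdiff phi x y * (K y / 2)); last by ring.
by apply: ler_wpM2r; [rewrite divr_ge0 ?K_ge0|exact: sdiff_sqr_le].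
Qed.

Lemma quad_le_inner phi : Ck 2 (box 2) phi ->
  quad_functional phi <= inner (box 1) phi (Lambda phi).
Proof.
move=> cp; have mB := @measurable_box R 1.
have [iL _] := Lambda_average cp; have [iL2 _] := Lambda_average (Ck_sqr cp).
have [C C0 pC] := Ck_bound cp.
rewrite /quad_functional /inner -(RintegralZl 2^-1 mB iL2).
apply: (le_Rintegral mB); first exact: integrable_EFinZ.
- apply: (integrable_dom mB (g := fun x => C * `|Lambda phi x|)).
  + apply: measurable_funM; last exact: (measurable_EFinP _ _).1 (measurable_int _ iL).
    apply: measurable_funS (@measurable_box R 2) _ (within_measurable (Ck_continuous cp)).
    by move=> x; exact: box_le.
  + by apply: integrable_EFinZ => //; exact: integrable_norm iL.
  + by move=> x x1; rewrite normrM ler_wpM2r// pC//; exact: box_le x1.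
- by move=> x x1; exact: Lambda_sqr_le.
Qed.

Lemma quad_abs_le phi : Ck 2 (box 2) phi ->
  `|quad_functional phi| <=
  @average_bound R * (\int[sleb2]_(x in box 2) `|sqr_fun phi x|) +
  Kconst * `|boundary_integral (sqr_fun phi)|.
Proof.
move=> cp; have [_ le] := Lambda_average (Ck_sqr cp).
rewrite /quad_functional; set L := \int[leb2]_(x in _) _ in le *.
set B := boundary_integral _ in le *.
have K0 := @Kconst_ge0 R.
rewrite normrM (ger0_norm (_ : 0 <= 2^-1)) ?invr_ge0//.
apply: (@le_trans _ _ `|L|); first by rewrite ler_piMl// invf_le1// ler1n.
rewrite -[L](addrK (Kconst * B)) (le_trans (ler_normB _ _))// lerD// normrM.
by rewrite (ger0_norm K0).
Qed.

Lemma box2_sqr_le phi : Ck 2 (box 2) phi ->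
  ((\int[sleb2]_(x in box 2) `|sqr_fun phi x|)%:E <= Lpnorm 2%:E (box 5) phi ^+ 2)%E.
Proof.
move=> cp; have mB := @measurable_box R 2.
have [C C0 pC] := Ck_bound (Ck_sqr cp).
have i : sleb2.-integrable (box 2) (EFin \o sqr_fun phi).
  apply: (@integrable_bounded _ _ _ sleb2 _ _ C) => //.
  - exact: measure_box_lty.
  - exact: within_measurable (Ck_continuous (Ck_sqr cp)).
rewrite /Rintegral fineK; last exact: (integrable_fin_num mB (integrable_norm i)).
have -> : (\int[sleb2]_(x in box 2) (`|sqr_fun phi x|)%:E = Lpnorm 2%:E (box 2) phi ^+ 2)%E.
  rewrite Lpnorm2_sqr; apply: eq_integral => x _.
  by rewrite ger0_norm// /sqr_fun sqr_ge0.
rewrite !expe2 lee_pmul ?Lnorm_ge0//.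
all: by apply: Lpnorm2_le => x x2; split => //; exact: box_le x2.
Qed.

End quadratic_functional.

(** * A weighted square bound on a strip *)

Section weighted_square_bound.
Context {R : realType}.
Notation mu := (@lebesgue_measure R).
Notation plane := (measurableTypeR R * measurableTypeR R)%type.
Notation leb2 := (@leb2 R).
Notation sleb2 := (@sleb2 R).
Notation I := (`[- pi, pi]%classic : set (measurableTypeR R)).
Notation I2 := (`[- (2 * pi), 2 * pi]%classic : set (measurableTypeR R)).
Implicit Types (x y : R * R) (q : R * R -> R).

(** The interval without its centre, where the power weights are singular, and
without its ends, whose translates by [- pi] lie on the border of the strip. *)
Definition core : set (measurableTypeR R) := ((I `\ (- pi)) `\ pi) `\ 0.

Lemma measurable_core : measurable core.
Proof.
have m1 (a : R) : measurable ([set a] : set (measurableTypeR R)) by exact: measurable_set1.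
do 3 (apply: measurableD; last exact: m1).
exact: measurable_itv.
Qed.

Lemma coreP (s : R) : core s -> `|s| < pi /\ s != 0.
Proof.
move=> [[[]]]; rewrite /= in_itv/= => /andP[s1 s2] /eqP n1 /eqP n2 /eqP n3; split=> //.
by rewrite ltr_norml !lt_neqAle s1 s2 n2 eq_sym n1.
Qed.

Lemma integral_core (h : R -> \bar R) : measurable_fun I h ->
  (\int[mu]_(s in core) h s = \int[mu]_(s in I) h s)%E.
Proof.
move=> mh; have m1 (a : R) : measurable ([set a] : set (measurableTypeR R)) by exact: measurable_set1.
have mI : measurable I by exact: measurable_itv.
have mh' (D : set (measurableTypeR R)) : measurable D -> D `<=` I -> measurable_fun D h.
  by move=> mD DI; exact: measurable_funS mI DI mh.
have mD1 := measurableD mI (m1 (- pi)); have mD2 := measurableD mD1 (m1 pi).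
have mD3 := measurableD mD2 (m1 0).
by rewrite /core !integral_setD1//; apply: mh' => //; do ?[exact: measurableD]; move=> s; do ?case.
Qed.

Lemma measurable_absw (p : R) (D : set (measurableTypeR R)) :
  measurable_fun D (fun s : measurableTypeR R => `|s| `^ p).
Proof.
apply: measurable_funTS.
by apply: (measurableT_comp (@measurable_powR R _)); exact: normr_measurable.
Qed.

Lemma weight_integral (p : R) : 0 < p < 1 ->
  exists2 J : R, 0 <= J & (\int[mu]_(s in core) (`|s| `^ (- p))%:E = J%:E)%E.
Proof.
move=> p01.
have fin : (\int[mu]_(s in core) (`|s| `^ (- p))%:E < +oo)%E.
  apply: le_lt_trans (integral_powR_abs p01); apply: ge0_subset_integral.
  - exact: measurable_core.
  - exact: measurable_punctured.
  - by apply/measurable_EFinP; exact: measurable_absw.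
  - by move=> s _; rewrite lee_fin powR_ge0.
  - by move=> s [[[sI _] _] s0]; split.
have ge0 : (0 <= \int[mu]_(s in core) (`|s| `^ (- p))%:E)%E.
  by apply: integral_ge0 => s _; rewrite lee_fin powR_ge0.
exists (fine (\int[mu]_(s in core) (`|s| `^ (- p))%:E)%E); first exact: fine_ge0.
by rewrite fineK// ge0_fin_numE.
Qed.

Definition strip : set plane := `]- (2 * pi), 0[%classic `*` I2.

Variable q : R * R -> R.
Hypothesis cq : continuous q.

Definition strip_column (s : R) : \bar R :=
  \int[mu]_(t in I2) (q (- pi + s, t) ^+ 2)%:E.

Lemma measurable_comp_q {d} {T : measurableType d} (X : T -> plane) :
  measurable_fun setT X -> measurable_fun setT (fun a => q (X a)).
Proof. exact: (measurableT_comp (continuous_measurable_plane cq)). Qed.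

Let q2_ge0 z : (0 <= (q z ^+ 2)%:E)%E.
Proof. by rewrite lee_fin sqr_ge0. Qed.

Let mq2 {d} {T : measurableType d} (X : T -> plane) : measurable_fun setT X ->
  measurable_fun setT (fun a => (q (X a) ^+ 2)%:E).
Proof. by move=> mX; apply/measurable_EFinP; apply: measurable_funX; exact: measurable_comp_q. Qed.

Let mI2 : measurable I2. Proof. exact: measurable_itv. Qed.

Let mshift (a : R) : measurable_fun [set: measurableTypeR R] (fun s : measurableTypeR R => (a + s : measurableTypeR R)).
Proof. by apply: measurable_funD; [exact: measurable_cst|exact: measurable_id]. Qed.

Let row_integral (u : R) : \bar R := (\int[mu]_(t in I2) (q (u, t) ^+ 2)%:E)%E.

Let measurable_row : measurable_fun [set: measurableTypeR R] row_integral.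
Proof.
apply: (@measurable_tonelli_setX1 _ _ _ _ R mu _ _ measurableT mI2 (fun z : plane => (q z ^+ 2)%:E)) => //.
exact: measurable_funTS (mq2 (@measurable_id _ _ setT)).
Qed.

Lemma measurable_strip_column : measurable_fun [set: measurableTypeR R] strip_column.
Proof. exact: (measurableT_comp measurable_row (mshift (- pi))). Qed.

Lemma strip_column_ge0 s : (0 <= strip_column s)%E.
Proof. by apply: integral_ge0 => t _; exact: q2_ge0. Qed.

Lemma strip_column_total :
  (\int[mu]_(s in core) strip_column s <= \int[leb2]_(z in strip) (q z ^+ 2)%:E)%E.
Proof.
pose J : set (measurableTypeR R) := `]- (2 * pi), 0[%classic.
have mJ : measurable J by exact: measurable_itv.
have mq := measurable_funTS (mq2 (@measurable_id _ _ [set: plane])) : measurable_fun (J `*` I2) _.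
have [e _] := @tonelli_setX _ _ _ _ R mu mu _ _ mJ mI2 (fun z : plane => (q z ^+ 2)%:E) mq (fun z _ => q2_ge0 z).
rewrite [leRHS]e.
pose T (s : measurableTypeR R) : measurableTypeR R := - pi + s.
have t1 := integral_transfer (mshift (- pi)) (@lebesgue_measure_translate R (- pi)) mJ (measurable_funTS measurable_row).
rewrite [leRHS]t1; apply: ge0_subset_integral.
- exact: measurable_core.
- by rewrite -[_ @^-1` _]setTI; exact: (mshift (- pi)).
- exact: measurable_funTS measurable_strip_column.
- by move=> s _; exact: strip_column_ge0.
- move=> s /coreP[]; rewrite ltr_norml => /andP[s1 s2] _.
  by rewrite /J /= in_itv/=; apply/andP; split; lra.
Qed.

(** With [b = |s|^(-1/4)] and [c = |q|], the weight is at most [|t|^(-3/4) * b] and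
[2 b c <= l b^2 + c^2 / l] for every positive [l]. The weight in [s] becomes
[|s|^(-1/2)], still integrable, and the one in [t] no longer meets [q] after
integration in [a]. *)
Lemma side_column_le (s t l : R) : core s -> core t -> 0 < l ->
  (\int[mu]_(a in I) ((enorm (s, t))^-1 * `|q (- pi + s, a + t)|)%:E <=
   (`|t| `^ (- (1 - 4^-1)) / 2)%:E *
     ((l * (2 * pi) * `|s| `^ (- 2^-1))%:E + l^-1%:E * strip_column s))%E.
Proof.
move=> /coreP[s1 s0] /coreP[t1 t0] l0.
have mI : measurable I by exact: measurable_itv.
set w := `|t| `^ _; set v := `|s| `^ (- 2^-1).
have w0 : 0 <= w by exact: powR_ge0.
have v0 : 0 <= v by exact: powR_ge0.
have mX : measurable_fun [set: measurableTypeR R] (fun a : measurableTypeR R => (- pi + s, a + t) : plane).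
  apply: measurable_pairR; first exact: measurable_cst.
  by apply: measurable_funD; [exact: measurable_id|exact: measurable_cst].
have pt a : (enorm (s, t))^-1 * `|q (- pi + s, a + t)| <=
    w / 2 * (l * v + l^-1 * q (- pi + s, a + t) ^+ 2).
  have p4 : 0 < (4^-1 : R) < 1 by apply/andP; split; lra.
  have le := @inv_enorm_le _ 4^-1 (s, t) p4 s0 t0.
  set k := q _; rewrite -(real_normK (num_real k)).
  apply: le_trans (ler_wpM2r (normr_ge0 k) le) _ => /=.
  rewrite -/w (mulrC _ w) -mulrA -mulrA ler_wpM2l//.
  have -> : v = (`|s| `^ (- 4^-1)) ^+ 2.
    rewrite -powR_mulrn ?powR_ge0// -powRrM /v; congr (_ `^ _); lra.
  set b := _ `^ _; set c := `|k|.
  rewrite -subr_ge0 (_ : _ - _ = (l * b - c) ^+ 2 / (2 * l)); last by field; rewrite gt_eqF.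
  by rewrite divr_ge0 ?sqr_ge0// mulr_ge0// ltW.
apply: (@le_trans _ _ (\int[mu]_(a in I) (w / 2 * (l * v + l^-1 * q (- pi + s, a + t) ^+ 2))%:E)%E).
  apply: ge0_le_integral => //.
  - by move=> a _; rewrite lee_fin mulr_ge0// invr_ge0 enorm_ge0.
  - apply/measurable_EFinP; apply: measurable_funTS; apply: measurable_funM => //.
    by apply: measurableT_comp => //; exact: measurable_comp_q.
  - apply/measurable_EFinP; apply: measurable_funTS; apply: measurable_funM => //.
    apply: measurable_funD => //; apply: measurable_funM => //.
    by apply: measurable_funX; exact: measurable_comp_q.
  - by move=> a _; rewrite lee_fin.
have mk : measurable_fun I (fun a : measurableTypeR R => (q (- pi + s, a + t) ^+ 2)%:E).
  by apply: measurable_funTS; exact: mq2.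
have e1 : (\int[mu]_(a in I) (w / 2 * (l * v + l^-1 * q (- pi + s, a + t) ^+ 2))%:E =
    (w / 2)%:E * ((l * v)%:E * mu I + l^-1%:E * \int[mu]_(a in I) (q (- pi + s, a + t) ^+ 2)%:E))%E.
  have hl0 : 0 <= l^-1 by rewrite invr_ge0 ltW.
  have hlv : 0 <= l * v by apply: mulr_ge0 => //; exact: ltW.
  have h1 a : (0 <= l^-1%:E * (q (- pi + s, a + t) ^+ 2)%:E)%E.
    by apply: mule_ge0; [rewrite lee_fin|exact: q2_ge0].
  have h0 a : (0 <= (l * v)%:E + l^-1%:E * (q (- pi + s, a + t) ^+ 2)%:E)%E.
    by apply: adde_ge0; [rewrite lee_fin|exact: h1].
  under eq_integral do rewrite EFinM EFinD (EFinM l^-1).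
  rewrite ge0_integralZl_EFin//; last 2 first.
  - by apply: emeasurable_funD => //; apply: emeasurable_funM.
  - by rewrite divr_ge0.
  congr (_ * _)%E; rewrite ge0_integralD//.
  - by rewrite integral_cst// ge0_integralZl_EFin.
  - by apply: emeasurable_funM.
rewrite e1; apply: lee_wpmul2l; first by rewrite lee_fin divr_ge0.
apply: leeD.
  rewrite lebesgue_measure_itv/= lte_fin gtrN ?pi_gt0// -EFinB -EFinM lee_fin.
  by rewrite (_ : l * v * _ = l * (2 * pi) * v)//; ring.
apply: lee_wpmul2l; first by rewrite lee_fin invr_ge0 ltW.
pose J : set (measurableTypeR R) := `[t - pi, t + pi]%classic.
have mJ : measurable J by exact: measurable_itv.
have mrow : measurable_fun [set: measurableTypeR R] (fun u : measurableTypeR R => (q (- pi + s, u) ^+ 2)%:E).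
  by apply: mq2; apply: measurable_pairR => //; exact: measurable_cst.
have JE : (fun a : measurableTypeR R => (t + a : measurableTypeR R)) @^-1` J = I.
  by apply/seteqP; split=> a; rewrite /J /= !in_itv/= lerD2l => /andP[a1 a2]; apply/andP; split; lra.
have t2 := integral_transfer (mshift t) (@lebesgue_measure_translate R t) mJ (measurable_funTS mrow).
rewrite JE in t2.
rewrite (eq_integral (fun a : measurableTypeR R => (q (- pi + s, t + a) ^+ 2)%:E)); last first.
  by move=> a _; rewrite (addrC (a : R) t).
rewrite -[leLHS]t2; apply: ge0_subset_integral => //; first exact: measurable_funTS.
move=> a; rewrite /J /= !in_itv/= => /andP[a1 a2].
by move: t1; rewrite ltr_norml => /andP[b1 b2]; apply/andP; split; lra.
Qed.

Definition strip_bound : R := 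
  fine (\int[mu]_(t in core) (`|t| `^ (- (1 - 4^-1)))%:E)%E / 2 *
  (2 * pi * fine (\int[mu]_(s in core) (`|s| `^ (- 2^-1))%:E)%E + 1).

Lemma strip_bound_ge0 : 0 <= strip_bound.
Proof.
have h p : 0 <= fine (\int[mu]_(t in core) (`|t| `^ p)%:E)%E.
  by rewrite fine_ge0//; apply: integral_ge0 => t _; rewrite lee_fin powR_ge0.
by rewrite /strip_bound mulr_ge0 ?divr_ge0 ?addr_ge0 ?mulr_ge0 ?pi_ge0.
Qed.

(** The choice [l = n] balances the two terms of [side_column_le]. *)
Lemma side_average_le_pos (n : R) : 0 < n -> (Lpnorm 2%:E strip q <= n%:E)%E ->
  (\int[mu]_(s in I) \int[mu]_(t in I) \int[mu]_(a in I)
     ((enorm (s, t))^-1 * `|q (- pi + s, a + t)|)%:E <= (strip_bound * n)%:E)%E.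
Proof.
move=> n0 qn.
have mI : measurable I by exact: measurable_itv.
have p4 : 0 < (1 - 4^-1 : R) < 1 by apply/andP; split; lra.
have p2 : 0 < (2^-1 : R) < 1 by apply/andP; split; lra.
have [J4 J40 e4] := weight_integral p4; have [J2 J20 e2] := weight_integral p2.
pose f (z : plane * measurableTypeR R) : \bar R := ((enorm z.1)^-1 * `|q (- pi + z.1.1, z.2 + z.1.2)|)%:E.
have f0 z : (0 <= f z)%E by rewrite lee_fin mulr_ge0// invr_ge0 enorm_ge0.
have mf : measurable_fun [set: plane * measurableTypeR R] f.
  apply/measurable_EFinP; apply: measurable_funM.
    exact: (measurable_inv_enorm_comp measurable_fst).
  apply: measurableT_comp => //; apply: measurable_comp_q.
  have [m1 m2] := (measurable_fun_pairP _).1 (@measurable_fst _ _ (plane : measurableType _) (measurableTypeR R : measurableType _)).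
  apply: measurable_pairR; first by apply: measurable_funD => //; exact: measurable_cst.
  by apply: measurable_funD => //; exact: measurable_snd.
pose F (z : plane) : \bar R := (\int[mu]_(a in I) f (z, a))%E.
have F0 z : (0 <= F z)%E by apply: integral_ge0 => a _; exact: f0.
have mF : measurable_fun [set: plane] F.
  by apply: (@measurable_tonelli_setX1 _ _ _ _ R mu _ _ measurableT mI f) => //; exact: measurable_funTS.
have mFs s : measurable_fun [set: measurableTypeR R] (fun t : measurableTypeR R => F (s, t)).
  exact: (measurableT_comp mF (pair1_measurable s)).
have mFI (A : set (measurableTypeR R)) : measurable A ->
    measurable_fun [set: measurableTypeR R] (fun s : measurableTypeR R => (\int[mu]_(t in A) F (s, t))%E).
  move=> mA; apply: (@measurable_tonelli_setX1 _ _ _ _ R mu _ _ measurableT mA F) => //.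
  exact: measurable_funTS.
have mC := measurable_core.
rewrite -[leLHS](@integral_core (fun s => (\int[mu]_(t in I) F (s, t))%E)); last exact: measurable_funTS (mFI _ mI).
pose B (s : R) : \bar R := ((n * (2 * pi) * `|s| `^ (- 2^-1))%:E + n^-1%:E * strip_column s)%E.
have n2 : 0 <= n^-1 by rewrite invr_ge0 ltW.
have cs (s : R) : 0 <= n * (2 * pi) * `|s| `^ (- 2^-1).
  by rewrite mulr_ge0 ?powR_ge0// mulr_ge0 ?(ltW n0)// mulr_ge0// pi_ge0.
have B1 s : (0 <= n^-1%:E * strip_column s)%E by apply: mule_ge0; [rewrite lee_fin|exact: strip_column_ge0].
have B0 s : (0 <= B s)%E by apply: adde_ge0; [rewrite lee_fin|].
have mB1 : measurable_fun core (fun s : measurableTypeR R => (n * (2 * pi) * `|s| `^ (- 2^-1))%:E).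
  by apply/measurable_EFinP; apply: measurable_funM => //; exact: measurable_absw.
have mB2 : measurable_fun core (fun s : measurableTypeR R => (n^-1%:E * strip_column s)%E).
  by apply: emeasurable_funM => //; exact: measurable_funTS measurable_strip_column.
have mB : measurable_fun core B by exact: emeasurable_funD.
have mw : measurable_fun core (fun t : measurableTypeR R => (`|t| `^ (- (1 - 4^-1)) / 2)%:E).
  by apply/measurable_EFinP; apply: measurable_funM => //; exact: measurable_absw.
have w0 (t : R) : (0 <= (`|t| `^ (- (1 - 4^-1)) / 2)%:E)%E by rewrite lee_fin divr_ge0 ?powR_ge0.
have ew : (\int[mu]_(t in core) (`|t| `^ (- (1 - 4^-1)) / 2)%:E = (J4 / 2)%:E)%E.
  under eq_integral do rewrite EFinM.
  rewrite ge0_integralZr//.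
    by rewrite e4 -EFinM.
  by apply/measurable_EFinP; exact: measurable_absw.
(* The bound of [side_column_le] is a product of functions of [t] and of [s]. *)
apply: (@le_trans _ _ (\int[mu]_(s in core) ((J4 / 2)%:E * B s))%E).
  apply: ge0_le_integral => //.
  - by move=> s _; apply: integral_ge0.
  - exact: measurable_funTS (mFI _ mI).
  - exact: emeasurable_funM.
  - move=> s sC.
    rewrite -[leLHS](@integral_core (fun t => F (s, t))); last exact: measurable_funTS (mFs s).
    rewrite -ew -ge0_integralZr//.
    apply: ge0_le_integral => //.
    + exact: measurable_funTS (mFs s).
    + exact: emeasurable_funM.
    + by move=> t tC; exact: side_column_le.
rewrite ge0_integralZl_EFin//; last by rewrite divr_ge0.
have le2 : (\int[mu]_(s in core) B s <= (n * (2 * pi * J2 + 1))%:E)%E.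
  rewrite ge0_integralD//; last by move=> s _; rewrite lee_fin.
  have -> : n * (2 * pi * J2 + 1) = n * (2 * pi) * J2 + n * 1 by ring.
  rewrite EFinD; apply: leeD.
    under eq_integral do rewrite EFinM.
    rewrite ge0_integralZl_EFin//.
    - by rewrite e2 -EFinM.
    - by apply/measurable_EFinP; exact: measurable_absw.
    - by rewrite mulr_ge0 ?(ltW n0)// mulr_ge0// pi_ge0.
  rewrite ge0_integralZl_EFin//; last 2 first.
  - by move=> s _; exact: strip_column_ge0.
  - exact: measurable_funTS measurable_strip_column.
  have h2 : (\int[mu]_(s in core) strip_column s <= (n ^+ 2)%:E)%E.
    apply: le_trans strip_column_total _; rewrite -Lpnorm2_sqr.
    by rewrite EFin_expe !expe2 lee_pmul// Lnorm_ge0.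
  have nE : n * 1 = n^-1 * n ^+ 2 by field; rewrite gt_eqF.
  by rewrite nE EFinM lee_wpmul2l// lee_fin.
have J40' : (0 <= (J4 / 2)%:E)%E by rewrite lee_fin divr_ge0.
apply: le_trans (lee_wpmul2l J40' le2) _.
rewrite -EFinM lee_fin /strip_bound e4 e2 /= le_eqVlt; apply/orP; left; apply/eqP; ring.
Qed.

(** An upper bound [n] that is arbitrarily close to the norm avoids dividing by a
norm equal to zero. *)
Lemma side_average_le :
  (\int[mu]_(s in I) \int[mu]_(t in I) \int[mu]_(a in I)
     ((enorm (s, t))^-1 * `|q (- pi + s, a + t)|)%:E <=
   (strip_bound + 1)%:E * Lpnorm 2%:E strip q)%E.
Proof.
have sb0 := strip_bound_ge0; have sb1 : 0 < strip_bound + 1 by rewrite ltr_wpDl.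
have : (0 <= Lpnorm 2%:E strip q)%E by exact: Lnorm_ge0.
case E : (Lpnorm 2%:E strip q) => [N||//]; last first.
  by move=> _; rewrite gt0_muley ?lte_fin// leey.
rewrite lee_fin => N0; apply/lee_addgt0Pr => e e0.
(* An upper bound of the norm that costs at most [e] in the conclusion. *)
have n0 : 0 < N + e / (strip_bound + 1) by rewrite ltr_wpDl ?divr_gt0.
apply: le_trans (side_average_le_pos n0 _) _.
  by rewrite E lee_fin lerDl divr_ge0 ?ltW.
rewrite -EFinM -EFinD lee_fin.
rewrite (_ : (strip_bound + 1) * N + e = (strip_bound + 1) * (N + e / (strip_bound + 1))).
  by rewrite ler_wpM2r ?lerDl ?(ltW n0).
by field; rewrite gt_eqF.
Qed.

End weighted_square_bound.

(** * Opposite sides and jumps across a period *)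

Section periodic_jump.
Context {R : realType}.
Notation mu := (@lebesgue_measure R).
Notation plane := (measurableTypeR R * measurableTypeR R)%type.
Notation leb2 := (@leb2 R).
Notation sleb2 := (@sleb2 R).
Notation I := (`[- pi, pi]%classic : set (measurableTypeR R)).
Implicit Types (x y : R * R).
Variables (G G1 : R * R -> R) (M C1 : R).
Hypotheses (cG : continuous G) (cG1 : continuous G1) (M0 : 0 <= M) (C10 : 0 <= C1).
Hypothesis G1C : forall x, `|G1 x| <= C1.
Hypothesis dG : forall s t, `|s| < 2 * pi -> `|t| <= 2 * pi ->
  is_derive (s : R) 1 (fun s => G (s, t)) (G1 (s, t)).
Hypothesis odM : forall x y, box 1 x -> box 1 y -> `|odiff G x y| <= M * enorm y.

Let mI : measurable I. Proof. exact: measurable_itv. Qed.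
Let mB : measurable (box 1 : set plane). Proof. exact: measurable_box. Qed.

Definition jump (F : R * R -> R) x : R := F (x + (2 * pi, 0)) - F x.

(** Up to sign, the primitive in [y.1] of [y.1 * |y|^-3] vanishing on the vertical
sides of the box, namely [1 / |y| - 1 / |(pi, y.2)|]; the product form gives it the
value 0 at the origin, where [rho] is 0 by convention. *)
Definition potential y : R := rho y * (1 - enorm y * rho (pi, y.2)).

Lemma potential_bounds y : box 1 y -> 0 <= potential y <= rho y.
Proof.
move=> /boxP; rewrite !mul1r => -[y1 y2].
have pi0 := @pi_gt0 R; have r0 := rho_ge0 y.
have p0 : 0 < enorm (pi : R, y.2).
  by apply: lt_le_trans (le_norm1_enorm _); rewrite /= gtr0_norm.
have h0 : 0 <= enorm y * rho (pi, y.2) by rewrite mulr_ge0 ?enorm_ge0 ?rho_ge0.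
have h1 : enorm y * rho (pi, y.2) <= 1.
  rewrite ler_pdivrMr// mul1r ler_sqrt ?addr_ge0 ?sqr_ge0//= lerD2r.
  by rewrite -real_normK ?num_real// lerXn2r ?nnegrE// ltW.
rewrite /potential mulr_ge0 ?subr_ge0//= -[leRHS]mulr1 ler_wpM2l//.
by rewrite gerBl.
Qed.

Lemma potentialN y : potential (- y) = potential y.
Proof.
rewrite /potential rhoN enormN; congr (_ * (1 - _ * _)).
by rewrite /rho /enorm/= sqrrN.
Qed.

Lemma potential_line (s t : R) : t != 0 -> potential (s, t) = rho (s, t) - rho (pi, t).
Proof.
move=> t0; have e0 : enorm (s, t) != 0.
  by rewrite gt_eqF// enorm_gt0; apply: contraNneq t0 => -[_ ->].
by rewrite /potential /rho; field; rewrite e0 /=; rewrite gt_eqF// enorm_gt0; apply: contraNneq t0 => -[_ ->].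
Qed.

Lemma measurable_potential : measurable_fun [set: plane] (fun y : plane => potential y).
Proof.
apply: measurable_funM; first exact: measurable_inv_enorm.
apply: measurable_funB => //; apply: measurable_funM; first exact: measurable_enorm.
apply: measurable_inv_enorm_comp; apply: measurable_pairR => //.
Qed.

Lemma continuous_jump F : continuous F -> continuous (jump F).
Proof.
move=> cF x; apply: cvgB; last exact: cF.
apply: (@continuous_comp _ _ _ (fun z : R * R => z + (2 * pi, 0)) F x); last exact: cF.
by apply: cvgD; [exact: cvg_id|exact: cvg_cst].
Qed.

Lemma jump_le x : `|jump G1 x| <= 2 * C1.
Proof.
by rewrite (_ : 2 * C1 = C1 + C1); [rewrite (le_trans (ler_normB _ _))// lerD|ring].
Qed.

Lemma jump_odiff (t : R) y : odiff G (pi, t) y - odiff G (- pi, t) y = odiff (jump G) (- pi, t) y.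
Proof.
have e : ((- pi, t) : R * R) + (2 * pi, 0) = (pi, t).
  by rewrite /GRing.add/= /add_pair/= addr0; congr (_, _); rewrite -[LHS]/(- pi + 2 * pi); ring.
rewrite /odiff /jump (addrAC _ y) (addrAC _ (- y)) e; ring.
Qed.

Let p (t : R) : R * R := (- pi, t).
Let npi : `|pi : R| = pi. Proof. by rewrite gtr0_norm ?pi_gt0. Qed.
Let nNpi : `|- pi : R| = pi. Proof. by rewrite normrN. Qed.

Lemma odd_jump_le t y : I t -> box 1 y ->
  `|y.1 * rho y ^+ 3 * odiff (jump G) (p t) y| <= 2 * M * rho y.
Proof.
move=> tI y1; apply: odd_kernel_le; first by rewrite mulr_ge0.
rewrite -jump_odiff (_ : 2 * M * _ = M * enorm y + M * enorm y); last by ring.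
by rewrite (le_trans (ler_normB _ _))// lerD// odM//; exact: side_box.
Qed.

Lemma side_jump : side_integral G pi - side_integral G (- pi) =
  \int[mu]_(t in I) \int[sleb2]_(y in box 1) (y.1 * rho y ^+ 3 * odiff (jump G) (p t) y).
Proof.
have ip := integrable_side_term cG M0 odM npi.
have im := integrable_side_term cG M0 odM nNpi.
have mIB := measurableX mI mB.
rewrite -(side_integralE cG M0 odM npi) -(side_integralE cG M0 odM nNpi) -(RintegralB mIB ip im).
have [_ e] := fubini_Rintegral1 mI mB (integrable_EFinB mIB ip im).
rewrite [LHS]e; apply: eq_Rintegral => t _; apply: eq_Rintegral => y _ /=.
by rewrite /side_term -mulrBr jump_odiff.
Qed.

Lemma is_derive_jump (t s b : R) : `|t| <= pi -> `|b| <= pi -> `|s| < pi ->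
  is_derive s 1 (fun s => odiff (jump G) (p t) (s, b))
    ((jump G1 (p t + (s, b)) + jump G1 (p t - (s, b))) / 2).
Proof.
move=> t1 b1 s1.
have pi0 := @pi_gt0 R.
move: s1; rewrite ltr_norml => /andP[s1 s2].
have bt : `|t + b| <= 2 * pi by rewrite (le_trans (ler_normD _ _))// mulr_natl mulr2n lerD.
have bt' : `|t - b| <= 2 * pi by rewrite (le_trans (ler_normB _ _))// mulr_natl mulr2n lerD.
have dp (c b' : R) : `|c + s| < 2 * pi -> `|b'| <= 2 * pi ->
    is_derive s 1 (fun s => G (c + s, b')) (G1 (c + s, b')).
  by move=> cs b2; apply: (@is_derive_line_shift _ (fun s => G (s, b'))); exact: dG.
have dm (c b' : R) : `|c - s| < 2 * pi -> `|b'| <= 2 * pi ->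
    is_derive s 1 (fun s => G (c - s, b')) (- G1 (c - s, b')).
  by move=> cs b2; apply: (@is_derive_line_opp _ (fun s => G (s, b'))); exact: dG.
have b0 : `|t + b + 0| <= 2 * pi by rewrite addr0.
have b0' : `|t - b + 0| <= 2 * pi by rewrite addr0.
have q1 : `|pi + s| < 2 * pi by rewrite ltr_norml; apply/andP; split; lra.
have q2 : `|- pi + s| < 2 * pi by rewrite ltr_norml; apply/andP; split; lra.
have q3 : `|pi - s| < 2 * pi by rewrite ltr_norml; apply/andP; split; lra.
have q4 : `|- pi - s| < 2 * pi by rewrite ltr_norml; apply/andP; split; lra.
have d := is_derive_mulc 2^-1 (is_derive_sub
  (is_derive_sub (dp _ _ q1 b0) (dp _ _ q2 bt)) (is_derive_sub (dm _ _ q3 b0') (dm _ _ q4 bt'))).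
have e (u v : R) : ((- pi + u, v) : R * R) + (2 * pi, 0) = (pi + u, v + 0).
  by rewrite /GRing.add/= /add_pair/=; congr (_, _); rewrite -[LHS]/(- pi + u + 2 * pi) -[RHS]/(pi + u); ring.
have fE : (fun s : R => odiff (jump G) (p t) (s, b)) =
    (fun s => (G (pi + s, t + b + 0) - G (- pi + s, t + b) - (G (pi - s, t - b + 0) - G (- pi - s, t - b))) * 2^-1).
  by apply/funext => u; rewrite /odiff /jump -(e u (t + b)) -(e (- u) (t - b)).
rewrite fE; apply: is_derive_eq d _.
by rewrite /jump -(e s (t + b)) -(e (- s) (t - b)); ring.
Qed.

Let avg (t : R) y : R := (jump G1 (p t + y) + jump G1 (p t - y)) / 2.

Let mq {d} {T : measurableType d} (F : R * R -> R) (X : T -> plane) : continuous F ->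
  measurable_fun setT X -> measurable_fun setT (fun a => F (X a)).
Proof. by move=> /continuous_measurable_plane mF mX; exact: (measurableT_comp mF mX). Qed.

Let mp : measurable_fun [set: measurableTypeR R] (fun t : measurableTypeR R => p t : plane).
Proof. by apply: measurable_pairR => //; exact: measurable_cst. Qed.

Lemma potential_jump_le t y : box 1 y ->
  `|potential y * jump G1 (p t + y)| <= 2 * C1 * rho y.
Proof.
move=> y1; have /andP[W0 W1] := potential_bounds y1.
by rewrite normrM (ger0_norm W0) mulrC ler_pM ?jump_le.
Qed.

Lemma integrable_potential_jump t : sleb2.-integrable (box 1)
  (EFin \o (fun y : plane => potential y * jump G1 (p t + y))).
Proof.
apply: (@integrable_dom _ _ _ sleb2 _ mB _ (fun y : plane => 2 * C1 * (enorm y)^-1)).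
- apply: measurable_funTS; apply: measurable_funM; first exact: measurable_potential.
  by apply: (mq (continuous_jump cG1)); exact: measurable_plane_add.
- exact: integrable_EFinZ (@integrable_inv_enorm R).
- by move=> y y1; exact: potential_jump_le.
Qed.

Lemma Rintegral_opp_box (f : R * R -> R) : measurable_fun (box 1 : set plane) f ->
  \int[sleb2]_(x in box 1) f (- x) = \int[sleb2]_(x in box 1) f x.
Proof.
move=> mf; have mfE : measurable_fun (box 1 : set plane) (EFin \o f) by exact/measurable_EFinP.
have e := integral_transfer (@measurable_plane_opp R) (@leb2_opp R) mB mfE.
have bs : (fun x : R * R => - x) @^-1` box 1 = box 1 by apply/seteqP; split=> x /boxN.
by rewrite /Rintegral; congr fine; rewrite bs in e; rewrite [RHS]e.
Qed.

(** The integrand is the derivative of minus the product of the potential and the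
odd difference of the jump; the potential vanishes at both ends. *)
Lemma jump_line (t b : R) : I t -> `|b| <= pi -> b != 0 ->
  \int[mu]_(s in I) (s * rho (s, b) ^+ 3 * odiff (jump G) (p t) (s, b) -
    potential (s, b) * avg t (s, b)) = 0.
Proof.
rewrite /= in_itv/= -ler_norml => t1 b1 b0.
have cr : continuous (fun s : R => rho (s, b)) by exact: continuous_inv_enorm.
have cW : continuous (fun s : R => rho (s, b) - rho (pi, b)) := ctsB cr (@cts_cst _ _).
have co := @continuous_odiff_line _ (jump G) (p t) b (continuous_jump cG).
have [cp cm] := @continuous_line _ (jump G1) (p t) b (continuous_jump cG1).
pose u (s : R) : R := - ((rho (s, b) - rho (pi, b)) * odiff (jump G) (p t) (s, b)).
pose du (s : R) : R := s * rho (s, b) ^+ 3 * odiff (jump G) (p t) (s, b) -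
  (rho (s, b) - rho (pi, b)) * avg t (s, b).
have cu : continuous u := ctsN (ctsM cW co).
have cdu : continuous du.
  apply: ctsB; first exact: (ctsM (ctsM (@cts_id _) (@ctsX _ _ 3 cr)) co).
  exact: (ctsM cW (ctsM (ctsD cp cm) (@cts_cst _ _))).
have pi0 : - pi < pi :> R by rewrite gtrN ?pi_gt0.
have du_ (s : R) : - pi < s < pi -> is_derive s 1 u (du s).
  move=> s12; have s1 : `|s| < pi by rewrite ltr_norml.
  have d1 := is_derive_sub (is_derive_inv_enorm s b0) (is_derive_cst (rho (pi, b)) s 1).
  have d := is_derive_opp (is_derive_mul d1 (is_derive_jump t1 b1 s1)).
  by apply: is_derive_eq d _; rewrite /du /avg /rho /cst /=; ring.
have e : \int[mu]_(s in I) du s = 0.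
  apply: etrans (Rintegral_is_derive pi0 cu cdu du_) _.
  by rewrite /u; have -> : rho (- pi, b) = rho (pi, b); [rewrite /rho /enorm/= sqrrN|rewrite subrr !mul0r oppr0 subrr].
by rewrite -[RHS]e; apply: eq_Rintegral => s _; rewrite /du potential_line.
Qed.

(** [jump_line] on almost every horizontal line; the potential being even, the two
terms of the derivative of the odd difference have the same integral. *)
Lemma jump_by_parts t : I t ->
  \int[sleb2]_(y in box 1) (y.1 * rho y ^+ 3 * odiff (jump G) (p t) y) =
  \int[sleb2]_(y in box 1) (potential y * jump G1 (p t + y)).
Proof.
move=> tI.
have mct : measurable_fun [set: plane] (fun _ : plane => p t : plane) by exact: measurable_cst.
have mid := @measurable_id _ _ [set: plane].
have io : sleb2.-integrable (box 1)
    (EFin \o (fun y : plane => y.1 * rho y ^+ 3 * odiff (jump G) (p t) y)).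
  apply: (@integrable_dom _ _ _ sleb2 _ mB _ (fun y : plane => 2 * M * (enorm y)^-1)).
  - apply: measurable_funTS; apply: measurable_funM; first exact: (measurable_odd_kernel 3 mid).
    exact: (measurable_odiff (continuous_jump cG) mct mid).
  - exact: integrable_EFinZ (@integrable_inv_enorm R).
  - by move=> y y1; exact: odd_jump_le.
have i1 := integrable_potential_jump t.
have i2 : sleb2.-integrable (box 1) (EFin \o (fun y : plane => potential y * jump G1 (p t - y))).
  apply: (@integrable_dom _ _ _ sleb2 _ mB _ (fun y : plane => 2 * C1 * (enorm y)^-1)).
  - apply: measurable_funTS; apply: measurable_funM; first exact: measurable_potential.
    by apply: (mq (continuous_jump cG1)); exact: (measurable_subp mct mid).
  - exact: integrable_EFinZ (@integrable_inv_enorm R).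
  - move=> y y1; have /(potential_jump_le t) := (boxN 1 y).2 y1.
    by rewrite potentialN rhoN.
have ia := integrable_EFinZ mB 2^-1 (integrable_EFinD mB i1 i2).
have ea : \int[sleb2]_(y in box 1) (2^-1 * (potential y * jump G1 (p t + y) + potential y * jump G1 (p t - y))) =
    \int[sleb2]_(y in box 1) (potential y * jump G1 (p t + y)).
  have e1 := RintegralZl 2^-1 mB (integrable_EFinD mB i1 i2).
  have e2 := RintegralD mB i1 i2.
  have e3 := Rintegral_opp_box ((measurable_EFinP _ _).1 (measurable_int _ i1)).
  rewrite [LHS]e1 [X in _ * X]e2.
  have -> : \int[sleb2]_(y in box 1) (potential y * jump G1 (p t - y)) = \int[sleb2]_(y in box 1) (potential y * jump G1 (p t + y)).
    by rewrite -[RHS]e3; apply: eq_Rintegral => y _; rewrite potentialN.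
  by set Z := \int[_]_(_ in _) _; field.
rewrite -[RHS]ea; apply/eqP; rewrite -subr_eq0; apply/eqP.
have iD := integrable_EFinB mB io ia.
rewrite -[LHS](RintegralB mB io ia).
have iD' : (mu \x mu)%E.-integrable (I `*` I) (EFin \o (fun y : plane =>
   y.1 * rho y ^+ 3 * odiff (jump G) (p t) y -
   2^-1 * (potential y * jump G1 (p t + y) + potential y * jump G1 (p t - y)))).
  by rewrite -box1E; exact: iD.
have [ib e] := fubini_Rintegral2 mI mI iD'.
rewrite box1E; apply: etrans e _.
rewrite (_ : 0 = \int[mu]_(b in I) 0); last by rewrite Rintegral_cst// mul0r.
apply: Rintegral_punctured; [|exact: measurable_cst|].
  by apply/measurable_EFinP; exact: (measurable_int _ ib).
move=> b b0; rewrite in_itv/= -ler_norml => b1.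
rewrite -[RHS](jump_line tI b1 b0); apply: eq_Rintegral => s _ /=.
by rewrite /avg; ring.
Qed.

(** After the integration by parts the kernel is at most [1 / |y|], and absolute
values may be taken inside. *)
Lemma side_jump_le :
  (`|side_integral G pi - side_integral G (- pi)|%:E <=
   (strip_bound + 1)%:E * Lpnorm 2%:E strip (jump G1))%E.
Proof.
have cJ := continuous_jump cG1.
apply: le_trans (side_average_le cJ).
pose F (z : measurableTypeR R * plane) : R := potential z.2 * jump G1 (p z.1 + z.2).
have mX : measurable_fun [set: measurableTypeR R * plane] (fun z : measurableTypeR R * plane => p z.1 + z.2 : plane).
  by apply: measurable_addp; [exact: (measurableT_comp mp measurable_fst)|exact: measurable_snd].
have mJ : measurable_fun [set: measurableTypeR R * plane] (fun z : measurableTypeR R * plane => jump G1 (p z.1 + z.2)).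
  exact: (mq cJ mX).
have mF : measurable_fun [set: measurableTypeR R * plane] F.
  by apply: measurable_funM => //; exact: (measurableT_comp measurable_potential measurable_snd).
have iF : (mu \x sleb2)%E.-integrable (I `*` box 1) (EFin \o F).
  apply: (@integrable_singular _ _ _ _ _ _ (2 * C1)) => //.
  - exact: measure_itv_lty.
  - by rewrite mulr_ge0.
  - exact: measurable_funTS.
  - by move=> t y _; exact: potential_jump_le.
have -> : side_integral G pi - side_integral G (- pi) = \int[(mu \x sleb2)%E]_(z in I `*` box 1) F z.
  have [_ e] := fubini_Rintegral1 mI mB iF.
  rewrite [RHS]e side_jump; apply: eq_Rintegral => t /set_mem tI.
  by rewrite jump_by_parts.
have mIB := measurableX mI mB.
rewrite EFin_normr_Rintegral//; apply: le_trans (le_abse_integral _ mIB (measurable_int _ iF)) _.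
pose f (z : measurableTypeR R * plane) : \bar R := (rho z.2 * `|jump G1 (p z.1 + z.2)|)%:E.
have f0 z : (0 <= f z)%E by rewrite lee_fin mulr_ge0 ?rho_ge0.
have mf : measurable_fun [set: measurableTypeR R * plane] f.
  apply/measurable_EFinP; apply: measurable_funM; last exact: measurableT_comp.
  exact: (measurable_inv_enorm_comp measurable_snd).
apply: (@le_trans _ _ (\int[(mu \x sleb2)%E]_(z in I `*` box 1) f z)%E).
  apply: ge0_le_integral => //.
  - by apply: measurableT_comp => //; exact: (measurable_int _ iF).
  - exact: measurable_funTS.
  - move=> z [_ z1]; have /andP[W0 W1] := potential_bounds z1.
    by rewrite lee_fin /F normrM (ger0_norm W0) ler_wpM2r.
have [_ e1] := @tonelli_setX _ _ _ _ R mu sleb2 _ _ mI mB f (measurable_funTS mf) (fun z _ => f0 z).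
rewrite [leLHS]e1.
pose h (y : plane) : \bar R := (\int[mu]_(t in I) f (t, y))%E.
have h0 y : (0 <= h y)%E by apply: integral_ge0.
have mh : measurable_fun [set: plane] h.
  apply: (@measurable_tonelli_setX1 _ _ _ _ R mu _ _ measurableT mI (fun z : plane * measurableTypeR R => f (z.2, z.1))) => //.
  apply: measurable_funTS; apply: (measurableT_comp mf).
  by apply/measurable_fun_pairP; split; [exact: measurable_snd|exact: measurable_fst].
have [e2 _] := @tonelli_setX _ _ _ _ R mu mu _ _ mI mI h (measurable_funTS mh) (fun z _ => h0 z).
rewrite box1E [leLHS]e2 le_eqVlt; apply/orP; left; apply/eqP.
apply: eq_integral => s _; apply: eq_integral => t _; apply: eq_integral => a _.
by [].
Qed.

End periodic_jump.

(** * Differences of a periodic and a smooth function *)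

Section periodic_functions.
Context {R : realType}.
Implicit Types (x y z v : R * R) (f psi : R * R -> R).

Lemma period_e1 z : z + (pi *+ 2) *: e1 = z + (2 * pi, 0) :> R * R.
Proof. by rewrite addre1 mulr_natl; case: z => a b; congr (_, _); rewrite addr0. Qed.

Lemma biperiodicN psi x : biperiodic psi ->
  psi (x - (pi *+ 2) *: e1) = psi x /\ psi (x - (pi *+ 2) *: e2) = psi x.
Proof.
move=> per; split.
  by have [<- _] := per (x - (pi *+ 2) *: e1); rewrite subrK.
by have [_ <-] := per (x - (pi *+ 2) *: e2); rewrite subrK.
Qed.

Lemma biperiodic_swap psi : biperiodic psi -> biperiodic (psi \o @swap R R).
Proof.
move=> per x; have [p1 p2] := per (swap x).
by rewrite /= swap_e1 swap_e2; split.
Qed.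

(** Every point of the double box is a translate, by periods, of a point of
the fundamental box. *)
Lemma period_reduce psi z : biperiodic psi -> box 2 z ->
  exists2 z0, box 1 z0 & forall w, psi (z + w) = psi (z0 + w).
Proof.
move=> per /boxP[z1 z2].
have red (a : R) : `|a| <= 2 * pi -> [\/ `|a| <= pi, `|a + pi *+ 2| <= pi | `|a - pi *+ 2| <= pi].
  have pi0 := @pi_gt0 R; rewrite -mulr_natl !ler_norml => /andP[a1 a2].
  have [h1|h1] := leP (- pi) a; have [h2|h2] := leP a pi.
  - by apply: Or31; apply/andP; split; lra.
  - by apply: Or33; apply/andP; split; lra.
  - by apply: Or32; apply/andP; split; lra.
  - by apply: Or31; lra.
have s1 : exists2 u : R * R, `|u.1| <= pi /\ `|u.2| <= 2 * pi & forall w, psi (z + w) = psi (u + w).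
  have [h|h|h] := red _ z1.
  - by exists z.
  - exists (z + (pi *+ 2) *: e1); first by rewrite addre1.
    by move=> w; rewrite addrAC; have [-> _] := per (z + w).
  - exists (z - (pi *+ 2) *: e1); first by rewrite -scaleNr addre1.
    by move=> w; rewrite addrAC; have [-> _] := biperiodicN (z + w) per.
have [u [u1 u2] zu] := s1.
have [h|h|h] := red _ u2.
- by exists u => //; apply/boxP; rewrite mul1r.
- exists (u + (pi *+ 2) *: e2); first by apply/boxP; rewrite addre2 mul1r.
  by move=> w; rewrite addrAC zu; have [_ ->] := per (u + w).
- exists (u - (pi *+ 2) *: e2); first by apply/boxP; rewrite -scaleNr addre2 mul1r.
  by move=> w; rewrite addrAC zu; have [_ ->] := biperiodicN (u + w) per.
Qed.

(** Inside the double box horizontally, the one-sided nature of derivatives relative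
to the box disappears. *)
Lemma is_derive_inside f z : Ck 1 (box 2) f -> box 2 z -> `|z.1| < 2 * pi ->
  is_derive (0 : R) 1 (fun s : R => f (z + s *: e1)) (rderive (box 2) e1 f z).
Proof.
move=> cf /[dup] z2 /boxP[_ zz2]; rewrite ltr_norml => /andP[z1 z1'].
have e0 : z + (0 : R) *: e1 = z by rewrite scale0r addr0.
have bx (a : R) : `|z.1 + a| <= 2 * pi -> box 2 (z + a *: e1).
  by move=> a2; rewrite addre1; apply/boxP.
have n2 : `|2 * pi : R| = 2 * pi by rewrite ger0_norm// mulr_ge0// pi_ge0.
have b1 : box 2 (z + (- (2 * pi) - z.1) *: e1) by apply: bx; rewrite addrC subrK normrN n2.
have b2 : box 2 (z + (2 * pi - z.1) *: e1) by apply: bx; rewrite addrC subrK n2.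
have s12 : - (2 * pi) - z.1 < 0 < 2 * pi - z.1 by apply/andP; split; lra.
have df : rderivable (box 2) e1 f (z + (0 : R) *: e1).
  by rewrite e0; exact: Ck_rderivable cf coord_dir1 z2.
by have := is_derive_line (@box_line_convex _ 2 e1) b1 b2 s12 df; rewrite e0.
Qed.

(** A derivative along a whole line can be transported by a period, unlike a
derivative relative to the box. *)
Lemma periodic_bounds psi (m : R) z : biperiodic psi -> Ck 1 (box 2) psi ->
  (forall x, box 1 x -> `|psi x| <= m) ->
  (forall x, box 1 x -> `|rderive (box 1) e1 psi x| <= m) ->
  box 2 z -> `|z.1| < 2 * pi ->
  `|psi z| <= m /\ `|rderive (box 2) e1 psi z| <= m.
Proof.
move=> per cpsi m0 m1 z2 z1.
have [u u1 zu] := period_reduce per z2.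
have d := is_derive_inside cpsi z2 z1.
have fE : (fun s : R => psi (z + s *: e1)) = (fun s : R => psi (u + s *: e1)).
  by apply/funext => s; rewrite zu.
rewrite fE in d.
have [_ e] := rderive_is_derive (@box_line_convex _ 1 e1) u1 (box_has_line coord_dir1 u1) d.
split; last by rewrite -e m1.
by have := zu 0; rewrite !addr0 => ->; exact: m0.
Qed.

(** The strip is open horizontally so that it and its translate by a period avoid
the vertical sides of the double box. *)
Lemma strip_inside z : strip z ->
  [/\ box 2 z, `|z.1| < 2 * pi, box 2 (z + (2 * pi, 0)) & `|(z + (2 * pi, 0)).1| < 2 * pi].
Proof.
case: z => a b [] /=; rewrite !in_itv/= => /andP[a1 a2] /andP[b1 b2].
have n1 : `|a| < 2 * pi by rewrite ltr_norml; apply/andP; split; have := @pi_gt0 R; lra.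
have n2 : `|a + 2 * pi| < 2 * pi by rewrite ltr_norml; apply/andP; split; have := @pi_gt0 R; lra.
have n3 : `|b| <= 2 * pi by rewrite ler_norml b1.
have b1x : box 2 (a, b) by apply/boxP; split => //; exact: ltW.
have e : ((a, b) : R * R) + (2 * pi, 0) = (a + 2 * pi, b).
  by rewrite -[LHS]/(a + 2 * pi, b + 0) addr0.
by rewrite e; split=> //; apply/boxP; split => //; exact: ltW.
Qed.

Lemma jump_rderive f z : Ck 1 (box 2) f -> strip z ->
  jump (rderive (box 2) e1 f \o clamp 2) z = rderive (box 2) e1 (shift_diff e1 f) z.
Proof.
move=> cf /strip_inside[z2 z1 z2' z1'].
have d := is_derive_inside cf z2 z1; have d' := is_derive_inside cf z2' z1'.
have dd := is_derive_sub d' d.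
have fE : (fun s : R => f (z + (2 * pi, 0) + s *: e1) - f (z + s *: e1)) =
    (fun s : R => shift_diff e1 f (z + s *: e1)).
  by apply/funext => s; rewrite /shift_diff (period_e1 (z + s *: e1)) addrAC.
rewrite fE in dd.
have [_ ->] := rderive_is_derive (@box_line_convex _ 2 e1) z2 (box_has_line coord_dir1 z2) dd.
by rewrite /jump /= (clamp_id z2) (clamp_id z2').
Qed.

Lemma jump_shift_diff f z : strip z -> jump (f \o clamp 2) z = shift_diff e1 f z.
Proof.
move=> /strip_inside[z2 _ z2' _].
by rewrite /jump /shift_diff (period_e1 z) /= (clamp_id z2) (clamp_id z2').
Qed.

End periodic_functions.

Section strip_norms.
Context {R : realType}.
Notation leb2 := (@leb2 R).
Notation plane := (measurableTypeR R * measurableTypeR R)%type.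
Implicit Types (x y z v : R * R) (f g : R * R -> R) (X : set plane).

Lemma Lpnorm2_add X f g : measurable X -> measurable_fun [set: plane] f ->
  measurable_fun [set: plane] g ->
  (Lpnorm 2%:E X (fun z => (f z + g z)%R) <= Lpnorm 2%:E X f + Lpnorm 2%:E X g)%E.
Proof.
move=> mX mf mg; rewrite /Lpnorm.
have mr (h : R * R -> R) : measurable_fun [set: plane] h -> measurable_fun [set: plane] (h \_ X).
  by move=> mh; exact: ((measurable_restrictT h mX).1 (measurable_funTS mh)).
have := minkowski_EFin leb2 (mr _ mf) (mr _ mg) (_ : 1 <= 2); rewrite ler1n => /(_ isT).
congr (_ <= _)%E; congr Lnorm; apply/funext => z /=.
by rewrite /patch; case: ifP => // _ /=; rewrite ?addr0.
Qed.

Lemma Lpnorm2_scale X f (c : R) : measurable X -> measurable_fun [set: plane] f ->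
  0 <= c -> (Lpnorm 2%:E X (fun z => (c * f z)%R) = c%:E * Lpnorm 2%:E X f)%E.
Proof.
move=> mX mf c0.
have N0 (h : R * R -> R) : (0 <= Lpnorm 2%:E X h)%E by exact: Lnorm_ge0.
have cN0 : (0 <= c%:E * Lpnorm 2%:E X f)%E by rewrite mule_ge0 ?lee_fin.
rewrite -(sqrt_expe2 (N0 _)) -[RHS]sqrt_expe2//; congr (_ `^ _)%E.
have -> : ((c%:E * Lpnorm 2%:E X f) ^+ 2 = (c ^+ 2)%:E * Lpnorm 2%:E X f ^+ 2)%E.
  by rewrite !expe2 muleACA -EFinM -expr2.
rewrite !Lpnorm2_sqr -ge0_integralZl_EFin ?sqr_ge0//.
- by apply: eq_integral => z _; rewrite exprMn EFinM.
- by move=> z _; rewrite lee_fin sqr_ge0.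
- by apply/measurable_EFinP; apply: measurable_funTS; apply: measurable_funX.
Qed.

Lemma measurable_strip : measurable (@strip R).
Proof. by apply: measurableX; exact: measurable_itv. Qed.

(** Coordinates are exchanged for continuous functions on the strip; with these the
derivatives relative to the double box are then compared pointwise. *)
Lemma Lpnorm2_swap X f : measurable X -> measurable_fun [set: plane] f ->
  Lpnorm 2%:E (@swap R R @^-1` X) (f \o @swap R R) = Lpnorm 2%:E X f.
Proof.
move=> mX mf.
have N0 (Y : set plane) (h : R * R -> R) : (0 <= Lpnorm 2%:E Y h)%E by exact: Lnorm_ge0.
rewrite -(sqrt_expe2 (N0 _ _)) -[RHS]sqrt_expe2//; congr (_ `^ _)%E.
rewrite !Lpnorm2_sqr.
have mf2 : measurable_fun X (fun z : plane => (f z ^+ 2)%:E).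
  by apply/measurable_EFinP; apply: measurable_funTS; apply: measurable_funX.
by have := integral_transfer (@measurable_swap _ _ _ _) (@leb2_swap R) mX mf2.
Qed.

End strip_norms.

Section jump_decomposition.
Context {R : realType}.
Notation sleb2 := (@sleb2 R).
Implicit Types (x y z v : R * R) (f : R * R -> R).
Variables (psi psih : R * R -> R) (m : R).
Hypotheses (per : biperiodic psi) (cpsih : Ck 2 (box 2) psih).
Let phi : R * R -> R := (psi \- psih)%R.
Hypothesis cphi : Ck 2 (box 2) phi.
Hypothesis psim : forall x, box 1 x -> `|psi x| <= m.
Hypothesis dpsim : forall x, box 1 x -> `|rderive (box 1) e1 psi x| <= m.

Let cpsi : Ck 2 (box 2) psi.
Proof. by apply: eq_Ck (CkD cphi cpsih) => x _; rewrite /phi /= subrK. Qed.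

Let m_ge0 : 0 <= m.
Proof.
apply: le_trans (psim (_ : box 1 0)); first exact: normr_ge0.
by apply/boxP; rewrite /= normr0 mul1r pi_ge0.
Qed.

Lemma rderive_sqr f z : Ck 1 (box 2) f -> box 2 z ->
  rderive (box 2) e1 (sqr_fun f) z = 2 * f z * rderive (box 2) e1 f z.
Proof.
move=> cf z2.
have lc := @box_line_convex R 2 e1; have hl := box_has_line coord_dir1 z2.
have df := Ck_rderivable cf coord_dir1 z2.
have [_ e] := rderiveM lc z2 hl df df.
by rewrite [LHS]e; ring.
Qed.

Lemma rderive_phi z : box 2 z ->
  rderive (box 2) e1 phi z = rderive (box 2) e1 psi z - rderive (box 2) e1 psih z.
Proof.
move=> z2; have lc := @box_line_convex R 2 e1; have hl := box_has_line coord_dir1 z2.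
exact: (rderiveB lc z2 hl (Ck_rderivable cpsi coord_dir1 z2) (Ck_rderivable cpsih coord_dir1 z2)).2.
Qed.

Lemma rderive_psi_periodic z : strip z ->
  rderive (box 2) e1 psi (z + (2 * pi, 0)) = rderive (box 2) e1 psi z.
Proof.
move=> /strip_inside[z2 z1 z2' z1'].
have d := is_derive_inside (Ck_pred cpsi) z2 z1.
have d' := is_derive_inside (Ck_pred cpsi) z2' z1'.
have fE : (fun s : R => psi (z + (2 * pi, 0) + s *: e1)) = (fun s : R => psi (z + s *: e1)).
  by apply/funext => s; rewrite -(period_e1 z) addrAC; have [-> _] := per (z + s *: e1).
rewrite fE in d'.
by case: d' => _ <-; case: d => _ <-.
Qed.

Definition jump_sqr := jump (rderive (box 2) e1 (sqr_fun psih) \o clamp 2).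
Definition jump_val := jump (psih \o clamp 2).
Definition jump_der := jump (rderive (box 2) e1 psih \o clamp 2).

(** Periodicity of [psi] cancels the products in which only [psi] occurs. *)
Lemma jump_sqr_phi_le z : strip z ->
  `|jump (rderive (box 2) e1 (sqr_fun phi) \o clamp 2) z| <=
  `|jump_sqr z| + (2 * m * `|jump_val z| + 2 * m * `|jump_der z|).
Proof.
move=> zs; have [z2 z1 z2' z1'] := strip_inside zs.
have [a0 a1] := periodic_bounds per (Ck_pred cpsi) psim dpsim z2 z1.
have aE : psi (z + (2 * pi, 0)) = psi z by rewrite -(period_e1 z); have [] := per z.
have a1E := rderive_psi_periodic zs.
rewrite /jump_sqr /jump_val /jump_der /jump /= (clamp_id z2) (clamp_id z2').
rewrite (rderive_sqr (Ck_pred cphi) z2) (rderive_sqr (Ck_pred cphi) z2').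
rewrite (rderive_sqr (Ck_pred cpsih) z2) (rderive_sqr (Ck_pred cpsih) z2').
rewrite (rderive_phi z2) (rderive_phi z2') a1E /phi /= aE.
set a := psi z in a0 *; set d := rderive _ _ psi z in a1 *.
set b := psih z; set b' := psih _; set c := rderive _ _ psih z; set c' := rderive _ _ psih _.
rewrite (_ : 2 * (a - b') * (d - c') - 2 * (a - b) * (d - c) = (2 * b' * c' - 2 * b * c) + (- (2 * d) * (b' - b) + - (2 * a) * (c' - c))); last by ring.
apply: le_trans (ler_normD _ _) _; apply: lerD => //.
apply: le_trans (ler_normD _ _) _.
by apply: lerD; rewrite normrM ler_wpM2r// normrN normrM ger0_norm// ler_wpM2l.
Qed.

Let cjump f : Ck 0 (box 2) f -> continuous (jump (f \o clamp 2)).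
Proof. by move=> cf; apply: continuous_jump; exact: Ck_clamp cf. Qed.

Lemma continuous_jump_sqr : continuous jump_sqr.
Proof. by apply: cjump; exact: Ck_pred (Ck_rderive (Ck_sqr cpsih) coord_dir1). Qed.

Lemma continuous_jump_val : continuous jump_val.
Proof. by apply: cjump; exact: Ck_pred (Ck_pred cpsih). Qed.

Lemma continuous_jump_der : continuous jump_der.
Proof. by apply: cjump; exact: Ck_pred (Ck_rderive cpsih coord_dir1). Qed.

Lemma jump_norm_le :
  (Lpnorm 2%:E strip (jump (rderive (box 2) e1 (sqr_fun phi) \o clamp 2)) <=
   Lpnorm 2%:E strip jump_sqr + (2 * m)%:E *
     (Lpnorm 2%:E strip jump_val + Lpnorm 2%:E strip jump_der))%E.
Proof.
have m2 : 0 <= 2 * m by rewrite mulr_ge0.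
have mS := @measurable_strip R.
have ma (f : R * R -> R) : continuous f -> measurable_fun [set: (measurableTypeR R * measurableTypeR R)%type] (fun z => `|f z|).
  by move=> /continuous_measurable_plane mf; exact: measurableT_comp.
have mas (f : R * R -> R) : continuous f -> measurable_fun [set: (measurableTypeR R * measurableTypeR R)%type] (fun z => 2 * m * `|f z|).
  by move=> cf; apply: measurable_funM => //; exact: ma.
have na (f : R * R -> R) : (Lpnorm 2%:E strip (fun z => `|f z|%R) <= Lpnorm 2%:E strip f)%E.
  by apply: Lpnorm2_le => z zs; rewrite normr_id.
have m0 := ma _ continuous_jump_sqr; have m1 := mas _ continuous_jump_val.
have m3 := mas _ continuous_jump_der.
apply: (@le_trans _ _ (Lpnorm 2%:E strip (fun z => `|jump_sqr z| + (2 * m * `|jump_val z| + 2 * m * `|jump_der z|))%R)).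
  apply: Lpnorm2_le => z zs; split => //.
  by apply: le_trans (jump_sqr_phi_le zs) _; exact: ler_norm.
apply: le_trans (Lpnorm2_add mS m0 (measurable_funD m1 m3)) _.
apply: leeD; first exact: na.
apply: le_trans (Lpnorm2_add mS m1 m3) _.
rewrite (Lpnorm2_scale mS (ma _ continuous_jump_val) m2) (Lpnorm2_scale mS (ma _ continuous_jump_der) m2).
by rewrite ge0_muleDr ?Lnorm_ge0// leeD// lee_wpmul2l ?lee_fin.
Qed.

Lemma side_difference_le :
  (`|side_integral (sqr_fun phi \o clamp 2) pi - side_integral (sqr_fun phi \o clamp 2) (- pi)|%:E <=
   (@strip_bound R + 1)%:E * (Lpnorm 2%:E strip jump_sqr + (2 * m)%:E *
     (Lpnorm 2%:E strip jump_val + Lpnorm 2%:E strip jump_der)))%E.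
Proof.
have cs := Ck_sqr cphi.
have [M M0 oM] := odiff_le (Ck_pred cs).
have [C1 C10 sC] := Ck_bound (Ck_rderive cs coord_dir1).
have oM' x y : box 1 x -> box 1 y -> `|odiff (sqr_fun phi \o clamp 2) x y| <= M * enorm y.
  move=> x1 y1; have bp : box 2 (x + y) by exact: (@boxD _ 1 1).
  have bm : box 2 (x - y) by apply: (@boxD _ 1 1) => //; exact/boxN.
  by rewrite /odiff /= (clamp_id bp) (clamp_id bm); exact: oM.
have le := side_jump_le (Ck_clamp cs) (Ck_clamp (Ck_rderive cs coord_dir1)) M0 C10
  (fun x => sC _ (clamp_box 2 x)) (fun s t => @clamp_is_derive _ _ s t (Ck_pred cs)) oM'.
apply: le_trans le _; apply: lee_wpmul2l; last exact: jump_norm_le.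
by rewrite lee_fin addr_ge0// strip_bound_ge0.
Qed.

End jump_decomposition.

Section jump_norms.
Context {R : realType}.
Implicit Types (z : R * R) (psih : R * R -> R).

Lemma H1norm_e1_ge psih : Ck 2 (box 2) psih ->
  [/\ (Lpnorm 2%:E strip (jump_sqr psih) <= H1norm (box 2) (shift_diff e1 (sqr_fun psih)))%E,
      (Lpnorm 2%:E strip (jump_val psih) <= H1norm (box 2) (shift_diff e1 psih))%E &
      (Lpnorm 2%:E strip (jump_der psih) <= H1norm (box 2) (shift_diff e1 psih))%E].
Proof.
move=> cp; split.
- apply: le_trans (H1norm_ge (Or32 _ _ erefl)); apply: Lpnorm2_le => z zs.
  have [z2 _ _ _] := strip_inside zs.
  by rewrite /jump_sqr (jump_rderive (Ck_pred (Ck_sqr cp)) zs).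
- apply: le_trans (H1norm_ge (Or31 _ _ erefl)); apply: Lpnorm2_le => z zs.
  have [z2 _ _ _] := strip_inside zs.
  by rewrite /jump_val jump_shift_diff.
- apply: le_trans (H1norm_ge (Or32 _ _ erefl)); apply: Lpnorm2_le => z zs.
  have [z2 _ _ _] := strip_inside zs.
  by rewrite /jump_der (jump_rderive (Ck_pred cp) zs).
Qed.

Lemma shift_diff_swap f : shift_diff e1 (f \o @swap R R) = shift_diff e2 f \o @swap R R.
Proof. by apply/funext => z; rewrite /shift_diff /= swap_e1. Qed.

Lemma H1norm_e2_ge psih : Ck 2 (box 2) psih ->
  let psis := psih \o @swap R R in
  [/\ (Lpnorm 2%:E strip (jump_sqr psis) <= H1norm (box 2) (shift_diff e2 (sqr_fun psih)))%E,
      (Lpnorm 2%:E strip (jump_val psis) <= H1norm (box 2) (shift_diff e2 psih))%E &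
      (Lpnorm 2%:E strip (jump_der psis) <= H1norm (box 2) (shift_diff e2 psih))%E].
Proof.
move=> cp psis; have cps : Ck 2 (box 2) psis by exact: Ck_swap.
have mS := @measurable_strip R.
have sK z : swap (swap z) = z by case: z.
have sw f : continuous f -> Lpnorm 2%:E strip f = Lpnorm 2%:E (@swap R R @^-1` strip) (f \o @swap R R).
  by move=> cf; rewrite Lpnorm2_swap//; exact: continuous_measurable_plane.
have der h z : rderive (box 2) e1 (shift_diff e1 (h \o @swap R R)) (swap z) = rderive (box 2) e2 (shift_diff e2 h) z.
  by rewrite shift_diff_swap (rderive_swap 2 _ _ (@swap_e1 R)).1 sK.
split.
- rewrite sw; last exact: continuous_jump_sqr.
  apply: le_trans (H1norm_ge (Or33 _ _ erefl)); apply: Lpnorm2_le => z zs.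
  have [z2 _ _ _] := strip_inside zs; split; first exact/box_swap.
  by rewrite /jump_sqr /= (jump_rderive (Ck_pred (Ck_sqr cps)) zs) -(der (sqr_fun psih)).
- rewrite sw; last exact: continuous_jump_val.
  apply: le_trans (H1norm_ge (Or31 _ _ erefl)); apply: Lpnorm2_le => z zs.
  have [z2 _ _ _] := strip_inside zs; split; first exact/box_swap.
  by rewrite /jump_val /= jump_shift_diff// shift_diff_swap /= sK.
- rewrite sw; last exact: continuous_jump_der.
  apply: le_trans (H1norm_ge (Or33 _ _ erefl)); apply: Lpnorm2_le => z zs.
  have [z2 _ _ _] := strip_inside zs; split; first exact/box_swap.
  by rewrite /jump_der /= (jump_rderive (Ck_pred cps) zs) -der.
Qed.

End jump_norms.

(** * The estimates of the quadratic functional *)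

Section final_estimates.
Context {R : realType}.
Notation sleb2 := (@sleb2 R).
Implicit Types (x y z v : R * R) (f psi psih phi : R * R -> R).

Lemma average_bound_ge0 : 0 <= @average_bound R.
Proof.
have p0 := @pi_ge0 R; have ip0 : 0 <= pi^-1 :> R by rewrite invr_ge0.
have mI : 0 <= fine (@lebesgue_measure R `[- pi, pi]) by exact/fine_ge0/measure_ge0.
have m1 : 0 <= fine (sleb2 (box 1)) by exact/fine_ge0/measure_ge0.
have e0 : 0 <= @edge_bound R by rewrite /edge_bound !mulr_ge0// exprn_ge0.
by rewrite /average_bound mulr_ge0 ?Kconst_ge0// addr_ge0 ?mulr_ge0.
Qed.

Lemma grad_norm_continuous psi : Ck 1 (box 1) psi ->
  {within box 1, continuous (grad_norm (box 1) psi)}.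
Proof.
move=> cp.
have c1 := Ck_clamp (Ck_rderive cp coord_dir1); have c2 := Ck_clamp (Ck_rderive cp coord_dir2).
apply: (@within_congr _ _ (fun x => enorm ((rderive (box 1) e1 psi \o clamp 1) x, (rderive (box 1) e2 psi \o clamp 1) x))).
  by move=> x x1; rewrite /= clamp_id.
apply: continuous_subspaceT => x.
apply: (@continuous_comp _ _ _ (fun x => ((rderive (box 1) e1 psi \o clamp 1) x, (rderive (box 1) e2 psi \o clamp 1) x) : R * R) (@enorm R) x).
  exact: continuous_pair.
exact: continuous_enorm.
Qed.

Definition sup_norms psi : \bar R :=
  (Lpnorm +oo (box 1) psi + Lpnorm +oo (box 1) (grad_norm (box 1) psi))%E.

(** A real bound is extracted from the sup norms before any product is formed,
so that an infinite factor never has to be handled. *)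
Lemma sup_norms_bound psi : Ck 2 (box 2) psi ->
  exists m : R, [/\ (m%:E <= sup_norms psi)%E,
    forall x, box 1 x -> `|psi x| <= m,
    forall x, box 1 x -> `|rderive (box 1) e1 psi x| <= m &
    forall x, box 1 x -> `|rderive (box 1) e2 psi x| <= m].
Proof.
move=> /(@Ck_box_le _ _ 0%N 2 _ (isT : (1 <= 2)%N)) cp.
have N0 (h : R * R -> R) : (0 <= Lpnorm +oo (box 1) h)%E by exact: Lnorm_ge0.
have l0 x : box 1 x -> (`|psi x|%:E <= sup_norms psi)%E.
  move=> x1; apply: le_trans (le_Linf (Ck_continuous cp) x1) _.
  by rewrite /sup_norms leeDl.
have lg x : box 1 x -> ((grad_norm (box 1) psi x)%:E <= sup_norms psi)%E.
  move=> x1; apply: le_trans (_ : (`|grad_norm (box 1) psi x|%:E <= _)%E).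
    by rewrite lee_fin ler_norm.
  apply: le_trans (le_Linf (grad_norm_continuous (Ck_pred cp)) x1) _.
  by rewrite /sup_norms leeDr.
have l1 x : box 1 x -> (`|rderive (box 1) e1 psi x|%:E <= sup_norms psi)%E.
  move=> x1; apply: le_trans (lg _ x1); rewrite lee_fin.
  exact: (le_norm1_enorm (rderive (box 1) e1 psi x, rderive (box 1) e2 psi x)).
have l2 x : box 1 x -> (`|rderive (box 1) e2 psi x|%:E <= sup_norms psi)%E.
  move=> x1; apply: le_trans (lg _ x1); rewrite lee_fin.
  exact: (le_norm2_enorm (rderive (box 1) e1 psi x, rderive (box 1) e2 psi x)).
have : (0 <= sup_norms psi)%E by rewrite /sup_norms adde_ge0.
case E : (sup_norms psi) l0 l1 l2 => [N||//] l0 l1 l2 N00.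
  by exists N.
have [M0 M00 b0] := Ck_bound cp.
have [M1 M10 b1] := Ck_bound (Ck_rderive cp coord_dir1).
have [M2 M20 b2] := Ck_bound (Ck_rderive cp coord_dir2).
exists (M0 + M1 + M2); split; first by rewrite leey.
- by move=> x x1; apply: le_trans (b0 _ x1) _; rewrite -addrA lerDl addr_ge0.
- by move=> x x1; apply: le_trans (b1 _ x1) _; rewrite addrAC lerDr addr_ge0.
- by move=> x x1; apply: le_trans (b2 _ x1) _; rewrite lerDr addr_ge0.
Qed.

Definition quad_bound : R :=
  @average_bound R + 4 * Kconst * (@strip_bound R + 1) + Kconst + 1.

Let sb0 : 0 <= @strip_bound R + 1.
Proof. by rewrite addr_ge0// strip_bound_ge0. Qed.

Let K0 : 0 <= @Kconst R. Proof. exact: Kconst_ge0. Qed.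

Let A0 := average_bound_ge0.

Let ks0 : 0 <= 4 * Kconst * (@strip_bound R + 1).
Proof. by apply: mulr_ge0 sb0; exact: mulr_ge0. Qed.

Lemma quad_bound_gt0 : 0 < quad_bound.
Proof. exact: ltr_wpDl (addr_ge0 (addr_ge0 A0 ks0) K0) ltr01. Qed.

Lemma quad_functional_le phi : Ck 2 (box 2) phi ->
  (`|quad_functional phi|%:E <= quad_bound%:E * Lpnorm 2%:E (box 5) phi ^+ 2 +
    quad_bound%:E * `|boundary_integral (sqr_fun phi)|%:E)%E.
Proof.
move=> cp; have le := quad_abs_le cp; have lQ := box2_sqr_le cp.
have h := ks0.
have k0 := K0; have a0 := A0.
have Q0 : (0 <= Lpnorm 2%:E (box 5) phi ^+ 2)%E by rewrite expe_ge0// Lnorm_ge0.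
have := le; rewrite -lee_fin EFinD !EFinM => /le_trans; apply; apply: leeD.
  apply: (@le_trans _ _ ((@average_bound R)%:E * Lpnorm 2%:E (box 5) phi ^+ 2)%E).
    by apply: lee_wpmul2l; rewrite ?lee_fin.
  by apply: lee_wpmul2r => //; rewrite lee_fin /quad_bound -!addrA lerDl !addr_ge0.
by apply: lee_wpmul2r; rewrite lee_fin// /quad_bound -addrA addrC -addrA lerDl !addr_ge0.
Qed.

(** Combination of the bounds for the two directions. The factor [n] may be
infinite; it is only compared with the real number [m]. *)
Lemma periodic_boundary_le (a b c d n : \bar R) (m d1 d2 : R) :
  (0 <= a)%E -> (0 <= b)%E -> (0 <= c)%E -> (0 <= d)%E -> 0 <= m -> (m%:E <= n)%E ->
  (`|d1|%:E <= (@strip_bound R + 1)%:E * (a + (2 * m)%:E * (c + c)))%E ->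
  (`|d2|%:E <= (@strip_bound R + 1)%:E * (b + (2 * m)%:E * (d + d)))%E ->
  ((Kconst * `|d1 + d2|)%:E <=
    quad_bound%:E * a + quad_bound%:E * b + quad_bound%:E * n * (c + d))%E.
Proof.
move=> a0 b0 c0 d0 m0 mn l1 l2.
have k0 := K0; have s0 := sb0; have q0 := ltW quad_bound_gt0.
have ks : Kconst * (@strip_bound R + 1) <= quad_bound.
  have := A0; have : 0 <= Kconst * (@strip_bound R + 1) by exact: mulr_ge0.
  rewrite /quad_bound => h1 h2; have := k0; lra.
have ks4 : 4 * (Kconst * (@strip_bound R + 1)) <= quad_bound.
  by have := A0; have := k0; rewrite /quad_bound; lra.
set s := @strip_bound R + 1 in l1 l2 s0 ks ks4 *.
have n0 : (0 <= n)%E by apply: le_trans mn; rewrite lee_fin.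
have half (u w : \bar R) (e : R) : (0 <= u)%E -> (0 <= w)%E ->
    (`|e|%:E <= s%:E * (u + (2 * m)%:E * (w + w)))%E ->
    ((Kconst * `|e|)%:E <= quad_bound%:E * u + quad_bound%:E * n * w)%E.
  move=> u0 w0 le; rewrite EFinM.
  apply: le_trans (lee_wpmul2l (_ : (0 <= Kconst%:E)%E) le) _; first by rewrite lee_fin.
  have ww0 : (0 <= (2 * m)%:E * (w + w))%E by rewrite mule_ge0 ?adde_ge0// lee_fin mulr_ge0.
  rewrite muleA -EFinM ge0_muleDr//; apply: leeD.
    by apply: lee_wpmul2r; rewrite ?lee_fin.
  rewrite -muleA (_ : (w + w = 2%:E * w)%E); last by rewrite -mule2n -mule_natl.
  rewrite !muleA -!EFinM; apply: lee_wpmul2r => //.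
  apply: (@le_trans _ _ (quad_bound%:E * m%:E)%E); last by apply: lee_wpmul2l; rewrite ?lee_fin.
  rewrite -EFinM lee_fin (_ : Kconst * s * (2 * m) * 2 = 4 * (Kconst * s) * m); last by ring.
  exact: ler_wpM2r.
have h1 := half _ _ _ a0 c0 l1; have h2 := half _ _ _ b0 d0 l2.
apply: (@le_trans _ _ ((Kconst * `|d1|)%:E + (Kconst * `|d2|)%:E)%E).
  by rewrite -EFinD lee_fin -mulrDr ler_wpM2l// ler_normD.
apply: le_trans (leeD h1 h2) _.
by rewrite addeACA [in leRHS]ge0_muleDr.
Qed.

Lemma quad_functional_periodic_le psi psih : biperiodic psi -> smooth (box 2) psih ->
  Ck 2 (box 5) (psi \- psih)%R ->
  (`|quad_functional (psi \- psih)%R|%:E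
     <= quad_bound%:E * Lpnorm 2%:E (box 5) (psi \- psih)%R ^+ 2
      + quad_bound%:E * H1norm (box 2) (shift_diff e1 (sqr_fun psih))
      + quad_bound%:E * H1norm (box 2) (shift_diff e2 (sqr_fun psih))
      + quad_bound%:E * sup_norms psi
        * (H1norm (box 2) (shift_diff e1 psih) + H1norm (box 2) (shift_diff e2 psih)))%E.
Proof.
move=> per sm c5.
have cphi : Ck 2 (box 2) (psi \- psih)%R := Ck_box_le (isT : (1 < 5)%N) c5.
have cpsih : Ck 2 (box 2) psih := sm 2%N.
have cpsi : Ck 2 (box 2) psi by apply: eq_Ck (CkD cphi cpsih) => x _; rewrite /= subrK.
have [m [mN b0 b1 b2]] := sup_norms_bound cpsi.
have m0 : 0 <= m.
  have o1 : box 1 (0 : R * R) by apply/boxP; rewrite /= normr0 mul1r pi_ge0.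
  exact: le_trans (normr_ge0 _) (b0 _ o1).
pose psis := psi \o @swap R R; pose psihs := psih \o @swap R R.
have pers : biperiodic psis := biperiodic_swap per.
have cpsihs : Ck 2 (box 2) psihs := Ck_swap cpsih.
have cphis : Ck 2 (box 2) (psis \- psihs)%R := Ck_swap cphi.
have b0s x : box 1 x -> `|psis x| <= m by move=> /box_swap; exact: b0.
have b1s x : box 1 x -> `|rderive (box 1) e1 psis x| <= m.
  by move=> /box_swap x1; rewrite (rderive_swap 1 _ _ (@swap_e1 R)).1; exact: b2.
have l1 := side_difference_le per cpsih cphi b0 b1.
have l2 := side_difference_le pers cpsihs cphis b0s b1s.
have [h11 h12 h13] := H1norm_e1_ge cpsih; have [h21 h22 h23] := H1norm_e2_ge cpsih.
have m2 : (0 <= (2 * m)%:E)%E by rewrite lee_fin mulr_ge0.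
have s0 : (0 <= (@strip_bound R + 1)%:E)%E by rewrite lee_fin sb0.
have H0 v f : (0 <= H1norm (box 2) (shift_diff v f))%E by exact: poweR_ge0.
have l1' := le_trans l1 (lee_wpmul2l s0 (leeD h11 (lee_wpmul2l m2 (leeD h12 h13)))).
have l2' := le_trans l2 (lee_wpmul2l s0 (leeD h21 (lee_wpmul2l m2 (leeD h22 h23)))).
have lb := periodic_boundary_le (H0 _ _) (H0 _ _) (H0 _ _) (H0 _ _) m0 mN l1' l2'.
have le := quad_abs_le cphi; have lQ := box2_sqr_le cphi.
have := le; rewrite -lee_fin EFinD => /le_trans; apply.
rewrite -!addeA; apply: leeD; last by rewrite addeA; exact: lb.
rewrite EFinM.
apply: (@le_trans _ _ ((@average_bound R)%:E * Lpnorm 2%:E (box 5) (psi \- psih)%R ^+ 2)%E).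
  by apply: lee_wpmul2l; rewrite ?lee_fin ?A0.
have kb := ks0.
apply: lee_wpmul2r; first by rewrite expe_ge0// Lnorm_ge0.
by rewrite lee_fin /quad_bound -!addrA lerDl !addr_ge0// ?K0.
Qed.

End final_estimates.

Theorem theorem3p1 (R : realType) :
  [/\ forall n : nat, (1 <= n)%N ->
      forall phi : R * R -> R, Ck 2 (box n.+1) phi ->
      forall x, box n x -> pv_exists (box 1) (Lambda_integrand phi x),
      exists2 C : R, 0 < C &
        forall (k : nat) (a : nat * nat), (a.1 + a.2)%N = k ->
        forall phi : R * R -> R, Ck k.+2 (box 2) phi ->
        has_partials (box 1) a (Lambda phi) /\
        forall x, box 1 x ->
          (`|partials (box 1) a (Lambda phi) x|%:E
             <= C%:E * Wknorm k.+2 (box 2) phi)%E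
    & exists (A : (R * R -> R) -> R) (C : R),
      [/\ 0 < C,
          (* elements of C^2(5T^2) are functions on 5T^2: A must not see the
             values of their representatives outside of box 5 *)
          forall f g : R * R -> R, Ck 2 (box 5) f -> Ck 2 (box 5) g ->
            (forall x, box 5 x -> f x = g x) -> A f = A g,
          forall phi : R * R -> R, Ck 2 (box 5) phi ->
            A phi <= inner (box 1) phi (Lambda phi) /\
            (`|A phi|%:E
               <= C%:E * Lpnorm 2%:E (box 5) phi ^+ 2
                + C%:E * `|int_bdry (fun x nu =>
                     pv_int (box 1)
                       (fun y => dot y nu * phi (x + y) ^+ 2 / enorm y ^+ 3))|%:E)%E
        & forall psi psih : R * R -> R,
            biperiodic psi -> smooth (box 2) psih ->
            Ck 2 (box 5) (psi \- psih)%R ->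
            (`|A (psi \- psih)%R|%:E
               <= C%:E * Lpnorm 2%:E (box 5) (psi \- psih)%R ^+ 2
                + C%:E * H1norm (box 2) (shift_diff e1 (fun x => psih x ^+ 2)%R)
                + C%:E * H1norm (box 2) (shift_diff e2 (fun x => psih x ^+ 2)%R)
                + C%:E
                  * (Lpnorm +oo (box 1) psi
                     + Lpnorm +oo (box 1) (grad_norm (box 1) psi))
                  * (H1norm (box 2) (shift_diff e1 psih)
                     + H1norm (box 2) (shift_diff e2 psih)))%E]].
Proof.
split.
- move=> n n1 phi cphi x xn; case: n n1 cphi xn => // n _ cphi xn.
  by have [_ h _] := Lambda_pv cphi xn.
- exists (@Lconst R + 1); first by rewrite ltr_wpDl// Lconst_ge0.
  move=> k a <- phi cphi; split; first exact: (Lambda_partials cphi).1.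
  by move=> x x1; exact: Lambda_partials_le.
- exists quad_functional, (@quad_bound R); split.
  + exact: quad_bound_gt0.
  + by move=> f g _ _; exact: eq_quad_functional.
  + move=> phi c5; have c2 : Ck 2 (box 2) phi := Ck_box_le (isT : (1 < 5)%N) c5.
    split; first exact: quad_le_inner.
    have := quad_functional_le c2.
    by rewrite -(int_bdryE (Ck_pred (Ck_sqr c2))).
  + by move=> psi psih per sm c5; exact: quad_functional_periodic_le.
Qed.
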